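(* Let $\Omega\subset\mathbb{R}^d$ be a bounded Lipschitz domain, $T>0$, and let $a:\mathbb{R}\to\mathbb{R}^+$ be Lipschitz continuous with $m\le a(s)\le M$ for all $s\in\mathbb{R}$, where $0<m\le M<\infty$. Let $V_h$ be the space-time isogeometric space described in the context and let $f\in Z=L^2(0,T;L^2(\Omega))$. Then there exists $u_h\in V_h$ such that $$\int_0^T\int_\Omega \partial_t u_h\,v_h\,d\Omega\,dt+\int_0^T\int_\Omega a(l(u_h))\nabla u_h\cdot\nabla v_h\,d\Omega\,dt=\int_0^T\int_\Omega f v_h\,d\Omega\,dt\quad\forall v_h\in V_h,$$ where $l(v)=\int_\Omega v\,d\Omega$ (computed at each time $t$).
   Context: Isogeometric space: for integers $q\ge1$ and an open knot vector $\{0=\zeta_1\le\dots\le\zeta_{n+q+1}=1\}$ (first and last $q+1$ knots repeated) the univariate B-splines of degree $q$ are given by the Cox–de Boor recursion; we use maximal regularity, and spline spaces are assumed to be contained in $C^0$. Take $d$ spatial knot vectors with degree $q_s\ge1$ and one time knot vector with degree $q_t\ge1$, all quasi-uniform (there is $0<\alpha<1$ with every nonempty knot span of a spatial knot vector of length in $[\alpha h_s,h_s]$ and every nonempty knot span of the time knot vector of length in $[\alpha h_t,h_t]$); the tensor-product B-splines $\widehat B(\zeta,\tau)=\widehat b_{j_1}(\zeta_1)\cdots\widehat b_{j_d}(\zeta_d)\widehat b_{j_t}(\tau)$ span $\widehat{\mathcal S}_{h,\mathbf q}$ on $\widehat\Omega\times(0,1)$, $\widehat\Omega=(0,1)^d$.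 The spatial domain is parametrized by $\widehat{\mathbf F}:\widehat\Omega\to\Omega$ whose components lie in the spatial spline space and whose inverse has bounded piecewise derivatives of all orders; set $\widehat{\mathbf G}(\zeta,\tau)=(\widehat{\mathbf F}(\zeta),T\tau)$. Then $V_h=\{\widehat u\circ\widehat{\mathbf G}^{-1}:\widehat u\in\widehat{\mathcal S}_{h,\mathbf q},\ \widehat u=0 \text{ on }\partial\widehat\Omega\times(0,1),\ \widehat u=0\text{ on }\widehat\Omega\times\{0\}\}$. *)

(* Defs.v *)
From HB Require Import structures.
From mathcomp Require Import all_boot all_order all_algebra.
From mathcomp Require Import all_classical all_reals all_analysis.
Set Implicit Arguments. Unset Strict Implicit. Unset Printing Implicit Defensive.
Import Order.TTheory GRing.Theory Num.Theory.
Import numFieldNormedType.Exports.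
Local Open Scope classical_set_scope.
Local Open Scope ring_scope.

Section IGA.
Variable R : realType.

(* Open knot vector of degree q with maximal regularity:
   Xi = [0 (q+1 times), z_1 < ... < z_k, 1 (q+1 times)], i.e.
   Xi = nseq q 0 ++ br ++ nseq q 1 with br strictly increasing from 0 to 1
   (br = the breakpoints, 0 and 1 included). *)
Definition open_knots (q : nat) (Xi : seq R) : Prop :=
  exists br : seq R,
    [/\ (2 <= size br)%N, sorted (fun a b : R => a < b) br,
        head 0 br = 0, last 0 br = 1 &
        Xi = nseq q 0 ++ br ++ nseq q 1].

Definition quasi_uniform (alpha h : R) (Xi : seq R) : Prop :=
  forall i : nat, (i.+1 < size Xi)%N -> Xi`_i < Xi`_i.+1 ->
    alpha * h <= Xi`_i.+1 - Xi`_i <= h.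

(* Cox--de Boor recursion; the degree-0 functions are indicators of the
   half-open spans [Xi_i, Xi_{i+1}), except that the last nonempty span is
   closed at the right end point (usual convention).  Divisions by 0 give 0
   in MathComp (x / 0 = 0), which is the usual 0/0 := 0 convention. *)
Fixpoint cdb (Xi : seq R) (p i : nat) (x : R) : R :=
  match p with
  | 0 => if (Xi`_i <= x < Xi`_i.+1) ||
            [&& Xi`_i < Xi`_i.+1, x == Xi`_i.+1 & Xi`_i.+1 == last 0 Xi]
         then 1 else 0
  | p'.+1 =>
      (x - Xi`_i) / (Xi`_(i + p) - Xi`_i) * cdb Xi p' i x
      + (Xi`_(i + p + 1) - x) / (Xi`_(i + p + 1) - Xi`_i.+1) * cdb Xi p' i.+1 x
  end.

Definition bspline (Xi : seq R) (q i : nat) (x : R) : R :=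
  if (i < size Xi - q.+1)%N then cdb Xi q i x else 0.

Definition bspline_space (d : nat) (Xi : 'I_d -> seq R) (qs : nat)
    (J : 'I_d -> nat) (z : 'rV[R]_d) : R :=
  \prod_(k < d) bspline (Xi k) qs (J k) (z 0 k).

Definition spline_space (d : nat) (Xi : 'I_d -> seq R) (qs : nat)
    : set ('rV[R]_d -> R) :=
  [set g | exists s : seq (('I_d -> nat) * R),
     forall z, g z = \sum_(p <- s) p.2 * bspline_space Xi qs p.1 z].

Definition spline_spacetime (d : nat) (Xi : 'I_d -> seq R) (qs : nat)
    (Th : seq R) (qt : nat) : set ('rV[R]_d -> R -> R) :=
  [set g | exists s : seq (('I_d -> nat) * nat * R),
     forall z tau, g z tau =
       \sum_(p <- s) p.2 * bspline_space Xi qs p.1.1 z * bspline Th qt p.1.2 tau].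

Definition open_cube (d : nat) : set 'rV[R]_d :=
  [set z | forall k, 0 < z 0 k < 1].
Definition closed_cube (d : nat) : set 'rV[R]_d :=
  [set z | forall k, 0 <= z 0 k <= 1].
Definition cube_boundary (d : nat) : set 'rV[R]_d :=
  @closed_cube d `\` @open_cube d.

Definition mesh_elem (d : nat) (Xi : 'I_d -> seq R) (J : 'I_d -> nat)
    : set 'rV[R]_d :=
  [set z | forall k, (Xi k)`_(J k) < z 0 k < (Xi k)`_(J k).+1].

Definition evec (d : nat) (k : 'I_d) : 'rV[R]_d := delta_mx 0 k.

Fixpoint iderive (d : nat) (G : 'rV[R]_d -> 'rV[R]_d) (ds : seq 'I_d)
    : 'rV[R]_d -> 'rV[R]_d :=
  match ds with
  | [::] => G
  | k :: ds' => fun x => derive (iderive G ds') x (evec k)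
  end.

Definition bounded_derivatives_on (d : nat) (G : 'rV[R]_d -> 'rV[R]_d)
    (P : set 'rV[R]_d) : Prop :=
  forall ds : seq 'I_d,
    (forall x k, P x -> derivable (iderive G ds) x (evec k)) /\
    (exists C : R, forall x, P x -> `|iderive G ds x| <= C).

Definition dx (d : nat) (u : 'rV[R]_d -> R -> R) (k : 'I_d) (x : 'rV[R]_d)
    (t : R) : R := derive (fun y => u y t) x (evec k).
Definition dt (d : nat) (u : 'rV[R]_d -> R -> R) (x : 'rV[R]_d) (t : R) : R :=
  derive1 (u x) t.
Definition grad_dot (d : nat) (u v : 'rV[R]_d -> R -> R) x t : R :=
  \sum_(k < d) dx u k x t * dx v k x t.

Definition lipschitz_fun (d : nat) (g : 'rV[R]_d -> R) : Prop :=
  exists L : R, forall y y', `|g y - g y'| <= L * `|y - y'|.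

(* bounded, open, connected, and locally (after a rigid rotation) the
   subgraph of a Lipschitz function of the remaining d-1 coordinates *)
Definition lipschitz_domain (d : nat) (Om : set 'rV[R]_d) : Prop :=
  [/\ open Om, connected Om,
      (exists C : R, forall x, Om x -> `|x| <= C) &
      forall x0, closure Om x0 -> ~ Om x0 ->
        exists (r : R) (k0 : 'I_d) (Q : 'M[R]_d) (g : 'rV[R]_d -> R),
          [/\ 0 < r, Q *m Q^T = 1%:M, lipschitz_fun g,
              (forall y y' : 'rV[R]_d, (forall k, k != k0 -> y 0 k = y' 0 k) -> g y = g y') &
              forall x, `|x - x0| < r ->
                (Om x <-> ((x - x0) *m Q) 0 k0 < g ((x - x0) *m Q))]].

(* Integrals: the d-dimensional Lebesgue integral is written as the     *)
(* iterated one-dimensional Lebesgue integral (Fubini).                *)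
Fixpoint iint (n : nat) : ('rV[R]_n -> R) -> R :=
  match n return ('rV[R]_n -> R) -> R with
  | 0 => fun g => g 0
  | n'.+1 => fun g =>
      Rintegral lebesgue_measure setT
        (fun a : R => iint (fun y : 'rV[R]_n' => g (row_mx (const_mx a : 'rV[R]_1) y)))
  end.

Fixpoint ieint (n : nat) : ('rV[R]_n -> \bar R) -> \bar R :=
  match n return ('rV[R]_n -> \bar R) -> \bar R with
  | 0 => fun g => g 0
  | n'.+1 => fun g =>
      (\int[lebesgue_measure]_(a in setT)
        ieint (fun y : 'rV[R]_n' => g (row_mx (const_mx a : 'rV[R]_1) y)))%E
  end.

Definition int_Omega (d : nat) (Om : set 'rV[R]_d) (g : 'rV[R]_d -> R) : R :=
  iint (fun x => \1_Om x * g x).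

Definition int_Q (d : nat) (Om : set 'rV[R]_d) (T : R)
    (g : 'rV[R]_d -> R -> R) : R :=
  Rintegral lebesgue_measure `]0, T[ (fun t => int_Omega Om (fun x => g x t)).

Definition in_Z (d : nat) (Om : set 'rV[R]_d) (T : R)
    (f : 'rV[R]_d -> R -> R) : Prop :=
  (forall B : set R, open B ->
     <<s open>> ((fun p : 'rV[R]_d * R =>
                    \1_(Om `*` `]0, T[) p * f p.1 p.2) @^-1` B)) /\
  (\int[lebesgue_measure]_(t in `]0%R, T[)
      ieint (fun x => (\1_Om x * f x t ^+ 2)%:E) < +oo)%E.

(* u in V_h iff u = uhat o G^{-1} on Omega x (0,T), G(z,tau) = (F z, T tau),
   with uhat in \hat S_{h,q}, uhat = 0 on bd(\hat Omega) x (0,1) and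
   uhat = 0 on \hat Omega x {0}.  Values of u outside Omega x (0,T) are
   irrelevant. *)
Definition Vh (d : nat) (Xi : 'I_d -> seq R) (qs : nat) (Th : seq R)
    (qt : nat) (F : 'rV[R]_d -> 'rV[R]_d) (T : R)
    : set ('rV[R]_d -> R -> R) :=
  [set u | exists uh : 'rV[R]_d -> R -> R,
     [/\ spline_spacetime Xi qs Th qt uh,
         (forall z tau, @cube_boundary d z -> 0 < tau < 1 -> uh z tau = 0),
         (forall z, @open_cube d z -> uh z 0 = 0) &
         (forall z tau, @open_cube d z -> 0 < tau < 1 ->
            u (F z) (T * tau) = uh z tau)]].

End IGA.
Arguments open_cube {R} d.
Arguments closed_cube {R} d.
Arguments cube_boundary {R} d.

(* Main.v *)
Require Import Defs.
From HB Require Import structures.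
From mathcomp Require Import all_boot all_order all_algebra.
From mathcomp Require Import zify ring lra.
From mathcomp Require Import all_classical all_reals all_analysis.
From mathcomp Require Import measurable_realfun.
Import Order.TTheory GRing.Theory Num.Theory.
Import numFieldNormedType.Exports.

(* In the coefficients of u_h the Galerkin equations form a finite nonlinear system
   P(c) = 0 with P continuous, since a(l(u_h(t))) depends Lipschitz-continuously on c.

   For d >= 1 the map P is coercive: the time term tested with u_h equals half the square
   of the L^2 norm of u_h(T), hence is nonnegative, and the diffusion term is at least m
   times the gradient energy, which is definite on V_h because the geometry map has
   invertible derivative off the mesh lines and u_h vanishes on the boundary. A coercive
   continuous map has a zero; this follows from Scarf's lemma on dominating sets, proved
   by a Sperner parity count.

   For d = 0 there is no diffusion and the system is linear, so it suffices that a degree-q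
   spline u with u(0) = 0, orthogonal to w' for all degree-q splines w with w(0) = 0,
   vanishes. Let h be the q-fold antiderivative of u that is flat at 0. Orthogonality to
   truncated powers makes h vanish at every knot and all its derivatives of order < q vanish
   at the right end. On a maximal run of knot spans where h is not identically zero, iterating
   Rolle then forces more sign changes of h^(2q) than there are spans for its constant
   values. *)

(** * Zeros of coercive maps *)

(** Three obstacles shape the proof. The integrals of the statement are iterated real integrals, and
    the derivatives in them take default values wherever a spline has a kink; each integral is
    therefore compared, off a null set, with an integral against a genuine product measure. Of the
    geometry map only Lipschitz continuity, injectivity and directional derivatives of its inverse
    are at hand; so measurability of images comes from compactness, and openness from a
    least-squares argument. Finally, a function does not determine its coefficient vector, so the
    system is solved modulo the vectors whose spline vanishes, and the lower bound for the nonlinear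
    form is a quadratic form, whose minimum over a sphere controls all large vectors. In dimension 0
    testing with [u] itself gives only half of [u(T)^2], which vanishes for many nonzero [u]; hence
    a separate injectivity argument, in which integration by parts against truncated powers turns
    orthogonality into point values. *)

Section Dominating.
Context (V I : finType) (r : I -> V -> nat).
Hypothesis r_inj : forall i, injective (r i).

(** Scarf's notion: no point of [V] lies strictly above the minimum of [S] in every order at
    once. *)
Definition dominating (S : {set V}) : bool :=
  [forall y, [exists i, [forall s in S, (r i y <= r i s)%N]]].

Lemma dominatingP (S : {set V}) :
  reflect (forall y, exists i, forall s, s \in S -> (r i y <= r i s)%N)
          (dominating S).
Proof.
apply: (iffP forallP) => H y.
  have /existsP[i /forall_inP Hi] := H y.
  by exists i.
by have [i Hi] := H y; apply/existsP; exists i; apply/forall_inP.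
Qed.

Lemma dominating_sub (S S' : {set V}) :
  S \subset S' -> dominating S' -> dominating S.
Proof.
move=> /fintype.subsetP sub /dominatingP H; apply/dominatingP => y.
by have [i Hi] := H y; exists i => s /sub; apply: Hi.
Qed.

(** Such a [y] can be dominated by [S] only through the order [i]; these are the candidates for a
    new point that takes over the minimum of order [i]. *)
Definition overtakes (S : {set V}) (i : I) (y : V) : bool :=
  [forall j, (j != i) ==> [exists s in S, (r j s < r j y)%N]].

Section Door.
Context (S : {set V}) (s0 : V).
Hypotheses (s0S : s0 \in S) (domS : dominating S) (cardS : #|S|.+1 = #|I|).

Let mn i : V := [arg min_(s < s0 in S) r i s]%N.

Let mnS i : mn i \in S.
Proof. by rewrite /mn; case: arg_minnP. Qed.

Let mn_le i s : s \in S -> (r i (mn i) <= r i s)%N.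
Proof. by rewrite /mn; case: arg_minnP => // j _ H; apply: H. Qed.

Let mn_uniq i s : s \in S -> (forall s', s' \in S -> (r i s <= r i s')%N) ->
  mn i = s.
Proof.
move=> sS H; apply: (r_inj i); apply/eqP.
by rewrite eqn_leq mn_le // H.
Qed.

Let above i : {set V} := [set y | overtakes S i y].

Let aboveP i y :
  reflect (forall j, j != i -> (r j (mn j) < r j y)%N) (y \in above i).
Proof.
rewrite inE; apply: (iffP forallP) => H j.
  move=> ji; have := H j; rewrite ji => /exists_inP[s sS].
  by apply: leq_ltn_trans; apply: mn_le.
by apply/implyP => /H lt; apply/exists_inP; exists (mn j).
Qed.

Let top i : {set V} :=
  [set x in above i | [forall y in above i, (r i y <= r i x)%N]].

Let in_top i x :
  (x \in top i) = (x \in above i) && [forall y in above i, (r i y <= r i x)%N].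
Proof. by rewrite inE. Qed.

Let card_top i : #|top i| = (above i != finset.set0).
Proof.
have [E|[x xM]] := set_0Vmem (above i).
  rewrite E eqxx; apply/eqP; rewrite cards_eq0; apply/eqP/finset.setP => x.
  by rewrite in_top E !inE.
have -> : above i != finset.set0 by apply/set0Pn; exists x.
apply/eqP/cards1P.
pose m := [arg max_(y > x in above i) r i y]%N.
have [mM mmax] : m \in above i /\ forall y, y \in above i -> (r i y <= r i m)%N.
  by rewrite /m; case: arg_maxnP => // y ? H; split => // z /H.
exists m; apply/finset.setP => y; rewrite in_top finset.in_set1; apply/andP/eqP.
  case=> yM /forall_inP ymax; apply: (r_inj i); apply/eqP.
  by rewrite eqn_leq mmax //= ymax.
by move=> ->; split => //; apply/forall_inP.
Qed.

(** A door is a dominating set with one point fewer than there are orders, a room one with as many.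
    Domination of its own points makes every point of a door minimal in some order, so [mn] maps the
    orders onto the door and exactly two orders share their minimum. A point that enlarges the door
    to a room takes over the minimum of one of these two, and is then the largest point overtaking
    in that order; so each of the two orders contributes at most one room. *)
Lemma door_rooms : exists i1 i2,
  [/\ i1 != i2,
   exists2 s, s \in S & forall s', s' \in S -> (r i1 s <= r i1 s')%N /\ (r i2 s <= r i2 s')%N &
   #|[set x | (x \notin S) && dominating (x |: S)]| =
     ([exists y, overtakes S i1 y] + [exists y, overtakes S i2 y])%N].
Proof.
have mn_onto s : s \in S -> exists i, mn i = s.
  move=> sS; have [i Hi] := dominatingP _ domS s; exists i.
  exact: mn_uniq.
have imS : mn @: [set: I] = S.
  apply/finset.setP => s; apply/imsetP/idP => [[i _ ->]//|/mn_onto[i <-]].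
  by exists i.
have /injectivePn[i1 [i2 i12 mn12]] : ~~ injectiveb mn.
  apply/negP => /injectiveP minj.
  by move: cardS; rewrite -imS card_imset // cardsT => /eqP; rewrite eqn_leq ltnn.
have inj_off i j : i != j -> mn i = mn j -> {in [set~ i] &, injective mn}.
  move=> ij e; apply/imset_injP.
  have -> : mn @: [set~ i] = S.
    rewrite -imS; apply/finset.setP => s; apply/imsetP/imsetP => [[k _ ->]|[k _ ->]].
      by exists k.
    have [->|ki] := eqVneq k i; last by exists k => //; rewrite !inE.
    by exists j => //; rewrite !inE eq_sym.
  by rewrite cardsC1 -cardS.
have inj1 := inj_off _ _ i12 mn12.
have i21 : i2 != i1 by rewrite eq_sym.
have inj2 := inj_off _ _ i21 (esym mn12).
have top_room i j x : i != j -> mn i = mn j -> x \in top i ->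
    (x \notin S) && dominating (x |: S).
  move=> ij e; rewrite in_top => /andP[/aboveP xM /forall_inP xmax].
  have ji : j != i by rewrite eq_sym.
  apply/andP; split.
    apply/negP => xS.
    have [k kx] := mn_onto _ xS.
    have kI : k = i.
      by apply/eqP/negPn/negP => /xM; rewrite kx ltnn.
    by have := xM _ ji; rewrite -e -kI kx ltnn.
  apply/dominatingP => y.
  have [yM|] := boolP (y \in above i).
    exists i => s; rewrite !inE => /orP[/eqP->|sS]; first exact: xmax.
    have [k Hk] := dominatingP _ domS y.
    have ki : k = i.
      apply/eqP/negPn/negP => /(aboveP _ _ yM).
      by rewrite ltnNge Hk.
    by rewrite -ki; apply: Hk.
  rewrite inE negb_forall => /existsP[k]; rewrite negb_imply => /andP[ki].
  rewrite negb_exists_in => /forall_inP /(_ _ (mnS k)); rewrite -leqNgt => le.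
  exists k => s; rewrite !inE => /orP[/eqP->|sS].
    by apply: leq_trans le _; apply/ltnW/xM.
  by apply: leq_trans le _; apply: mn_le.
have room_top x : x \notin S -> dominating (x |: S) ->
    x \in top i1 :|: top i2.
  move=> xS xdom.
  have [i Hi] := dominatingP _ xdom x.
  have loc s : s \in S -> exists2 j, j != i & (mn j = s) /\ (r j s < r j x)%N.
    move=> sS; have [j Hj] := dominatingP _ xdom s.
    have jm : mn j = s.
      by apply: mn_uniq => // s' s'S; apply: Hj; rewrite !inE s'S orbT.
    have lt : (r j s < r j x)%N.
      rewrite ltn_neqAle Hj ?inE ?eqxx // andbT.
      by apply/eqP => /r_inj sx; move: xS; rewrite -sx sS.
    exists j => //; apply/eqP => ji; subst j.
    by move: lt; rewrite ltnNge Hi // !inE sS orbT.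
  (* Had [x] taken the minimum of any other order, the orders left would still contain the
     coinciding pair and could not serve all points of [S]. *)
  have ii : (i == i1) || (i == i2).
    apply/negPn/negP; rewrite negb_or => /andP[n1 n2].
    have : (#|S| <= #|[set~ i] :\ i1|)%N.
      have sub : S \subset mn @: ([set~ i] :\ i1).
        apply/fintype.subsetP => s /loc[j ji [<- _]].
        have [->|j1] := eqVneq j i1.
          by rewrite mn12; apply: finset.imset_f; rewrite !inE i21 eq_sym n2.
        by apply: finset.imset_f; rewrite !inE j1.
      exact: leq_trans (subset_leq_card sub) (leq_imset_card _ _).
    have := cardsD1 i1 [set~ i]; rewrite !inE eq_sym n1 cardsC1 -cardS /= => ->.
    by rewrite ltnn.
  have xtop : (forall k k', k \notin [set i] -> k' \notin [set i] ->
      mn k = mn k' -> k = k') -> x \in top i.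
    move=> inj; rewrite in_top; apply/andP; split.
      apply/aboveP => j ji.
      have [j' j'i [e lt]] := loc _ (mnS j).
      by rewrite -(inj j' j _ _ e) ?finset.in_set1 // e.
    apply/forall_inP => y /aboveP yM.
    have [k Hk] := dominatingP _ xdom y.
    have ki : k = i.
      apply/eqP/negPn/negP => /yM; rewrite ltnNge Hk // !inE mnS orbT //.
    by rewrite -ki; apply: Hk; rewrite !inE eqxx.
  rewrite finset.in_setU; case/orP: ii => /eqP ei; rewrite -ei xtop ?orbT // ei => k k'.
    by rewrite !finset.in_set1 => k1 k1' e; apply: inj1; rewrite // !inE.
  by rewrite !finset.in_set1 => k1 k1' e; apply: inj2; rewrite // !inE.
exists i1, i2; split => //.
  exists (mn i1) => // s' sS; split; first exact: mn_le.
  by rewrite mn12; apply: mn_le.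
have exE i : [exists y, overtakes S i y] = (above i != finset.set0).
  apply/existsP/set0Pn => [[y Hy]|[y]]; first by exists y; rewrite inE.
  by rewrite inE => Hy; exists y.
rewrite !exE.
have -> : [set x | (x \notin S) && dominating (x |: S)] = top i1 :|: top i2.
  apply/finset.setP => x; apply/idP/idP.
    by rewrite inE => /andP[xS xd]; apply: room_top.
  rewrite finset.in_setU inE => /orP[] xt.
    exact: (top_room i1 i2).
  exact: (top_room i2 i1).
rewrite cardsU !card_top.
(* A point overtaking in both orders would exceed the minimum of [S] in every order. *)
suff -> : top i1 :&: top i2 = finset.set0 by rewrite cards0 subn0.
apply/finset.setP => x; rewrite [RHS]inE; apply/negP; rewrite finset.in_setI !in_top.
case/andP=> /andP[/aboveP M1 _] /andP[/aboveP M2 _].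
have [k Hk] := dominatingP _ domS x.
have [ki|ki] := eqVneq k i1.
  by have := M2 k; rewrite ltnNge Hk // ki => /(_ i12).
by have := M1 k; rewrite ltnNge Hk // => /(_ ki).
Qed.

End Door.

(* Sperner parity: count pairs (S, x) where S is a door coloured by all colours but i0
   and x |: S is dominating, once by doors and once by the rooms x |: S. *)
Lemma full_colored_room (col : V -> I) (i0 : I) (S0 : {set V}) :
  #|S0|.+1 = #|I| -> col @: S0 = [set~ i0] ->
  odd #|[set x | (x \notin S0) && dominating (x |: S0)]| ->
  (forall S : {set V}, #|S|.+1 = #|I| -> dominating S -> col @: S = [set~ i0] -> S != S0 ->
     ~~ odd #|[set x | (x \notin S) && dominating (x |: S)]|) ->
  exists R : {set V}, [/\ dominating R, #|R| = #|I| & col @: R = [set: I]].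
Proof.
move=> cS0 colS0 oddS0 evenS.
pose door (S : {set V}) := (#|S|.+1 == #|I|) && (col @: S == [set~ i0]).
pose rooms (S : {set V}) := [set x | (x \notin S) && dominating (x |: S)].
pose room (R : {set V}) := (#|R| == #|I|) && dominating R.
pose doors (R : {set V}) := [set x in R | col @: (R :\ x) == [set~ i0]].
have dbl : (\sum_(S | door S) #|rooms S| = \sum_(R | room R) #|doors R|)%N.
  under eq_bigr do rewrite -sum1_card.
  under [RHS]eq_bigr do rewrite -sum1_card.
  rewrite !pair_big_dep /=.
  rewrite (reindex_onto (fun p : {set V} * V => (p.1 :\ p.2, p.2))
            (fun p : {set V} * V => (p.2 |: p.1, p.2))) /=; last first.
    move=> [S x] /=; rewrite inE => /andP[_ /andP[xS _]].
    by rewrite setU1K.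
  apply: eq_bigl => -[R x] /=; rewrite !inE /= eqxx /= xpair_eqE eqxx andbT /door /room.
  apply/idP/idP.
    case/andP=> /andP[/andP[cR colR] domR] /eqP ER.
    have xR : x \in R by rewrite -ER !inE eqxx.
    rewrite ER in domR; rewrite domR xR colR !andbT.
    by rewrite (cardsD1 x R) xR add1n.
  case/andP=> /andP[cR domR] /andP[xR colR].
  by rewrite finset.setD1K // domR eqxx colR !andbT -(eqP cR) (cardsD1 x R) xR.
have odd_doors : odd (\sum_(S | door S) #|rooms S|)%N.
  have dS0 : door S0 by rewrite /door cS0 colS0 !eqxx.
  rewrite (bigD1 S0) //= oddD oddS0 /=.
  apply: (big_ind (fun m => ~~ odd m)) => //.
    by move=> a b ha hb; rewrite oddD (negbTE ha) (negbTE hb).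
  move=> S /andP[/andP[/eqP cS /eqP colS] SS0].
  have [x|no] := pickP [pred x in rooms S].
    rewrite !inE => /andP[_ dx]; apply: evenS => //.
    by apply: dominating_sub dx; apply: finset.subsetUr.
  by rewrite eq_card0.
have [R roomR oddR] : exists2 R, room R & odd #|doors R|.
  have [R /andP[H1 H2]|no] := pickP [pred R | room R & odd #|doors R|].
    by exists R.
  move: odd_doors; rewrite dbl => o; exfalso; move: o; apply/negP.
  apply: (big_ind (fun m => ~~ odd m)) => //.
    by move=> a b ha hb; rewrite oddD (negbTE ha) (negbTE hb).
  by move=> R rR; apply/negP => oR; have := no R; rewrite /= rR oR.
case/andP: roomR => /eqP cR domR.
exists R; split => //.
have [x xd] : exists x, x \in doors R.
  by apply/set0Pn/eqP => E; rewrite E cards0 in oddR.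
move: (xd); rewrite inE => /andP[xR /eqP colx].
have colR : col @: R = col x |: [set~ i0].
  by rewrite -colx -imsetU1 finset.setD1K.
have [cx|cx] := eqVneq (col x) i0.
  rewrite colR cx; apply/finset.setP => i; rewrite !inE.
  by case: eqP.
(* If the removed point has a colour other than [i0], exactly one other point shares its colour, and
   removing either of the two leaves a door: the number of doors is two, hence even. *)
exfalso.
have inj : {in R :\ x &, injective col}.
  apply/imset_injP; rewrite colx cardsC1 -cR.
  by rewrite (cardsD1 x R) xR.
have : col x \in col @: (R :\ x) by rewrite colx !inE.
case/imsetP=> x' x'R cx'.
move: (x'R); rewrite !inE => /andP[x'x x'R0].
suff E : doors R = [set x; x'] by move: oddR; rewrite E cards2 eq_sym x'x.
have swap z : z \in R -> (col @: (R :\ z) == [set~ i0]) = (z == x) || (z == x').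
  move=> zR; have [->|zx] := eqVneq z x; first by rewrite colx eqxx.
  have [->|zx'] /= := eqVneq z x'.
    apply/eqP; rewrite -colx; apply/finset.setP => i.
    apply/imsetP/imsetP => -[y]; rewrite !inE => /andP[y1 y2] ->.
      have [->|yx] := eqVneq y x; first by exists x'; rewrite // !inE x'x.
      by exists y; rewrite // !inE yx.
    have [->|yx] := eqVneq y x'; first by exists x; rewrite // !inE eq_sym x'x.
    by exists y; rewrite // !inE yx.
  apply/negP => /eqP colz.
  have : col z \in col @: (R :\ x) by apply: finset.imset_f; rewrite !inE zx.
  rewrite colx -colz => /imsetP[w]; rewrite !inE => /andP[wz wR] e.
  have zR' : z \in R :\ x by rewrite !inE zx.
  have [wx|wx] := eqVneq w x.
    by move/eqP: zx'; apply; apply: (inj _ _ zR' x'R); rewrite e wx.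
  have wR' : w \in R :\ x by rewrite !inE wx.
  by move/eqP: wz; apply; apply: (inj _ _ wR' zR').
apply/finset.setP => z; rewrite !inE.
have [zR|zR] /= := boolP (z \in R); first exact: swap.
by apply/esym/negbTE; apply: contra zR => /orP[]/eqP->.
Qed.

End Dominating.

Local Open Scope ring_scope.

Lemma ltn_lex (a b a' b' N : nat) :
  (a < a')%N -> (b < N)%N -> (a * N + b < a' * N + b')%N.
Proof. by move=> aa' bN; nia. Qed.

(** * Scarf's lemma on the grid points of a simplex *)

Section Grid.
Context (n k : nat).
Hypothesis n_gt0 : (0 < n)%N.
Notation I := 'I_n.+1.
Notation T := {x : {ffun I -> 'I_k.+1} | \sum_i (x i : nat) == k :> nat}%N.
Notation V := (T + I)%type.

(* The points [inr j] are Scarf's slack vectors: least in the order j, above all grid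
   points in the other orders. *)
Definition grid_rank (i : I) (v : V) : nat :=
  match v with
  | inl x => (1 + (sval x i * #|{: T}| + enum_rank x))%N
  | inr j => if j == i then 0%N else (1 + (k.+1 * #|{: T}| + j))%N
  end.

Lemma grid_rank_bound i (x : T) j : j != i ->
  (grid_rank i (inl x) < grid_rank i (inr j))%N.
Proof.
move=> /negbTE ji; rewrite /= ji ltn_add2l.
exact: ltn_lex.
Qed.

Lemma grid_rank_lt i (x y : T) : (sval x i < sval y i)%N ->
  (grid_rank i (inl x) < grid_rank i (inl y))%N.
Proof.
move=> lt; rewrite /= ltn_add2l.
exact: ltn_lex.
Qed.

Lemma grid_rank_inj i : injective (grid_rank i).
Proof.
move=> [x|j] [y|l].
- move=> /= /eqP; rewrite eqn_add2l => /eqP e; congr inl.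
  apply: enum_rank_inj; apply/val_inj => /=.
  have := congr1 (modn^~ #|{: T}|) e.
  by rewrite !modnMDl !modn_small // ltn_ord.
- have [->|li] := eqVneq l i; first by rewrite /= eqxx.
  by move=> e; have := grid_rank_bound i x l li; rewrite e ltnn.
- have [->|li] := eqVneq j i; first by rewrite /= eqxx.
  by move=> e; have := grid_rank_bound i y j li; rewrite e ltnn.
- rewrite /=; case: eqP => [->|_]; case: eqP => [->|_] //.
  by move=> /eqP; rewrite !eqn_add2l => /eqP/val_inj ->.
Qed.

Context (c : T -> I).

Definition grid_color (v : V) : I := match v with inl x => c x | inr i => i end.

Let i0 : I := ord0.
Let S0 : {set V} := inr @: [set~ i0].

Let inrS0 i : (inr i \in S0) = (i != i0).
Proof.
apply/imsetP/idP => [[j]|ii]; first by rewrite !inE => ji [->].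
by exists i; rewrite // !inE.
Qed.

Let inlS0 x : (inl x \in S0) = false.
Proof. by apply/negP => /imsetP[]. Qed.

Let T0 : T.
Proof.
exists [ffun i => if i == i0 then ord_max else ord0].
rewrite (bigD1 i0) //= ffunE eqxx big1 ?addn0 // => i /negbTE ii.
by rewrite ffunE ii.
Qed.

Let cardS0 : #|S0|.+1 = #|{: I}|.
Proof. by rewrite card_imset; [rewrite cardsC1 card_ord | move=> ? ? []]. Qed.

Let domS0 : dominating _ _ grid_rank S0.
Proof.
apply/dominatingP => -[x|j].
  exists i0 => -[y|l]; first by rewrite inlS0.
  by rewrite inrS0 => li; apply/ltnW/grid_rank_bound.
by exists j => s _; rewrite /= eqxx.
Qed.

Let rooms (S : {set V}) := #|[set x | (x \notin S) && dominating _ _ grid_rank (x |: S)]|.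

(** In each order [i] other than [i0] the slack vector of [i] is the minimum of [S0], so the
    coinciding pair consists of [i0] and one further order. Grid points overtake in order [i0]; in
    the further order nothing does, because in order [i0] slack vectors lie above all grid points.
    This single room is the odd one of the parity count. *)
Let rooms_S0 : rooms S0 = 1%N.
Proof.
have [s1 s1S0] : exists s, s \in S0.
  have lt : (1 < n.+1)%N by [].
  by exists (inr (Ordinal lt)); rewrite inrS0.
have [i1 [i2 [i12 [s sS0 smin] cardE]]] := door_rooms _ _ _ grid_rank_inj _ _ s1S0 domS0 cardS0.
rewrite /rooms cardE.
have zero i s' : i != i0 -> s' \in S0 ->
    (forall s, s \in S0 -> (grid_rank i s' <= grid_rank i s)%N) -> s' = inr i.
  move=> ii s'S H; apply: (grid_rank_inj i).
  have := H (inr i); rewrite inrS0 ii => /(_ isT).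
  by rewrite /= eqxx leqn0 => /eqP.
have yes : [exists y, overtakes _ _ grid_rank S0 i0 y].
  apply/existsP; exists (inl T0); apply/forallP => j; apply/implyP => ji.
  by apply/exists_inP; exists (inr j); rewrite ?inrS0 //= eqxx.
have no j : j != i0 -> s = inr j ->
    (forall s', s' \in S0 -> (grid_rank i0 s <= grid_rank i0 s')%N) ->
    [exists y, overtakes _ _ grid_rank S0 j y] = false.
  move=> ji sj smin0; apply/negbTE/negP. move=> /fintype.existsP[y]; rewrite /overtakes => /forallP Hy.
  have Y0 i : i != j -> y != inr i.
    move=> ij; apply/eqP => yi; have := Hy i; rewrite ij /= => /exists_inP[s' _].
    by rewrite yi /= eqxx.
  have := Hy i0; rewrite eq_sym ji /= => /exists_inP[s' s'S].
  case: y Y0 {Hy} => [x|l] Y0.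
    case: s' s'S => [x'|i]; first by rewrite inlS0.
    by rewrite inrS0 => ii; rewrite ltnNge ltnW // grid_rank_bound.
  have [<-|lj] := eqVneq j l; last by have := Y0 l; rewrite eq_sym lj eqxx => /(_ isT).
  by rewrite -sj ltnNge smin0.
have min1 s' : s' \in S0 -> (grid_rank i1 s <= grid_rank i1 s')%N by move=> /smin[].
have min2 s' : s' \in S0 -> (grid_rank i2 s <= grid_rank i2 s')%N by move=> /smin[].
have [e1|n1] := eqVneq i1 i0.
  have n2 : i2 != i0 by rewrite -e1 eq_sym.
  rewrite e1 yes (no i2) ?addn0 //; first exact: zero.
  by rewrite -e1.
have s1E := zero _ _ n1 sS0 min1.
have [e2|n2] := eqVneq i2 i0.
  rewrite e2 yes (no i1) ?addn0 // -e2 //.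
have s2E := zero _ _ n2 sS0 min2.
by move: i12; rewrite s1E in s2E; case: s2E => ->; rewrite eqxx.
Qed.

(** A door with these colours that differs from [S0] contains a grid point; then the slack vector of
    [i] overtakes in order [i], for both orders of the coinciding pair. *)
Let rooms_inner (S : {set V}) : #|S|.+1 = #|{: I}| -> dominating _ _ grid_rank S ->
  grid_color @: S = [set~ i0] -> S != S0 -> rooms S = 2.
Proof.
move=> cS dS colS SS0.
have [x xS] : exists x, inl x \in S.
  have [x ex|no] := pickP [pred x | inl x \in S]; first by exists x.
  exfalso; move/eqP: SS0; apply; apply/finset.setP => -[x|i].
    by rewrite inlS0; have := no x; rewrite /= => ->.
  rewrite inrS0; have -> : (i != i0) = (i \in grid_color @: S) by rewrite colS !inE.
  apply/idP/imsetP => [iS|[[x|j]]]; first by exists (inr i).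
    by have := no x; rewrite /= => ->.
  by move=> jS /= ->.
have [i1 [i2 [i12 _ cardE]]] := door_rooms _ _ _ grid_rank_inj _ _ xS dS cS.
rewrite /rooms cardE.
have yes i : [exists y, overtakes _ _ grid_rank S i y].
  apply/existsP; exists (inr i); apply/forallP => j; apply/implyP => ji.
  by apply/exists_inP; exists (inl x) => //; apply: grid_rank_bound; rewrite eq_sym.
by rewrite !yes.
Qed.

(** Domination makes a fully coloured set [R] narrow. For the orders whose slack vector is absent
    from [R], let [m i] be the least [i]-th coordinate of its grid points: these numbers nearly add
    up to [k], so every coordinate is known up to [n]. A coordinate above [n] rules out the slack
    vector of that index, and its colour must sit on a grid point. *)
Lemma grid_full_colored : exists x : T, forall i, (n < sval x i)%N ->
  exists x' : T, c x' = i /\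
    forall j, (sval x j <= sval x' j + n)%N /\ (sval x' j <= sval x j + n)%N.
Proof.
have colS0 : grid_color @: S0 = [set~ i0].
  apply/finset.setP => i; apply/imsetP/idP => [[[x|j]]|].
  - by rewrite inlS0.
  - by rewrite inrS0 !inE => ji /= ->.
  by rewrite !inE => ii; exists (inr i) => //; rewrite inrS0.
have [R [domR cR colR]] : exists R : {set V},
    [/\ dominating _ _ grid_rank R, #|R| = #|{: I}| & grid_color @: R = [set: I]].
  apply: (full_colored_room _ _ _ grid_color i0 S0) => //.
    by rewrite -/(rooms S0) rooms_S0.
  by move=> S h1 h2 h3 h4; rewrite -/(rooms S) rooms_inner.
have [x0 x0R] : exists x, inl x \in R.
  have [i Hi] := dominatingP _ _ _ _ domR (inl T0).
  have iR : i \in grid_color @: R by rewrite colR inE.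
  case/imsetP: iR => -[x|j] jR; first by exists x.
  by move=> /= ij; have := Hi _ jR; rewrite -ij /= eqxx.
pose C i := inr i \notin R.
pose mx i := [arg min_(x < x0 | inl x \in R) (sval x i : nat)]%N.
have mxP i : inl (mx i) \in R /\ forall x, inl x \in R -> (sval (mx i) i <= sval x i)%N.
  by rewrite /mx; case: arg_minnP.
pose m i := (sval (mx i) i : nat).
(* Otherwise the numbers [(m i).+1], with the remainder put on coordinate [i0], form a grid point
   above the minimum of [R] in every order. *)
have big_m : (k < \sum_(i < n.+1 | C i) (m i).+1)%N.
  rewrite ltnNge; apply/negP => le.
  pose yf i := ((if C i then (m i).+1 else 0) +
    (if i == i0 then k - \sum_(i < n.+1 | C i) (m i).+1 else 0))%N.
  have sum_yf : (\sum_i yf i = k)%N.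
    rewrite /yf big_split /= -big_mkcond -[X in (_ + X)%N]big_mkcond big_pred1_eq.
    by rewrite subnKC.
  have yf_le i : (yf i < k.+1)%N.
    by rewrite ltnS -sum_yf (bigD1 i) //= leq_addr.
  have yP : (\sum_i ([ffun i => Ordinal (yf_le i)] i : nat) == k)%N.
    by under eq_bigr do rewrite ffunE; rewrite sum_yf.
  pose y : T := exist _ [ffun i => Ordinal (yf_le i)] yP.
  have [i Hi] := dominatingP _ _ _ _ domR (inl y).
  have Ci : C i by apply/negP => /Hi; rewrite /= eqxx.
  have := Hi _ (mxP i).1; rewrite leqNgt grid_rank_lt //.
  by rewrite /y /= ffunE /= /yf Ci -/(m i) leq_addr.
have card_C : (\sum_(i < n.+1 | C i) 1 <= n.+1)%N.
  rewrite -[X in (_ <= X)%N]card_ord -sum1_card [leqRHS](bigID C) /=.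
  by rewrite leq_addr.
have close x j : inl x \in R ->
    (if C j then (m j <= sval x j <= m j + n)%N else (sval x j <= n)%N).
  move=> xR; have := big_m; under eq_bigr do rewrite -addn1.
  rewrite big_split /= => lt.
  have : (\sum_(i < n.+1 | C i) m i + (sval x j : nat) <= k + (if C j then m j else 0))%N.
    rewrite -[X in (_ <= X + _)%N](eqP (svalP x)).
    rewrite [X in (_ <= X + _)%N](bigD1 j) //= [X in (X + _ <= _)%N]big_mkcond /=.
    rewrite [X in (X + _ <= _)%N](bigD1 j) //=.
    rewrite addnC -!addnA leq_add2l addnC leq_add2r.
    apply: leq_sum => i _; case: ifP => // _; exact: (mxP i).2.
  have arith (u v w z : nat) : (k < u + v)%N -> (v <= n.+1)%N ->
    (u + w <= k + z)%N -> (w <= z + n)%N by lia.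
  move=> /(arith _ _ _ _ lt card_C); case: ifP => Cj // le.
  by rewrite (mxP j).2.
exists x0 => i lt.
have Ci : C i.
  by have := close _ i x0R; case: ifP => // _; rewrite leqNgt lt.
have iR : i \in grid_color @: R by rewrite colR inE.
case/imsetP: iR => -[x'|j] jR.
  move=> /= ci; exists x'; split => // j.
  have arith (u v w z : nat) : (w <= u <= w + z)%N -> (w <= v <= w + z)%N -> (u <= v + z)%N by lia.
  have := close _ j x0R; have := close _ j jR; case: ifP => _ h1 h2.
    by rewrite !(arith _ _ _ _ h1 h2, arith _ _ _ _ h2 h1).
  by rewrite (leq_trans h1) ?(leq_trans h2) ?leq_addl.
by move=> /= ij; move: Ci; rewrite /C ij jR.
Qed.

End Grid.

Local Open Scope classical_set_scope.
Local Open Scope ring_scope.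

(** * From colourings to zeros of continuous maps *)

Section Coercive.
Context (R : realType).

Lemma rowv_ball n (x y : 'rV[R]_n) (e : R) : 0 < e ->
  (forall i, `|x 0 i - y 0 i| < e) -> ball x e y.
Proof. by move=> e0 H; split => // i j; rewrite (ord1 i); apply: H. Qed.

Lemma rowv_ballP n (x y : 'rV[R]_n) (e : R) :
  ball x e y -> forall i, `|x 0 i - y 0 i| < e.
Proof. by move=> [_ H] i; apply: H. Qed.

Lemma cluster_seq n (u : nat -> 'rV[R]_n) (a b : R) :
  (forall k i, a <= u k 0 i <= b) ->
  exists p : 'rV[R]_n, (forall i, a <= p 0 i <= b) /\
    forall (e : R) K, 0 < e -> exists2 k, (K <= k)%N & forall i, `|p 0 i - u k 0 i| < e.
Proof.
move=> ub.
have cpt : compact [set v : 'rV[R]_n | forall i, v ord0 i \in `[a, b]].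
  apply: (@rV_compact _ _ (fun=> `[a, b]%classic)).
  by move=> _; apply: segment_compact.
have [] := cpt (u @ \oo) _.
  by exists 0%N => // k _ i /=; rewrite in_itv /= ub.
move=> p [pin pcl]; exists p; split.
  by move=> i; have := pin i; rewrite in_itv.
move=> e K e0.
have [] := pcl [set u k | k in [set k | (K <= k)%N]] (ball p e).
- by exists K => // k /= Kk; exists k.
- exact: nbhsx_ballx.
by move=> _ [[k /= Kk <-]] pk; exists k => //; apply: rowv_ballP.
Qed.

(** Points of a large simplex are coloured by the least component of [P], extended by a slot [ord0]
    with value 0. At a limit of fully coloured clusters every slot with positive barycentric
    coordinate carries the least value [mu <= 0]. Coercivity then places the limit in the open cube,
    where all barycentric coordinates are positive; so all slots are equal, and equal to 0. *)
Lemma coercive_zero (N : nat) (P : 'rV[R]_N -> 'rV[R]_N) (rho : R) :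
  0 < rho -> continuous P ->
  (forall (x : 'rV[R]_N) (k : 'I_N), rho <= `|x 0 k| -> 0 < \sum_j P x 0 j * x 0 j) ->
  exists x, P x = 0.
Proof.
case: N P => [|n] P rho0 Pcont coer; first by exists 0; apply/rowP => -[].
pose N := n.+1; pose I := 'I_N.+1.
(* The simplex has the corner with all coordinates [- rho] and edges of length [L] along the axes.
   Its interior contains the open cube of half-side [rho], as there the excesses over [- rho] add up
   to less than [2 * N%:R * rho]. *)
pose L : R := (2 * N%:R + 1) * rho.
have L0 : 0 < L by rewrite mulr_gt0 // ltr_wpDl // mulr_ge0 // ler0n.
pose P0 (x : 'rV[R]_N) (i : I) : R := if unlift ord0 i is Some j then P x 0 j else 0.
have P0l x j : P0 x (lift ord0 j) = P x 0 j by rewrite /P0 liftK.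
have P00 x : P0 x ord0 = 0 by rewrite /P0 unlift_none.
have P0cont i : continuous (P0^~ i).
  rewrite /P0; case: (unlift ord0 i) => [j|] x; last exact: cst_continuous.
  apply: (@continuous_comp _ _ _ P (fun y : 'rV[R]_N => y 0 j)); first exact: Pcont.
  exact: coord_continuous.
pose lam k (x : {ffun I -> 'I_k.+2}) : 'rV[R]_N.+1 := \row_i ((x i)%:R / k.+1%:R).
pose pt (l : 'rV[R]_N.+1) : 'rV[R]_N := \row_j (L * l 0 (lift ord0 j) - rho).
pose col (y : 'rV[R]_N) : I := [arg min_(i < ord0) P0 y i]%O.
have colP y j : P0 y (col y) <= P0 y j.
  by rewrite /col; case: Order.TotalTheory.arg_minP => // i _; apply.
have gc k := cid (@grid_full_colored N k.+1 isT (fun x => col (pt (lam k (sval x))))).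
pose xx k := projT1 (gc k).
have Hxx k := projT2 (gc k).
pose u k := lam k (sval (xx k)).
have u01 k i : 0 <= u k 0 i <= 1.
  rewrite mxE divr_ge0 ?ler0n //= ler_pdivrMr ?ltr0n // mul1r ler_nat.
  by rewrite -ltnS.
have usum k : \sum_i u k 0 i = 1.
  under eq_bigr do rewrite mxE.
  by rewrite -mulr_suml -natr_sum (eqP (svalP (xx k))) divff.
have [p [p01 pcl]] := cluster_seq _ u 0 1 u01.
have psum : \sum_i p 0 i = 1.
  apply/eqP; rewrite -subr_eq0 -normr_eq0; apply/eqP/le_anti.
  rewrite normr_ge0 andbT; apply/ler_addgt0Pl => e e0; rewrite addr0.
  have [|k _ Hk] := pcl (e / N.+1%:R) 0%N; first by rewrite divr_gt0.
  rewrite -(usum k) -sumrB.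
  apply: le_trans (ler_norm_sum _ _ _) _.
  apply: (@le_trans _ _ (\sum_(i < N.+1) e / N.+1%:R)).
    by apply: ler_sum => i _; apply/ltW/Hk.
  by rewrite sumr_const card_ord -[X in X <= _]mulr_natr divfK // pnatr_eq0.
pose xs := pt p.
(* On fine grids [p 0 i > 0] forces a numerator above [N], so a grid point of colour [i] lies near
   [xs]; its colour says that slot [i] is least there, and continuity carries this to [xs]. *)
have minP i j : 0 < p 0 i -> P0 xs i <= P0 xs j.
  move=> pi0; rewrite leNgt; apply/negP => lt.
  have : \forall y \near xs, P0 y j < P0 y i.
    have : \forall y \near xs, 0 < P0 y i - P0 y j.
      have cd : {for xs, continuous (fun y => P0 y i - P0 y j)}.
        by apply: continuousB; apply: P0cont.
      by apply: cvgr_gt cd _ _; rewrite subr_gt0.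
    by apply: filterS => y; rewrite subr_gt0.
  move=> /nbhs_ballP[d /= d0 Hd].
  have [e [e0 e1 e2]] : exists e, [/\ 0 < e, e <= p 0 i / 2 & e <= d / (2 * L)].
    exists (Num.min (p 0 i / 2) (d / (2 * L))).
    by rewrite lt_min !divr_gt0 ?mulr_gt0 // !ge_min !lexx orbT.
  have [K HK] : exists K : nat, N%:R / e < K%:R.
    by exists (Num.truncn (N%:R / e)).+1; rewrite Num.Theory.truncnS_gt.
  have [k Kk Hk] := pcl e K e0.
  have k0 : 0 < k.+1%:R :> R by rewrite ltr0n.
  have NKe : N%:R / k.+1%:R < e.
    rewrite ltr_pdivrMr // mulrC -ltr_pdivrMr //.
    by apply: lt_le_trans HK _; rewrite ler_nat leqW.
  have Nxi : (N < sval (xx k) i)%N.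
    rewrite -(ltr_nat R).
    have : N%:R / k.+1%:R < (sval (xx k) i)%:R / k.+1%:R :> R.
      have := Hk i; rewrite [u k 0 i]mxE ltr_norml => /andP[_].
      move: NKe e1; move: (N%:R / _ : R) (_ / k.+1%:R : R) => A B; lra.
    by rewrite ltr_pM2r // invr_gt0.
  have [x' [cx' dx']] := Hxx k i Nxi.
  have : ball xs d (pt (lam k (sval x'))).
    apply: rowv_ball => // j'; rewrite !mxE.
    set i' := lift ord0 j'.
    have -> : L * p 0 i' - rho - (L * ((sval x' i')%:R / k.+1%:R) - rho)
            = L * (p 0 i' - (sval x' i')%:R / k.+1%:R) by ring.
    rewrite normrM gtr0_norm //.
    have e2' : L * (2 * e) <= d.
      by move: e2; rewrite ler_pdivlMr ?mulr_gt0 // mulrC (mulrC 2) -mulrA.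
    apply: lt_le_trans e2'; rewrite ltr_pM2l //.
    have -> : p 0 i' - (sval x' i')%:R / k.+1%:R =
       (p 0 i' - u k 0 i') + (u k 0 i' - (sval x' i')%:R / k.+1%:R) by ring.
    apply: le_lt_trans (ler_normD _ _) _.
    have h1 := Hk i'.
    have h2 : `|u k 0 i' - (sval x' i')%:R / k.+1%:R| <= N%:R / k.+1%:R.
      rewrite mxE -mulrBl normrM [X in _ * X]gtr0_norm ?invr_gt0 // ler_pM2r ?invr_gt0 //.
      have [d1 d2] := dx' i'.
      by rewrite ler_distl lerBlDr -!natrD !ler_nat d2.
    by move: h1 h2 NKe; move: (N%:R / _ : R) `|_| `|_| => A B C; lra.
  by move=> /Hd /=; rewrite ltNge -cx' colP.
have [i0 pi0] : exists i0, 0 < p 0 i0.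
  apply/not_existsP => no.
  have : \sum_i p 0 i <= 0.
    by apply: sumr_le0 => i _; rewrite leNgt; apply/negP/no.
  by rewrite psum ler10.
pose mu := P0 xs i0.
have mu_le j : mu <= P0 xs j by apply: minP.
have mu_eq i : 0 < p 0 i -> P0 xs i = mu.
  by move=> pi; apply/le_anti; rewrite mu_le andbT; apply: minP.
have mu0 : mu <= 0 by rewrite -(P00 xs).
have pmu i : p 0 i * P0 xs i = p 0 i * mu.
  have /andP[] := p01 i; rewrite le_eqVlt => /orP[/eqP<-|/mu_eq-> //].
  by rewrite !mul0r.
(* The inner product equals [L * mu] minus [rho] times the sum of the components; that sum is at
   least [N%:R * mu], which leaves at most [(N%:R + 1) * rho * mu]. *)
have S_le : \sum_j P xs 0 j * xs 0 j <= 0.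
  have -> : \sum_j P xs 0 j * xs 0 j = L * mu - rho * \sum_j P xs 0 j.
    have -> : mu = \sum_i p 0 i * P0 xs i.
      by under eq_bigr do rewrite pmu; rewrite -mulr_suml psum mul1r.
    rewrite [X in L * X]big_ord_recl P00 mulr0 add0r !mulr_sumr -sumrB; apply: eq_bigr => j _.
    by rewrite P0l [xs 0 j]mxE; ring.
  have h : N%:R * mu <= \sum_j P xs 0 j.
    have -> : N%:R * mu = \sum_(j < N) mu by rewrite sumr_const card_ord mulr_natl.
    by apply: ler_sum => j _; rewrite -P0l.
  have h2 : rho * (N%:R * mu) <= rho * \sum_j P xs 0 j by rewrite ler_pM2l.
  have h3 : L * mu - rho * (N%:R * mu) <= 0.
    have -> : L * mu - rho * (N%:R * mu) = (N%:R + 1) * rho * mu by rewrite /L; ring.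
    by rewrite mulr_ge0_le0 // mulr_ge0 ?ltW // ltr_wpDl // ler0n.
  by move: h2 h3; lra.
have small k : `|xs 0 k| < rho.
  by rewrite ltNge; apply/negP => /coer; rewrite ltNge S_le.
have pl j : p 0 (lift ord0 j) = (xs 0 j + rho) / L.
  by rewrite [xs 0 j]mxE subrK mulrC mulKf // gt_eqF.
have p_pos i : 0 < p 0 i.
  have [j ->|->] := unliftP ord0 i.
    rewrite pl divr_gt0 //; have := small j; rewrite ltr_norml => /andP[].
    lra.
  have : 1 - \sum_j p 0 (lift ord0 j) = p 0 ord0 by rewrite -psum big_ord_recl addrK.
  move=> <-; rewrite subr_gt0.
  apply: (@le_lt_trans _ _ (\sum_(j < N) (2 * rho / L))).
    apply: ler_sum => j _; rewrite pl ler_pM2r ?invr_gt0 //.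
    by have := small j; rewrite ltr_norml => /andP[]; lra.
  rewrite sumr_const card_ord -[X in X < _]mulr_natl mulrA ltr_pdivrMr // mul1r /L -subr_gt0.
  by have -> : (2 * N%:R + 1) * rho - N%:R * (2 * rho) = rho by ring.
exists xs; apply/rowP => j; rewrite mxE -P0l mu_eq //.
by rewrite -(mu_eq ord0) // P00.
Qed.

End Coercive.

Set Implicit Arguments. Unset Strict Implicit. Unset Printing Implicit Defensive.

(** * Lebesgue measure on row vectors *)

Section OffNull.
Context d (T : measurableType d) (R : realType) (mu : {measure set T -> \bar R}).
Local Open Scope ereal_scope.
Import HBNNSimple.

(** The integral of a nonnegative function is a supremum over simple functions below it. One that
    lies below [f], cut to the complement of the null set, lies below [g] and keeps its integral. *)
Let ge0_le_integral_off_null (f g : T -> \bar R) :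
  (forall x, 0 <= f x) -> (forall x, 0 <= g x) ->
  mu.-negligible [set x | f x <> g x] -> \int[mu]_x f x <= \int[mu]_x g x.
Proof.
move=> f0 g0 [N [mN N0 fgN]].
have mNC : measurable (~` N) by exact: measurableC.
rewrite ge0_integralTE// [leRHS]ge0_integralTE//.
apply: ge_ereal_sup => _ [h hf <-].
have -> : sintegral mu h = sintegral mu (proj_nnsfun h mNC).
  have := integral_nnsfun mu measurableT h; rewrite patch_setT => <-.
  rewrite -mrestrict -integral_nnsfun // (ge0_negligible_integral mN) ?setTD //.
    exact/measurable_EFinP/measurable_funP.
  by move=> x _; rewrite lee_fin.
apply: ereal_sup_ubound; exists (proj_nnsfun h mNC) => // x /=.
rewrite mindicE; have [|xN] := boolP (x \in ~` N).
  rewrite inE => xN; rewrite mulr1; have -> : g x = f x; last exact: hf.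
  apply: esym; apply: contrapT => fg; apply: xN.
  exact: fgN.
by rewrite mulr0.
Qed.

(* Neither function is assumed measurable: this disposes of the junk values of
   derivatives on null sets. *)
Lemma integral_off_null (f g : T -> \bar R) :
  mu.-negligible [set x | f x <> g x] -> \int[mu]_x f x = \int[mu]_x g x.
Proof.
move=> fg; rewrite integralE [RHS]integralE.
congr (_ - _); apply/eqP; rewrite eq_le; apply/andP; split;
  apply: ge0_le_integral_off_null => //.
all: by apply: negligibleS fg => x /= h e; apply: h; rewrite ?funeposE ?funenegE e.
Qed.

Lemma Rintegral_off_null (D : set T) (f g : T -> R) :
  mu.-negligible [set x | D x /\ f x <> g x] ->
  (\int[mu]_(x in D) f x = \int[mu]_(x in D) g x)%R.
Proof.
move=> fg; rewrite Rintegral_mkcond [RHS]Rintegral_mkcond; congr fine.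
apply: integral_off_null; apply: negligibleS fg => x /=.
rewrite !patchE; case: ifP => [|_]; last by [].
by rewrite inE => Dx fg; split=> // e; apply: fg; rewrite e.
Qed.

End OffNull.

Section RowBorel.
Context (R : realType).
Notation rvec n := (g_sigma_algebraType (@open 'rV[R]_n)).

Lemma rvec_open n (U : set 'rV[R]_n) : open U -> measurable (U : set (rvec n)).
Proof. by move=> oU; apply: sub_sigma_algebra. Qed.

Lemma rvec_continuous_measurable n (f : 'rV[R]_n -> R) : continuous f ->
  measurable_fun setT (f : rvec n -> R).
Proof.
move=> /continuousP cf; apply: (measurability _ (RGenOpens.measurableE R)).
move=> _ [_ [a [b ->] <-]]; rewrite setTI; apply: rvec_open.
exact/cf/interval_open.
Qed.

Lemma rvec_continuous_measurable_rvec m n (f : 'rV[R]_m -> 'rV[R]_n) :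
  continuous f -> measurable_fun setT (f : rvec m -> rvec n).
Proof.
move=> /continuousP cf; apply: (@measurability _ _ _ (rvec n) _ _ (@open 'rV[R]_n)) => //.
by move=> _ [B oB <-]; rewrite setTI; apply: rvec_open; exact: cf.
Qed.

Definition rcons_row n (p : measurableTypeR R * rvec n) : rvec n.+1 :=
  row_mx (const_mx p.1 : 'rV[R]_1) (p.2 : 'rV[R]_n).

Definition runcons_row n (v : rvec n.+1) : measurableTypeR R * rvec n :=
  ((v : 'rV[R]_n.+1) 0 0, rsubmx (v : 'rV[R]_(1 + n))).

Lemma rcons_rowK n : cancel (@rcons_row n) (@runcons_row n).
Proof.
move=> [a y]; rewrite /runcons_row /rcons_row /=; congr (_, _).
  have -> : (0 : 'I_n.+1) = lshift n (0 : 'I_1) by apply/val_inj.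
  by rewrite [LHS](row_mxEl (const_mx a : 'rV[R]_1) (y : 'rV[R]_n) 0 (0 : 'I_1)) mxE.
by rewrite row_mxKr.
Qed.

Lemma rcons_row0 n (p : measurableTypeR R * rvec n) : (rcons_row p : 'rV[R]_n.+1) 0 ord0 = p.1.
Proof. by have /(congr1 fst) := rcons_rowK p. Qed.

Lemma rcons_rowS n (p : measurableTypeR R * rvec n) i :
  (rcons_row p : 'rV[R]_n.+1) 0 (lift ord0 i) = (p.2 : 'rV[R]_n) 0 i.
Proof.
have -> : lift ord0 i = rshift 1 i by apply/val_inj.
exact: (row_mxEr (const_mx p.1 : 'rV[R]_1) (p.2 : 'rV[R]_n) 0 i).
Qed.

(** The product sigma-algebra contains the open sets of the product, since an open set is the union
    of those boxes inside it that have rational centres and radii [1/(k+1)], a countable family. *)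
Lemma measurable_rcons_row n : measurable_fun setT (@rcons_row n).
Proof.
apply: (@measurability _ _ _ (rvec n.+1) _ _ (@open 'rV[R]_n.+1)) => //.
move=> _ [U oU <-]; rewrite setTI.
pose r (k : nat) : R := k.+1%:R^-1.
have r0 k : 0 < r k by rewrite invr_gt0.
pose box (i : rat * 'rV[rat]_n * nat) : set (measurableTypeR R * rvec n) :=
  (ball (ratr i.1.1 : R) (r i.2) : set R) `*`
  (ball (map_mx ratr i.1.2 : 'rV[R]_n) (r i.2) : set (rvec n)).
have mbox i : measurable (box i).
  apply: measurableX; first exact: measurable_ball.
  by apply: rvec_open; exact: ball_open.
suff -> : @rcons_row n @^-1` U =
    \bigcup_i (if `[< box i `<=` @rcons_row n @^-1` U >] then box i else set0).
  apply: countable_bigcupT_measurable => // i; by case: ifP.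
apply/seteqP; split => [[x y] Uxy|p [i _]]; last first.
  by case: ifP => // /asboolP sub /sub.
have /nbhs_ballP[e /= e0 eU] := open_nbhs_nbhs (conj oU Uxy).
(* Factor 2: the box is centred at a rational point that is itself up to [r k] away. *)
have [k ke] : exists k, 2 * r k < e.
  exists (Num.truncn (2 / e)); rewrite /r.
  by rewrite ltr_pdivrMr // mulrC -ltr_pdivrMr // truncnS_gt.
have ratE (a : R) : exists q : rat, `|ratr q - a| < r k.
  have [q] : exists q : rat, ratr q \in `](a - r k), (a + r k)[.
    by apply: rat_in_itvoo; rewrite ltrBlDr -addrA ltrDl addr_gt0.
  by rewrite in_itv /= => h; exists q; rewrite ltr_distl.
have [q qx] := ratE x.
have [v vy] : exists v : 'rV[rat]_n, forall i, `|ratr (v 0 i) - (y : 'rV[R]_n) 0 i| < r k.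
  have vE i := cid (ratE ((y : 'rV[R]_n) 0 i)).
  by exists (\row_i projT1 (vE i)) => i; rewrite mxE; exact: projT2 (vE i).
exists (q, v, k) => //; rewrite ifT; last first.
  apply/asboolP => -[x' y'] [/= bx by_]; apply: eU; split => // i j.
  rewrite (ord1 i) => {i}.
  have [l ->|->] := unliftP ord0 j.
    rewrite !rcons_rowS /=; apply: le_lt_trans ke.
    have := vy l; have := by_.2 0 l; rewrite /ball /= mxE distrC => h1 h2.
    have -> : (y : 'rV[R]_n) 0 l - (y' : 'rV[R]_n) 0 l =
      ((y : 'rV[R]_n) 0 l - ratr (v 0 l)) + (ratr (v 0 l) - (y' : 'rV[R]_n) 0 l) by ring.
    apply: le_trans (ler_normD _ _) _; rewrite mulr2n mulrDl mul1r.
    by apply: lerD; rewrite distrC ltW.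
  rewrite !rcons_row0 /=; apply: le_lt_trans ke.
  have -> : x - x' = (x - ratr q) + (ratr q - x') by ring.
  apply: le_trans (ler_normD _ _) _; rewrite mulr2n mulrDl mul1r.
  by apply: lerD; rewrite ltW // distrC.
split => /=; first by rewrite /ball /=.
by split => // i j; rewrite (ord1 i) mxE; apply: vy.
Qed.

Lemma measurable_runcons_row n : measurable_fun setT (@runcons_row n).
Proof.
apply: measurable_fun_pair.
  by apply: rvec_continuous_measurable; exact: coord_continuous.
by apply: rvec_continuous_measurable_rvec; exact: (@continuous_rsubmx R 1 1 n).
Qed.

End RowBorel.

Section RowMeasure.
Context (R : realType).
Notation rvec n := (g_sigma_algebraType (@open 'rV[R]_n)).
Notation leb := (@lebesgue_measure R).

Section Step.
Context n (m : {sigma_finite_measure set (rvec n) -> \bar R}).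

Definition row_measureS (A : set (rvec n.+1)) : \bar R :=
  pushforward (leb \x m)%E (@rcons_row R n) A.

HB.instance Definition _ := Measure.copy row_measureS
  (measure_function_pushforward__canonical__measure_function_Measure (leb \x m)%E (@measurable_rcons_row R n)).

Lemma row_measureS_sigma_finite : sigma_finite setT row_measureS.
Proof.
pose lm : {sigma_finite_measure set _ -> \bar R} := leb.
have /sigma_finiteP[F [TF ndF Foo]] := sigma_finiteT lm.
have /sigma_finiteP[G [TG ndG Goo]] := sigma_finiteT m.
exists (fun k => @runcons_row R n @^-1` (F k `*` G k)).
  apply/esym/seteqP; split => // v _.
  have [k _ Fk] : (\bigcup_i F i) (runcons_row v).1 by rewrite -TF.
  have [l _ Gl] : (\bigcup_i G i) (runcons_row v).2 by rewrite -TG.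
  exists (maxn k l) => //; split.
    by move: Fk; apply/subsetPset/ndF/leq_maxl.
  by move: Gl; apply/subsetPset/ndG/leq_maxr.
move=> k; have [mF Fk] := Foo k; have [mG Gk] := Goo k.
have mFG : measurable (F k `*` G k) by exact: measurableX.
split; first by rewrite -[X in measurable X]setTI; exact: measurable_runcons_row.
rewrite /row_measureS /pushforward.
rewrite [X in (_ X < _)%E](_ : _ = F k `*` G k).
  by rewrite product_measure1E // lte_mul_pinfty // ge0_fin_numE.
by apply/seteqP; split => p; rewrite /preimage /mkset rcons_rowK.
Qed.

HB.instance Definition _ := Measure_isSigmaFinite.Build _ _ _ row_measureS
  row_measureS_sigma_finite.

End Step.

(** Lebesgue measure, built coordinate by coordinate in the order in which [iint] integrates; the
    point mass in dimension 0 matches the base case of [iint]. *)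
Fixpoint row_measure n : {sigma_finite_measure set (rvec n) -> \bar R} :=
  match n with
  | 0 => dirac (0 : rvec 0)
  | n'.+1 => row_measureS (row_measure n')
  end.

End RowMeasure.

Section RowIntegral.
Context (R : realType).
Notation rvec n := (g_sigma_algebraType (@open 'rV[R]_n)).
Notation leb := (@lebesgue_measure R).
Notation mu n := (row_measure R n).

Lemma row_measureSE n (A : set (rvec n.+1)) :
  mu n.+1 A = (\int[leb]_a mu n [set y | A (rcons_row (a, y))])%E.
Proof.
apply: eq_integral => a _ /=; congr (mu n _).
by apply/seteqP; split => y; rewrite /xsection /= inE.
Qed.

Lemma ge0_row_integralS n (g : rvec n.+1 -> \bar R) :
  measurable_fun setT g -> (forall v, 0 <= g v)%E ->
  (\int[mu n.+1]_v g v = \int[leb]_a \int[mu n]_y g (rcons_row (a, y)))%E.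
Proof.
move=> mg g0.
transitivity (\int[leb \x mu n]_p (g \o @rcons_row R n) p)%E.
  exact: (@ge0_integral_pushforward _ _ _ _ _ _ (@measurable_rcons_row R n) (leb \x mu n)%E setT g).
rewrite fubini_tonelli1 //.
  exact: measurableT_comp mg (@measurable_rcons_row R n).
by move=> p; exact: g0.
Qed.

Lemma measurable_rcons_slice n d (T : measurableType d) (g : rvec n.+1 -> T) a :
  measurable_fun setT g -> measurable_fun setT (fun y => g (rcons_row (a, y))).
Proof.
move=> mg; apply: (@measurable_fun_pair2 _ _ _ _ _ _ (g \o @rcons_row R n)).
exact: measurableT_comp mg (@measurable_rcons_row R n).
Qed.

Lemma ieintE n (g : rvec n -> \bar R) :
  measurable_fun setT g -> (forall v, 0 <= g v)%E ->
  ieint (g : 'rV[R]_n -> \bar R) = (\int[mu n]_v g v)%E.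
Proof.
elim: n g => [|n IHn] g mg g0 /=.
  by rewrite integral_dirac // diracT mul1e.
rewrite ge0_row_integralS //; apply: eq_integral => a _.
apply: (IHn (fun y => g (rcons_row (a, y)))) => //.
exact: measurable_rcons_slice.
Qed.

Section Integrable.
Context n (g : rvec n.+1 -> R).
Hypothesis ig : (mu n.+1).-integrable setT (EFin \o g).

Let ig2 : (leb \x mu n)%E.-integrable setT (EFin \o g \o @rcons_row R n).
Proof.
have /integrableP[mg foo] := ig.
apply/integrableP; split.
  exact: measurableT_comp mg (@measurable_rcons_row R n).
move: foo; rewrite (@ge0_integral_pushforward _ _ _ _ _ _ (@measurable_rcons_row R n) (leb \x mu n)%E setT) //.
exact: measurableT_comp.
Qed.

Lemma row_integralS :
  (\int[mu n.+1]_v (g v)%:E = \int[leb]_a \int[mu n]_y (g (rcons_row (a, y)))%:E)%E.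
Proof.
transitivity (\int[leb \x mu n]_p ((EFin \o g \o @rcons_row R n) p))%E.
  apply: (@integral_pushforward _ _ _ _ _ _ (@measurable_rcons_row R n) (leb \x mu n)%E setT) => //.
  exact: measurable_int ig.
by rewrite -integral12_prod_meas1.
Qed.

Lemma ae_row_integrable :
  {ae leb, forall a, (mu n).-integrable setT (fun y => (g (rcons_row (a, y)))%:E)}.
Proof. exact: (ae_integrable1 ig2). Qed.

Lemma row_integrableS :
  leb.-integrable setT (fun a => \int[mu n]_y (g (rcons_row (a, y)))%:E)%E.
Proof. exact: (integrable_fubini_F ig2). Qed.

End Integrable.

(** The measure of a null set is the integral of its slice measures, so these are 0 almost
    everywhere. *)
Lemma ae_row_negligible n (N : set (rvec n.+1)) : (mu n.+1).-negligible N ->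
  {ae leb, forall a, (mu n).-negligible [set y | N (rcons_row (a, y))]}.
Proof.
move=> [A [mA A0 NA]].
have mA' : measurable_fun setT (fun a => mu n [set y | A (rcons_row (a, y))]).
  have mR : measurable (@rcons_row R n @^-1` A).
    by rewrite -[X in measurable X]setTI; exact: measurable_rcons_row.
  have := measurable_fun_xsection (mu n) mR.
  apply: eq_measurable_fun => a _ /=; congr (mu n _).
  by apply/seteqP; split => y; rewrite /xsection /= inE.
have mslice a : measurable ([set y | A (rcons_row (a, y))] : set (rvec n)).
  have := @measurable_rcons_slice n _ _ id a (@measurable_id _ _ _).
  by move=> /(_ measurableT _ mA); rewrite setTI.
have : ae_eq leb setT (fun a => mu n [set y | A (rcons_row (a, y))]) (cst 0%E).
  apply/(ae_eq_integral_abs leb measurableT mA').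
  under eq_integral do rewrite gee0_abs //.
  by rewrite -row_measureSE.
apply: filterS => a /= /(_ I) A0a.
exists [set y | A (rcons_row (a, y))]; split => // y /=; exact: NA.
Qed.

(** The bridge from iterated real integrals to measure theory; [g] may fail to be measurable. For
    almost every first coordinate the slice of [g'] is integrable and the slice of the exceptional
    set is null, so induction applies; the other slices, on which [fine] may return a default, form
    a null set of first coordinates. *)
Lemma iintE n (g g' : rvec n -> R) :
  (mu n).-integrable setT (EFin \o g') ->
  (mu n).-negligible [set v | g v <> g' v] ->
  iint (g : 'rV[R]_n -> R) = \int[mu n]_v g' v.
Proof.
elim: n g g' => [|n IHn] g g' ig' gg' /=.
  rewrite /Rintegral integral_dirac // ?diracT ?mul1e /=; last exact: measurable_int ig'.
  (* A null set of a point mass misses the point, so the two functions agree there. *)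
  have [A [mA A0 sA]] := gg'; apply: contrapT => ne.
  have : dirac (0 : rvec 0) A = 1%:E :> \bar R by rewrite diracE mem_set //; apply: sA.
  by rewrite A0 => /eqP; rewrite eq_sym onee_eq0.
have -> : \int[mu n.+1]_v g' v =
   \int[leb]_a fine (\int[mu n]_y (g' (rcons_row (a, y)))%:E)%E.
  rewrite /Rintegral row_integralS //; congr fine; apply: ae_eq_integral => //.
  - exact: measurable_int (row_integrableS ig').
  - apply/measurable_EFinP; apply: measurableT_comp => //.
    exact: measurable_int (row_integrableS ig').
  - have := integrable_ae measurableT (row_integrableS ig').
    by apply: filterS => a /= /(_ I) fa _; rewrite fineK.
apply: Rintegral_off_null.
have : {ae leb, forall a, iint (fun y : 'rV[R]_n => g (rcons_row (a, y))) =
    fine (\int[mu n]_y (g' (rcons_row (a, y)))%:E)%E}.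
  have H1 := ae_row_integrable ig'; have H2 := ae_row_negligible gg'.
  apply: filterS2 H1 H2 => a ia na.
  exact: (IHn (fun y => g (rcons_row (a, y))) (fun y => g' (rcons_row (a, y)))).
by apply: negligibleS => a /= [_].
Qed.

End RowIntegral.

Section RowBoxes.
Context (R : realType).
Notation rvec n := (g_sigma_algebraType (@open 'rV[R]_n)).
Notation leb := (@lebesgue_measure R).
Notation mu n := (row_measure R n).

Definition row_box n (a b : 'rV[R]_n) : set (rvec n) :=
  [set v | forall i, a 0 i < (v : 'rV[R]_n) 0 i < b 0 i].

Lemma measurable_row_coord n i : measurable_fun setT (fun v : rvec n => (v : 'rV[R]_n) 0 i).
Proof. by apply: rvec_continuous_measurable; exact: coord_continuous. Qed.

Lemma measurable_row_box n (a b : 'rV[R]_n) : measurable (row_box a b).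
Proof.
have -> : row_box a b = \bigcap_(i in [set: 'I_n])
    ((fun v : rvec n => (v : 'rV[R]_n) 0 i) @^-1` `]a 0 i, b 0 i[).
  apply/seteqP; split => v /= H i; first by move=> _; rewrite /= in_itv /=; exact: H.
  by have := H i I; rewrite /= in_itv.
apply: fin_bigcap_measurable => // i _.
rewrite -[X in measurable X]setTI; exact: measurable_row_coord.
Qed.

Lemma row_measure_box n (a b : 'rV[R]_n) : (forall i, a 0 i <= b 0 i) ->
  mu n (row_box a b) = (\prod_i (b 0 i - a 0 i))%:E.
Proof.
elim: n a b => [|n IHn] a b ab.
  rewrite big_ord0 /= diracE mem_set //.
  by move=> -[].
pose a' : 'rV[R]_n := \row_i a 0 (lift ord0 i).
pose b' : 'rV[R]_n := \row_i b 0 (lift ord0 i).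
have sliceE x : [set y | row_box a b (rcons_row (x, y))] =
    if x \in `]a 0 ord0, b 0 ord0[ then row_box a' b' else set0.
  case: ifPn; rewrite in_itv /= => xab; apply/seteqP; split => y //= H.
  - by move=> i; have := H (lift ord0 i); rewrite rcons_rowS !mxE.
  - move=> i; have [j ->|->] := unliftP ord0 i; last by rewrite rcons_row0.
    by have := H j; rewrite rcons_rowS !mxE.
  - by have := H ord0; rewrite rcons_row0 /= (negbTE xab).
rewrite row_measureSE big_ord_recl.
under eq_integral do rewrite sliceE.
rewrite (eq_integral (fun x : measurableTypeR R => ((\prod_i (b' 0 i - a' 0 i)) * \1_(`]a 0 ord0, b 0 ord0[) x)%:E)); last first.
  move=> x _; rewrite indicE mem_setE.
  case: ifP => _; last by rewrite measure0 mulr0.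
  by rewrite mulr1 IHn // => i; rewrite !mxE.
under eq_integral do rewrite EFinM.
rewrite ge0_integralZl //.
- rewrite integral_indic // setIT /= lebesgue_measure_itv /= lte_fin.
  have -> : \prod_i (b' 0 i - a' 0 i) = \prod_i (b 0 (lift ord0 i) - a 0 (lift ord0 i)).
    by apply: eq_bigr => i _; rewrite !mxE.
  case: ltP => [_|ba]; first by rewrite -EFinB -EFinM mulrC.
  have -> : b 0 ord0 = a 0 ord0 by apply/le_anti; rewrite ba ab.
  by rewrite subrr mul0r mule0.
- by apply/measurable_EFinP.
- by rewrite lee_fin prodr_ge0 // => i _; rewrite !mxE subr_ge0.
Qed.

Lemma bounded_row_integrable n (g : rvec n -> R) (C r : R) :
  measurable_fun setT g -> (forall v, `|g v| <= C) ->
  (forall v, g v != 0 -> forall i, `|(v : 'rV[R]_n) 0 i| < r) ->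
  (mu n).-integrable setT (EFin \o g).
Proof.
move=> mg gC gr.
(* The absolute value keeps the ends of the box in order even for negative [r]. *)
pose B := row_box (const_mx (- `|r|) : 'rV[R]_n) (const_mx `|r|).
have mB : measurable B by exact: measurable_row_box.
have C0 : 0 <= C by apply: le_trans (gC 0); rewrite normr_ge0.
apply: (@le_integrable _ _ _ _ _ measurableT _ (fun v => (C * \1_B v)%:E)).
- exact/measurable_EFinP.
- move=> v _ /=; have h : 0 <= C * \1_B v by rewrite mulr_ge0.
  rewrite lee_fin (ger0_norm h).
  have [->|/gr gv] := eqVneq (g v) 0; first by rewrite normr0 mulr_ge0.
  rewrite indicE mem_set ?mulr1 // => i; rewrite !mxE.
  by rewrite -ltr_norml (lt_le_trans (gv i)) // ler_norm.
under eq_fun do rewrite EFinM.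
apply: integrableZl => //.
apply/integrableP; split; first exact/measurable_EFinP.
under eq_integral do rewrite gee0_abs ?lee_fin //.
rewrite integral_indic // setIT.
suff : (mu n B < +oo)%E by [].
by rewrite row_measure_box ?ltry // => i; rewrite !mxE ge0_cp // normr_ge0.
Qed.

Section SpaceTime.
Context (d : nat) (Om : set 'rV[R]_d) (T : R).

(** Time is the first entry of the row because [int_Q] integrates over time outermost. *)
Definition spacetime_fun (g : 'rV[R]_d -> R -> R) (v : rvec d.+1) : R :=
  let p := runcons_row v in \1_(`]0, T[) p.1 * (\1_Om (p.2 : 'rV[R]_d) * g p.2 p.1).

Lemma int_QE (g : 'rV[R]_d -> R -> R) (G : rvec d.+1 -> R) :
  (mu d.+1).-integrable setT (EFin \o G) ->
  (mu d.+1).-negligible [set v | spacetime_fun g v <> G v] ->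
  int_Q Om T g = \int[mu d.+1]_v G v.
Proof.
move=> iG gG; rewrite -(iintE iG gG) /int_Q Rintegral_mkcond.
apply: eq_Rintegral => t _; rewrite patchE /int_Omega.
have E (y : rvec d) : spacetime_fun g (rcons_row (t, y)) =
    \1_(`]0, T[) t * (\1_Om (y : 'rV[R]_d) * g y t).
  by rewrite /spacetime_fun rcons_rowK.
rewrite (_ : (fun y : 'rV[R]_d => spacetime_fun g _) =
   (fun y : 'rV[R]_d => \1_(`]0, T[) t * (\1_Om y * g y t))); last first.
  by apply/funext => y; rewrite -E.
case: ifPn => tT.
  by congr (iint _); apply/funext => y /=; rewrite (indicE _ _ t) tT mul1r.
rewrite (_ : (fun y : 'rV[R]_d => \1_(`]0, T[) t * (\1_Om y * g y t)) = (fun=> 0)); last first.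
  by apply/funext => y /=; rewrite (indicE _ _ t) (negbTE tT) mul0r.
suff H n : iint (fun _ : 'rV[R]_n => 0) = 0 :> R by exact: esym (H d).
elim: n => [//|n IHn] /=; rewrite (@eq_Rintegral _ _ _ _ _ (fun=> 0)) => [|? _]; last exact: IHn.
by rewrite Rintegral_cst // mul0r.
Qed.

Definition tensor (w : rvec d -> R) (b : R -> R) (v : rvec d.+1) : R :=
  let p := runcons_row v in b p.1 * w p.2.

Section Tensor.
Context (w : rvec d -> R) (b : R -> R).
Hypotheses (iw : (mu d).-integrable setT (EFin \o w))
  (ib : leb.-integrable setT (EFin \o b)).

Lemma measurable_tensor : measurable_fun setT (tensor w b).
Proof.
have mb : measurable_fun setT b by apply/measurable_EFinP; exact: measurable_int ib.
have mw : measurable_fun setT w by apply/measurable_EFinP; exact: measurable_int iw.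
apply: measurable_funM.
  apply: measurableT_comp mb _.
  by apply: measurableT_comp (@measurable_runcons_row R d).
apply: measurableT_comp mw _.
by apply: measurableT_comp (@measurable_runcons_row R d).
Qed.

Lemma tensorE t (y : rvec d) : tensor w b (rcons_row (t, y)) = b t * w y.
Proof. by rewrite /tensor rcons_rowK. Qed.

Lemma tensor_integrable : (mu d.+1).-integrable setT (EFin \o tensor w b).
Proof.
apply/integrableP; split; first by apply/measurable_EFinP; exact: measurable_tensor.
rewrite ge0_row_integralS //; last first.
  by apply: measurableT_comp => //; by apply/measurable_EFinP; exact: measurable_tensor.
have /integrableP[mw foow] := iw; have /integrableP[mb foob] := ib.
have maw : measurable_fun setT (fun y => `|w y|%:E).
  by apply/measurable_EFinP; apply: measurableT_comp => //; apply/measurable_EFinP.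
have mab : measurable_fun setT (fun t => `|b t|%:E).
  by apply/measurable_EFinP; apply: measurableT_comp => //; apply/measurable_EFinP.
rewrite (eq_integral (fun t : measurableTypeR R => (\int[mu d]_y `|(EFin \o w) y|) * `|(EFin \o b) t|)%E); last first.
  move=> t _ /=; rewrite muleC -ge0_integralZl //.
    by apply: eq_integral => y _ /=; rewrite tensorE normrM EFinM.
rewrite ge0_integralZl //; last by exact: integral_ge0.
by rewrite lte_mul_pinfty // ?integral_ge0 // ge0_fin_numE ?integral_ge0.
Qed.

End Tensor.

End SpaceTime.
End RowBoxes.

Section RowNull.
Context (R : realType).
Notation rvec n := (g_sigma_algebraType (@open 'rV[R]_n)).
Notation leb := (@lebesgue_measure R).
Notation mu n := (row_measure R n).

Lemma measure_bigsetU_le d (T : measurableType d) (m : {measure set T -> \bar R})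
    (I : Type) (s : seq I) (F : I -> set T) :
  (forall i, measurable (F i)) ->
  (m (\big[setU/set0]_(i <- s) F i) <= \sum_(i <- s) m (F i))%E.
Proof.
move=> mF; elim: s => [|i s IHs]; first by rewrite !big_nil measure0.
rewrite !big_cons; apply: le_trans (measureU2 _ _ _) _ => //.
  exact: bigsetU_measurable.
by rewrite leeD2l.
Qed.

Lemma unit_grid_approx (N : nat) (z : R) : 0 <= z <= 1 ->
  exists j : 'I_N.+1, `|z - j%:R / N.+1%:R| <= N.+1%:R^-1.
Proof.
case/andP=> z0 z1; have N0 : 0 < N.+1%:R :> R by rewrite ltr0n.
have [z_eq1|z_lt1] := eqVneq z 1.
  exists ord_max; rewrite z_eq1 /= -{1}[1](divff (lt0r_neq0 N0)) -mulrBl -natrB //.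
  by rewrite subSn // subnn mul1r ger0_norm // invr_ge0 ltW.
have zN0 : 0 <= z * N.+1%:R by rewrite mulr_ge0 // ltW.
have tN : (Num.truncn (z * N.+1%:R) < N.+1)%N.
  rewrite truncn_lt_nat //.
  by rewrite gtr_pMl // lt_neqAle z_lt1.
exists (Ordinal tN) => /=.
have /andP[t1 t2] := truncn_itv zN0.
have -> (x : R) : z - x / N.+1%:R = (z * N.+1%:R - x) / N.+1%:R.
  by rewrite mulrBl mulfK // lt0r_neq0.
rewrite normrM [X in _ * X]gtr0_norm ?invr_gt0 // ler_piMl ?invr_ge0 ?ltW //.
by rewrite ger0_norm ?subr_ge0 // ltrBlDl natr1.
Qed.

(* The slab has N^(d-1) cells of side 1/N; the image of each lies in a box of
   volume (4L/N)^d. *)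
Lemma lipschitz_slab_negligible d (F : 'rV[R]_d -> 'rV[R]_d) (L : R) (k : 'I_d) (xi : R) :
  0 < L ->
  (forall z z' (r : R), closed_cube d z -> closed_cube d z' -> 0 <= r ->
     (forall i, `|z 0 i - z' 0 i| <= r) -> forall i, `|F z 0 i - F z' 0 i| <= L * r) ->
  (mu d).-negligible (F @` [set z | closed_cube d z /\ z 0 k = xi]).
Proof.
case: d F k => [F []//|d] F k L0 FL.
have [xi01|nxi] := boolP (0 <= xi <= 1); last first.
  apply: negligibleS (negligible_set0 _) => _ [z [zc zk] _] /=.
  by move: nxi; rewrite -zk zc.
pose ctr N (j : {ffun 'I_d -> 'I_N.+1}) : 'rV[R]_d.+1 :=
  \row_i (if unlift k i is Some l then (j l)%:R / N.+1%:R else xi).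
pose side N : R := 2 * L / N.+1%:R.
pose box N j := row_box (F (ctr N j) - const_mx (side N)) (F (ctr N j) + const_mx (side N)).
pose cover N : set (rvec d.+1) := \big[setU/set0]_(j : {ffun 'I_d -> 'I_N.+1}) box N j.
have side0 N : 0 < side N by rewrite divr_gt0 // mulr_gt0.
have mbox N j : measurable (box N j) by exact: measurable_row_box.
have mcover N : measurable (cover N) by apply: bigsetU_measurable.
have mu_box N j : mu d.+1 (box N j) = ((4 * L / N.+1%:R) ^+ d.+1)%:E.
  rewrite row_measure_box => [|i]; last first.
    by rewrite !mxE lerD2l ge0_cp // ltW.
  congr EFin; rewrite -[in RHS](card_ord d.+1) -prodr_const; apply: eq_bigr => i _.
  by rewrite !mxE /side; field.
have mu_cover N : (mu d.+1 (cover N) <= ((4 * L) ^+ d.+1 / N.+1%:R)%:E)%E.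
  apply: le_trans (measure_bigsetU_le _ _ (mbox N)) _.
  rewrite (eq_bigr (fun=> ((4 * L / N.+1%:R) ^+ d.+1)%:E)); last by move=> j _; exact: mu_box.
  rewrite sumEFin lee_fin sumr_const card_ffun !card_ord -[X in X <= _]mulr_natl natrX.
  rewrite expr_div_n exprS [N.+1%:R ^+ d.+1]exprS.
  have N0 : N.+1%:R != 0 :> R by rewrite pnatr_eq0.
  rewrite le_eqVlt; apply/orP; left; apply/eqP.
  have := expf_neq0 d N0; move: N0; move: (N.+1%:R : R) => X X0; move: (X ^+ d) => Y Y0.
  by field; rewrite X0 Y0.
have sub N : F @` [set z | closed_cube d.+1 z /\ z 0 k = xi] `<=` cover N.
  move=> _ [z [zc zk] <-].
  have gr l := cid (unit_grid_approx N (zc (lift k l))).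
  pose j : {ffun 'I_d -> 'I_N.+1} := [ffun l => projT1 (gr l)].
  rewrite /cover (bigD1 j) //=; left => i.
  have jc : closed_cube d.+1 (ctr N j).
    move=> i'; rewrite mxE; case: unliftP => [l _|_]; last by rewrite xi01.
    rewrite divr_ge0 ?ler0n //= ler_pdivrMr ?ltr0n // mul1r ler_nat.
    exact/ltnW/ltn_ord.
  have zj i' : `|z 0 i' - ctr N j 0 i'| <= N.+1%:R^-1.
    rewrite mxE; case: unliftP => [l ->|->].
      by rewrite ffunE; exact: projT2 (gr l).
    by rewrite zk subrr normr0 invr_ge0 ler0n.
  have N0 : 0 <= N.+1%:R^-1 :> R by rewrite invr_ge0 ler0n.
  have := FL _ _ _ zc jc N0 zj i; rewrite !mxE => le.
  rewrite -ltr_distl; apply: le_lt_trans le _.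
  by rewrite /side ltr_pM2r ?invr_gt0 ?ltr0n // ltr_pMl // ltr1n.
exists (\bigcap_N cover N); split.
- exact: bigcapT_measurable.
- apply/eqP; rewrite eq_le measure_ge0 andbT.
  apply/lee_addgt0Pr => e e0; rewrite add0e.
  have [N HN] : exists N, (4 * L) ^+ d.+1 / N.+1%:R < e.
    exists (Num.truncn ((4 * L) ^+ d.+1 / e)).
    by rewrite ltr_pdivrMr // [e * _]mulrC -ltr_pdivrMr // truncnS_gt.
  apply: (@le_trans _ _ (mu d.+1 (cover N))).
    apply: le_measure; rewrite ?inE //; first exact: bigcapT_measurable.
    exact: bigcap_inf.
  by apply: le_trans (mu_cover N) _; rewrite lee_fin ltW.
- by move=> x Fx N _; apply: sub.
Qed.

End RowNull.

(** * Piecewise polynomials and B-splines *)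

Section PiecewisePoly.
Context (R : realType).
Implicit Types (br : seq R) (b : R -> R).

(** The elements are closed, so continuity across the breakpoints is part of the notion; B-splines
    of degree 0 do not qualify in general. *)
Definition pw_poly br b := forall j, (j.+1 < size br)%N ->
  exists p : {poly R}, forall x, br`_j <= x <= br`_j.+1 -> b x = p.[x].

Lemma pw_polyD br b c : pw_poly br b -> pw_poly br c -> pw_poly br (fun x => b x + c x).
Proof.
move=> Hb Hc j jb; have [p Hp] := Hb j jb; have [q Hq] := Hc j jb.
by exists (p + q) => x xj; rewrite hornerD Hp // Hq.
Qed.

Lemma pw_polyM br b c : pw_poly br b -> pw_poly br c -> pw_poly br (fun x => b x * c x).
Proof.
move=> Hb Hc j jb; have [p Hp] := Hb j jb; have [q Hq] := Hc j jb.
by exists (p * q) => x xj; rewrite hornerM Hp // Hq.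
Qed.

Lemma pw_poly_horner br p : pw_poly br (fun x => p.[x]).
Proof. by move=> j _; exists p. Qed.

Lemma pw_poly_sum br (I : Type) (s : seq I) (b : I -> R -> R) :
  (forall i, pw_poly br (b i)) -> pw_poly br (fun x => \sum_(i <- s) b i x).
Proof.
move=> Hb; elim: s => [|i s IHs].
  move=> j _; exists 0 => x _; by rewrite big_nil horner0.
move=> j jb; have [p Hp] := pw_polyD (Hb i) IHs jb.
by exists p => x xj; rewrite big_cons Hp.
Qed.

Section Knots.
Context (q : nat) (Xi br : seq R).
Hypotheses (br2 : (2 <= size br)%N) (br_lt : sorted (fun a b : R => a < b) br)
  (br0 : head 0 br = 0) (br1 : last 0 br = 1) (XiE : Xi = nseq q 0 ++ br ++ nseq q 1).

Lemma breaks_lt i j : (i < j)%N -> (j < size br)%N -> br`_i < br`_j.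
Proof.
move=> ij jb; apply: (@sorted_ltn_nth _ <%O) => //; first exact: lt_trans.
by rewrite inE (ltn_trans ij).
Qed.

Lemma breaks_le i j : (i <= j)%N -> (j < size br)%N -> br`_i <= br`_j.
Proof.
by rewrite leq_eqVlt => /orP[/eqP->//|ij jb]; apply/ltW/breaks_lt.
Qed.

Lemma breaks_first : br`_0 = 0. Proof. by rewrite nth0. Qed.

Lemma breaks_last : br`_(size br).-1 = 1. Proof. by rewrite nth_last. Qed.

Lemma breaks_ge0 i : (i < size br)%N -> 0 <= br`_i.
Proof. by move=> ib; have := @breaks_le 0 i isT ib; rewrite breaks_first. Qed.

Lemma breaks_le1 i : (i < size br)%N -> br`_i <= 1.
Proof. by move=> ib; rewrite -breaks_last breaks_le //; lia. Qed.

Lemma size_knots : size Xi = (q + size br + q)%N.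
Proof. by rewrite XiE !size_cat !size_nseq addnA. Qed.

Lemma nth_knots j : (j < size br)%N -> Xi`_(q + j) = br`_j.
Proof.
move=> jb; rewrite XiE nth_cat size_nseq ltnNge leq_addr /= addKn.
by rewrite nth_cat jb.
Qed.

Lemma nth_knots_first i : (i <= q)%N -> Xi`_i = 0.
Proof.
rewrite leq_eqVlt => /orP[/eqP->|iq].
  by have := @nth_knots 0; rewrite addn0 breaks_first => -> //; apply: leq_trans br2.
by rewrite XiE nth_cat size_nseq iq nth_nseq iq.
Qed.

Lemma nth_knots_last i : (q + (size br).-1 <= i)%N -> (i < size Xi)%N -> Xi`_i = 1.
Proof.
rewrite leq_eqVlt => /orP[/eqP<-|iq] iX.
  by rewrite nth_knots ?breaks_last //; move: br2; case: (size br).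
rewrite size_knots in iX; rewrite XiE nth_cat size_nseq nth_cat.
have -> : (i < q)%N = false by lia.
have -> : (i - q < size br)%N = false by lia.
have lt : (i - q - size br < q)%N by lia.
by rewrite nth_nseq lt.
Qed.

Lemma knots01 l : (l < size Xi)%N -> 0 <= Xi`_l <= 1.
Proof.
move=> lX; have [lq|ql] := leqP l q; first by rewrite nth_knots_first // lexx ler01.
have [le|lt] := leqP (q + (size br).-1) l.
  by rewrite nth_knots_last // lexx ler01.
rewrite -(subnKC (ltnW ql)) nth_knots; last by lia.
by rewrite breaks_ge0 ?breaks_le1 //; lia.
Qed.

Lemma knots_le i k : (i <= k)%N -> (k < size Xi)%N -> Xi`_i <= Xi`_k.
Proof.
move=> ik kX.
have [iq|qi] := leqP i q.
  by rewrite nth_knots_first //; case/andP: (knots01 kX).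
have [le|lt] := leqP (q + (size br).-1) k.
  by rewrite [leRHS]nth_knots_last //; case/andP: (knots01 (leq_ltn_trans ik kX)).
rewrite -(subnKC (ltnW qi)) -(subnKC (ltnW (leq_trans qi ik))) !nth_knots; try lia.
by apply: breaks_le; lia.
Qed.

Lemma last_knots : last 0 Xi = 1.
Proof.
rewrite -nth_last nth_knots_last // ?size_knots; last by move: br2; lia.
by move: br2; lia.
Qed.

Lemma cdb0_elem j i x : (j.+1 < size br)%N -> (i.+1 < size Xi)%N ->
  br`_j <= x < br`_j.+1 -> cdb Xi 0 i x = (i == q + j)%N%:R.
Proof.
move=> jb iX /andP[x1 x2].
have E1 : Xi`_(q + j) = br`_j by rewrite nth_knots //; lia.
have E2 : Xi`_(q + j).+1 = br`_j.+1 by rewrite -addnS nth_knots.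
have xlt1 : x < 1 by apply: lt_le_trans x2 _; apply: breaks_le1.
have sX := size_knots.
rewrite /=; have [->|ne] := eqVneq i (q + j)%N.
  by rewrite E1 E2 x1 x2.
have -> : (Xi`_i <= x < Xi`_i.+1) = false.
  apply/negP => /andP[h1 h2]; case: (ltngtP i (q + j)%N) ne => // lt _.
    have : Xi`_i.+1 <= Xi`_(q + j) by apply: knots_le => //; lia.
    by rewrite E1 leNgt (le_lt_trans x1 h2).
  have : Xi`_(q + j).+1 <= Xi`_i by apply: knots_le => //; lia.
  by rewrite E2 leNgt (le_lt_trans h1 x2).
rewrite /=; case: ifP => // /and3P[_ /eqP xE /eqP e1].
by move: xlt1; rewrite xE e1 last_knots ltxx.
Qed.

(** Here the closed right end of the last span enters; it makes the splines of higher degree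
    continuous up to 1. *)
Lemma cdb0_last i : (i.+1 < size Xi)%N ->
  cdb Xi 0 i 1 = (i == q + (size br).-2)%N%:R.
Proof.
move=> iX.
have E1 : Xi`_(q + (size br).-2) = br`_(size br).-2 by rewrite nth_knots //; lia.
have E2 : Xi`_(q + (size br).-2).+1 = 1.
  by rewrite nth_knots_last // ?size_knots; move: br2; lia.
have lt1 : br`_(size br).-2 < 1.
  by rewrite -breaks_last; apply: breaks_lt; lia.
have sX := size_knots.
rewrite /= last_knots; have [->|ne] := eqVneq i (q + (size br).-2)%N.
  by rewrite E1 E2 lt1 !eqxx orbT.
have /andP[_ le1] := knots01 iX.
rewrite [1 < _]ltNge le1 andbF /=; case: ifP => // /and3P[h1 /eqP h2 _].
case: (ltngtP i (q + (size br).-2)%N) ne => // lt _.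
  have : Xi`_i.+1 <= Xi`_(q + (size br).-2) by apply: knots_le => //; lia.
  by rewrite E1 -h2 leNgt lt1.
have : Xi`_(q + (size br).-2).+1 <= Xi`_i by apply: knots_le => //; lia.
by rewrite E2 leNgt h2 h1.
Qed.

Lemma cdb1E i x : cdb Xi 1 i x =
  (x - Xi`_i) / (Xi`_i.+1 - Xi`_i) * cdb Xi 0 i x +
  (Xi`_i.+2 - x) / (Xi`_i.+2 - Xi`_i.+1) * cdb Xi 0 i.+1 x.
Proof. by rewrite [LHS]/= !addn1. Qed.

(* Simplicity of the interior knots is what makes the degree-1 functions continuous. *)
Lemma cdb1_pw_poly i : (i.+2 < size Xi)%N -> pw_poly br (cdb Xi 1 i).
Proof.
move=> iX j jb; set e := (q + j)%N.
have E1 : Xi`_e = br`_j by rewrite nth_knots //; lia.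
have E2 : Xi`_e.+1 = br`_j.+1 by rewrite /e -addnS nth_knots.
have jlt : br`_j < br`_j.+1 by apply: breaks_lt.
exists (if i == e then (br`_j.+1 - br`_j)^-1 *: ('X - (br`_j)%:P)
        else if i.+1 == e then (br`_j.+1 - br`_j)^-1 *: ((br`_j.+1)%:P - 'X) else 0).
move=> x /andP[x1 x2]; rewrite cdb1E.
have body : cdb Xi 0 i x = (i == e)%:R -> cdb Xi 0 i.+1 x = (i.+1 == e)%:R ->
  (x - Xi`_i) / (Xi`_i.+1 - Xi`_i) * cdb Xi 0 i x +
  (Xi`_i.+2 - x) / (Xi`_i.+2 - Xi`_i.+1) * cdb Xi 0 i.+1 x =
  (if i == e then (br`_j.+1 - br`_j)^-1 *: ('X - (br`_j)%:P)
   else if i.+1 == e then (br`_j.+1 - br`_j)^-1 *: ((br`_j.+1)%:P - 'X) else 0).[x].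
  move=> -> ->; have [->|ie] := eqVneq i e.
    have -> : (e.+1 == e) = false by apply/eqP; lia.
    by rewrite mulr0 addr0 mulr1 E1 E2 !hornerE mulrC.
  have [ei|_] := eqVneq i.+1 e; last by rewrite !mulr0 addr0 horner0.
  by rewrite ei mulr0 add0r mulr1 E1 E2 !hornerE mulrC.
move: x2; rewrite le_eqVlt => /orP[/eqP xE|x2]; last first.
  by apply: body; apply: cdb0_elem => //; rewrite ?x1 ?x2 //; lia.
(* At the right end of the element: in the last element this is 1 and the closed span decides;
   elsewhere [x] already belongs to the next span, whose formula takes the same value. *)
have [jl|jl] := leqP (size br) j.+2.
  have jE : j = (size br).-2 by lia.
  have x_eq1 : x = 1 by rewrite xE -breaks_last; congr nth; lia.
  have eE : e = (q + (size br).-2)%N by rewrite /e jE.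
  by apply: body; rewrite x_eq1 eE; apply: cdb0_last; lia.
have xin : br`_j.+1 <= x < br`_j.+2 by rewrite xE lexx breaks_lt.
have E3 : Xi`_e.+2 = br`_j.+2 by rewrite /e -!addnS nth_knots.
rewrite !(cdb0_elem jl _ xin); try lia.
rewrite addnS eqSS -/e.
have [ie|ie] := eqVneq i e.
  have -> : (i == e.+1) = false by apply/eqP; lia.
  rewrite mulr0 add0r ie mulr1 E2 E3 xE divff ?hornerE.
    by rewrite mulVf // subr_eq0 gt_eqF.
  by rewrite subr_eq0 gt_eqF // breaks_lt.
rewrite mulr0 addr0; have [->|ie1] := eqVneq i e.+1.
  have -> : (e.+2 == e) = false by apply/eqP; lia.
  by rewrite E2 xE subrr !mul0r horner0.
rewrite mulr0; case: ifP => _; last by rewrite horner0.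
by rewrite !hornerE xE subrr mulr0.
Qed.

Lemma cdb_pw_poly p i : (i + p.+2 < size Xi)%N -> pw_poly br (cdb Xi p.+1 i).
Proof.
elim: p i => [|p IHp] i iX.
  by apply: cdb1_pw_poly; rewrite addn2 in iX.
have lin (a b : R) : pw_poly br (fun x => (x - a) / b).
  move=> j _; exists (b^-1 *: ('X - a%:P)) => x _.
  by rewrite !hornerE mulrC.
have lin' (a b : R) : pw_poly br (fun x => (a - x) / b).
  move=> j _; exists (b^-1 *: (a%:P - 'X)) => x _.
  by rewrite !hornerE mulrC.
have := pw_polyD (pw_polyM (lin Xi`_i (Xi`_(i + p.+2) - Xi`_i)) (IHp i _))
  (pw_polyM (lin' Xi`_(i + p.+2 + 1) (Xi`_(i + p.+2 + 1) - Xi`_i.+1)) (IHp i.+1 _)).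
by apply; lia.
Qed.

Lemma bspline_pw_poly i : (0 < q)%N -> pw_poly br (bspline Xi q i).
Proof.
move=> q0; have [iX|iX] := ltnP i (size Xi - q.+1); last first.
  by move=> j _; exists 0 => x _; rewrite horner0 /bspline ltnNge iX.
have -> : bspline Xi q i = cdb Xi q.-1.+1 i.
  by apply/funext => x; rewrite /bspline iX prednK.
by apply: cdb_pw_poly; lia.
Qed.

End Knots.
End PiecewisePoly.

(** * Calculus of piecewise polynomials *)

Section PolyCalculus.
Context (R : realType).
Notation leb := (@lebesgue_measure R).

Lemma Rintegral_sum d (T : measurableType d) (m : {measure set T -> \bar R})
    (I : Type) (s : seq I) (g : I -> T -> R) :
  (forall i, m.-integrable setT (EFin \o g i)) ->
  \int[m]_x (\sum_(i <- s) g i x) = \sum_(i <- s) \int[m]_x g i x.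
Proof.
move=> ig; elim: s => [|i s IHs].
  under eq_Rintegral do rewrite big_nil.
  by rewrite big_nil /Rintegral integral0.
under eq_Rintegral do rewrite big_cons.
rewrite big_cons -IHs RintegralD //.
have -> : EFin \o (fun x => \sum_(i <- s) g i x) = (fun x => \sum_(i <- s) (g i x)%:E)%E.
  by apply/funext => x; rewrite /= sumEFin.
by apply: integrable_sum => // j _; apply: ig.
Qed.

Lemma integrable_sumR d (T : measurableType d) (m : {measure set T -> \bar R})
    (I : Type) (s : seq I) (g : I -> T -> R) :
  (forall i, m.-integrable setT (EFin \o g i)) ->
  m.-integrable setT (EFin \o (fun x => \sum_(i <- s) g i x)).
Proof.
move=> ig.
have -> : EFin \o (fun x => \sum_(i <- s) g i x) = (fun x => \sum_(i <- s) (g i x)%:E)%E.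
  by apply/funext => x; rewrite /= sumEFin.
by apply: integrable_sum => // j _; apply: ig.
Qed.

Lemma integrableZlR d (T : measurableType d) (m : {measure set T -> \bar R}) (k : R) (g : T -> R) :
  m.-integrable setT (EFin \o g) -> m.-integrable setT (EFin \o (fun x => k * g x)).
Proof.
move=> ig; have -> : EFin \o (fun x => k * g x) = (fun x => k%:E * (EFin \o g) x)%E.
  by apply/funext => x; rewrite /= EFinM.
exact: integrableZl.
Qed.

Lemma poly_lipschitz (p : {poly R}) (a b : R) : exists2 L, 0 <= L &
  forall x y, a <= x <= b -> a <= y <= b -> `|p.[x] - p.[y]| <= L * `|x - y|.
Proof.
pose B := `|a| + `|b|.
have xB x : a <= x <= b -> `|x| <= B.
  move=> /andP[ax xb]; rewrite ler_norml; apply/andP; split; rewrite /B.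
    by have := ler_norm (- a); rewrite normrN; have := normr_ge0 b; lra.
  by have := ler_norm b; have := normr_ge0 a; lra.
have B0 : 0 <= B by rewrite addr_ge0.
elim/poly_ind: p => [|p c [L L0 HL]].
  by exists 0 => // x y _ _; rewrite !horner0 subrr normr0 mul0r.
have [ab|ba] := leP a b; last first.
  by exists 0 => // x y /andP[h1 h2]; have := le_trans h1 h2; rewrite leNgt ba.
pose M := `|p.[a]| + L * (b - a).
have pM x : a <= x <= b -> `|p.[x]| <= M.
  move=> xab; have := HL x a xab; rewrite lexx ab => /(_ isT) h.
  have -> : p.[x] = p.[a] + (p.[x] - p.[a]) by ring.
  apply: le_trans (ler_normD _ _) _; rewrite lerD2l (le_trans h) //.
  by case/andP: xab => ax xb; rewrite ler_wpM2l // ger0_norm ?subr_ge0 // lerD2r.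
have M0 : 0 <= M by rewrite addr_ge0 ?mulr_ge0 ?subr_ge0.
exists (M + B * L); first by rewrite addr_ge0 ?mulr_ge0.
move=> x y xab yab; rewrite !hornerE.
have -> : p.[x] * x + c - (p.[y] * y + c) = p.[x] * (x - y) + y * (p.[x] - p.[y]) by ring.
apply: le_trans (ler_normD _ _) _; rewrite !normrM mulrDl lerD //.
  by rewrite ler_wpM2r ?pM.
by rewrite -mulrA ler_pM // ?xB // HL.
Qed.

Lemma Rintegral_poly_deriv (p : {poly R}) (a b : R) : a <= b ->
  leb.-integrable setT (EFin \o (fun x => \1_(`]a, b[) x * (deriv p).[x])) /\
  \int[leb]_x (\1_(`]a, b[) x * (deriv p).[x]) = p.[b] - p.[a].
Proof.
move=> ab.
have icc : leb.-integrable `[a, b] (EFin \o (horner (deriv p))).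
  apply: continuous_compact_integrable; first exact: segment_compact.
  by apply: continuous_subspaceT; exact: continuous_horner.
have ioo : leb.-integrable `]a, b[ (EFin \o (horner (deriv p))).
  apply: integrableS icc => //; exact: subset_itv_oo_cc.
have E : (fun x => \1_(`]a, b[) x * (deriv p).[x]) = (horner (deriv p)) \_ (`]a, b[).
  by apply/funext => x; rewrite patchE indicE; case: ifP; rewrite ?mul1r ?mul0r.
rewrite E; split.
  by rewrite -restrict_EFin; apply: (integrable_mkcond _ _).1 ioo.
rewrite -Rintegral_mkcond.
move: ab; rewrite le_eqVlt => /orP[/eqP<-|ab].
  by rewrite set_itvoo0 Rintegral_set0 subrr.
rewrite Rintegral_itv_bndo_bndc // Rintegral_itv_obnd_cbnd; last first.
  by apply: integrableS icc => //; exact: subset_itv_oc_cc.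
have der x : is_derive x (1 : R) (horner p) (deriv p).[x] := is_derive_poly p x.
have cp : continuous (horner p) := @continuous_horner R p.
rewrite /Rintegral (@continuous_FTC2 _ _ (horner p)) //.
- by apply: continuous_subspaceT; exact: continuous_horner.
- split; first by move=> x _; exact: ex_derive.
    by apply: cvg_at_right_filter; exact: cp.
  by apply: cvg_at_left_filter; exact: cp.
- by move=> x _; rewrite derive1E; apply: derive_val.
Qed.

End PolyCalculus.

Section PiecewisePolyCalculus.
Context (R : realType) (br : seq R).
Notation leb := (@lebesgue_measure R).
Hypotheses (br2 : (2 <= size br)%N)
  (br_ltn : forall i j, (i < j)%N -> (j < size br)%N -> br`_i < br`_j).
Let lo := br`_0.
Let hi := br`_(size br).-1.
Implicit Types b : R -> R.

Let br_le i j : (i <= j)%N -> (j < size br)%N -> br`_i <= br`_j.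
Proof.
by rewrite leq_eqVlt => /orP[/eqP->//|ij jb]; apply/ltW/br_ltn.
Qed.

Lemma find_elem x : lo <= x <= hi ->
  exists j, (j.+1 < size br)%N /\ br`_j <= x <= br`_j.+1.
Proof.
move=> /andP[x0 x1].
have H k : (k.+1 < size br)%N -> x <= br`_k.+1 ->
    exists j, (j.+1 < size br)%N /\ br`_j <= x <= br`_j.+1.
  elim: k => [|k IHk] kb xk; first by exists 0%N; rewrite xk -/lo x0.
  have [xk'|xk'] := leP x br`_k.+1; first by apply: IHk => //; lia.
  by exists k.+1; rewrite kb xk ltW.
apply: (H (size br).-2); first by lia.
by move: x1; rewrite /hi; congr (_ <= br`_ _); lia.
Qed.

Definition open_elems : set R := [set x | lo < x < hi /\ x \notin br].

Lemma find_open_elem x : open_elems x ->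
  exists j, (j.+1 < size br)%N /\ br`_j < x < br`_j.+1.
Proof.
move=> [/andP[x0 x1] xbr].
have [|j [jb /andP[h1 h2]]] := @find_elem x; first by rewrite !ltW.
exists j; split=> //; rewrite !lt_neqAle h1 h2 !andbT; apply/andP; split.
  by apply: contra xbr => /eqP <-; apply: mem_nth; exact: ltnW.
by apply: contra xbr => /eqP ->; apply: mem_nth.
Qed.

Lemma open_elemsP j x : (j.+1 < size br)%N -> br`_j < x < br`_j.+1 -> open_elems x.
Proof.
move=> jb /andP[h1 h2]; split.
  rewrite (le_lt_trans _ h1) ?(lt_le_trans h2) //; first by apply: br_le; lia.
  by apply: br_le => //; lia.
apply/negP => /(nthP 0)[i ib ix]; subst x.
have [ij|ji] := leqP i j.
  by move: h1; rewrite ltNge br_le //; lia.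
by move: h2; rewrite ltNge br_le.
Qed.

Lemma indic_open_elems x :
  \1_open_elems x = \sum_(j < (size br).-1) \1_(`]br`_j, br`_j.+1[) x :> R.
Proof.
have jlt (j : 'I_(size br).-1) : (j.+1 < size br)%N by have := ltn_ord j; lia.
rewrite indicE; have [|nx] := boolP (x \in open_elems).
  rewrite inE => /find_open_elem[j [jb xj]].
  have jb' : (j < (size br).-1)%N by lia.
  rewrite (bigD1 (Ordinal jb')) //= big1 => [|i ij].
    by rewrite addr0 indicE mem_set /= ?in_itv.
  rewrite indicE memNset //= in_itv /= => /andP[i1 i2].
  have ij' : i <> j :> nat by move=> e; move/eqP: ij; apply; apply/val_inj.
  case/andP: xj => j1 j2.
  have [lt|lt|//] := ltngtP i j.
    have : br`_i.+1 <= br`_j by apply: br_le => //; lia.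
    by rewrite leNgt (lt_trans j1 i2).
  have : br`_j.+1 <= br`_i by apply: br_le => //; have := jlt i; lia.
  by rewrite leNgt (lt_trans i1 j2).
rewrite big1 // => i _; rewrite indicE memNset //= in_itv /= => xi.
by move: nx; rewrite notin_setE; apply; apply: open_elemsP xi.
Qed.

Section OneFunction.
Context (b : R -> R).
Hypothesis pb : pw_poly br b.

Lemma pw_poly_piece : exists p : nat -> {poly R}, forall j, (j.+1 < size br)%N ->
  forall x, br`_j <= x <= br`_j.+1 -> b x = (p j).[x].
Proof.
have H j : exists p : {poly R}, (j.+1 < size br)%N ->
    forall x, br`_j <= x <= br`_j.+1 -> b x = p.[x].
  have [/pb[p Hp]|_] := boolP (j.+1 < size br)%N; first by exists p.
  by exists 0.
by exists (fun j => projT1 (cid (H j))) => j; exact: projT2 (cid (H j)).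
Qed.

Lemma pw_poly_lipschitz : exists2 L, 0 <= L &
  forall x y, lo <= x <= hi -> lo <= y <= hi -> `|b x - b y| <= L * `|x - y|.
Proof.
have [p Hp] := pw_poly_piece.
have Hl j := cid2 (poly_lipschitz (p j) br`_j br`_j.+1).
pose l j := s2val (Hl j).
have l0 j : 0 <= l j := s2valP (Hl j).
pose L := \sum_(j < size br) l j.
have lL j : (j.+1 < size br)%N -> l j <= L.
  move=> jb; have jb' : (j < size br)%N by lia.
  rewrite /L (bigD1 (Ordinal jb')) //= lerDl sumr_ge0 // => i _; exact: l0.
have L0 : 0 <= L by apply: sumr_ge0.
have elemL j x y : (j.+1 < size br)%N -> br`_j <= x -> x <= y -> y <= br`_j.+1 ->
    `|b x - b y| <= L * (y - x).
  move=> jb jx xy yj.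
  have xin : br`_j <= x <= br`_j.+1 by rewrite jx (le_trans xy).
  have yin : br`_j <= y <= br`_j.+1 by rewrite yj (le_trans jx).
  rewrite !(Hp _ jb) //; apply: le_trans (s2valP' (Hl j) x y xin yin) _.
  rewrite distrC ger0_norm ?subr_ge0 // ler_wpM2r ?subr_ge0 //; exact: lL.
have main k : (k < size br)%N -> forall x y, lo <= x -> x <= y -> y <= br`_k ->
    `|b x - b y| <= L * (y - x).
  elim: k => [|k IHk] kb x y x0 xy yk.
    have -> : x = y by apply/le_anti; rewrite xy (le_trans yk).
    by rewrite !subrr normr0 mulr0.
  have kb' : (k < size br)%N by lia.
  have [yk'|yk'] := leP y br`_k; first exact: IHk.
  have [xk|xk] := leP br`_k x; first exact: (elemL k).
  have -> : b x - b y = (b x - b br`_k) + (b br`_k - b y) by ring.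
  apply: le_trans (ler_normD _ _) _.
  have -> : L * (y - x) = L * (br`_k - x) + L * (y - br`_k) by ring.
  by apply: lerD; [apply: IHk; rewrite // ltW | apply: (elemL k); rewrite // ltW].
exists L => // x y /andP[x0 x1] /andP[y0 y1].
have lastb : ((size br).-1 < size br)%N by lia.
have [xy|yx] := leP x y.
  have -> : `|x - y| = y - x by rewrite distrC ger0_norm ?subr_ge0.
  exact: (main _ lastb).
have -> : `|x - y| = x - y by rewrite gtr0_norm ?subr_gt0.
by rewrite distrC; apply: (main _ lastb) => //; exact: ltW.
Qed.

Lemma pw_poly_near j p (x : R) : (j.+1 < size br)%N ->
  (forall x : R, br`_j <= x <= br`_j.+1 -> b x = p.[x]) -> br`_j < x < br`_j.+1 ->
  \forall y \near x, br`_j < y < br`_j.+1 /\ b y = p.[y].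
Proof.
move=> jb Hp xj.
have : \forall y \near x, y \in `]br`_j, br`_j.+1[.
  by apply: near_in_itvoo; rewrite in_itv.
apply: filterS => y; rewrite in_itv /= => yj; split => //.
by apply: Hp; case/andP: yj => h1 h2; rewrite !ltW.
Qed.

Lemma pw_poly_derive1 j p (x : R) : (j.+1 < size br)%N ->
  (forall x : R, br`_j <= x <= br`_j.+1 -> b x = p.[x]) -> br`_j < x < br`_j.+1 ->
  is_derive x (1 : R) b (deriv p).[x] /\ derive1 b x = (deriv p).[x].
Proof.
move=> jb Hp xj.
have d : is_derive x (1 : R) b (deriv p).[x].
  have dp : is_derive x (1 : R) (horner p) (deriv p).[x] := is_derive_poly p x.
  apply: near_eq_is_derive dp.
  by apply: filterS (pw_poly_near jb Hp xj) => y [_ ->].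
by split => //; rewrite derive1E; apply: derive_val.
Qed.

Lemma pw_poly_is_derive x : open_elems x -> is_derive x (1 : R) b (derive1 b x).
Proof.
move=> /find_open_elem[j [jb xj]]; have [p Hp] := pb jb.
by have [d ->] := pw_poly_derive1 jb Hp xj.
Qed.

Lemma pw_poly_derive1_continuous x : open_elems x -> {for x, continuous (derive1 b)}.
Proof.
move=> /find_open_elem[j [jb xj]]; have [p Hp] := pb jb.
have [_ e] := pw_poly_derive1 jb Hp xj.
suff : derive1 b y @[y --> x] --> (deriv p).[x] by rewrite -e.
have : (fun y => (deriv p).[y]) @ x --> (deriv p).[x] by exact: continuous_horner.
apply: cvg_trans; apply: near_eq_cvg.
apply: filterS (pw_poly_near jb Hp xj) => y [yj _].
by have [_ ->] := pw_poly_derive1 jb Hp yj.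
Qed.

Lemma pw_poly_derive1_bounded : exists C, forall x, open_elems x -> `|derive1 b x| <= C.
Proof.
have [L L0 HL] := pw_poly_lipschitz.
have [p Hp] := pw_poly_piece.
have Hl j := cid2 (poly_lipschitz (deriv (p j)) br`_j br`_j.+1).
pose c j := `|(deriv (p j)).[br`_j]| + s2val (Hl j) * (br`_j.+1 - br`_j).
exists (\sum_(j < size br) `|c j|) => x /find_open_elem[j [jb xj]].
have [_ ->] := pw_poly_derive1 jb (Hp j jb) xj.
have jb' : (j < size br)%N by lia.
rewrite (bigD1 (Ordinal jb')) //=; apply: ler_wpDr; first by apply: sumr_ge0.
apply: le_trans (ler_norm _); rewrite /c.
have -> : (deriv (p j)).[x] = (deriv (p j)).[br`_j] + ((deriv (p j)).[x] - (deriv (p j)).[br`_j]) by ring.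
apply: le_trans (ler_normD _ _) _; rewrite lerD2l.
case/andP: xj => h1 h2.
have xin : br`_j <= x <= br`_j.+1 by rewrite !ltW.
have jin : br`_j <= br`_j <= br`_j.+1 by rewrite lexx (ltW (lt_trans h1 h2)).
apply: le_trans (s2valP' (Hl j) x br`_j xin jin) _.
apply: ler_wpM2l; first exact: s2valP (Hl j).
by rewrite gtr0_norm ?subr_gt0 // lerD2r ltW.
Qed.

Definition pw_deriv (x : R) : R := \1_open_elems x * derive1 b x.

(** The pieces match at the breakpoints, so the increments over the elements telescope. *)
Lemma pw_deriv_FTC : leb.-integrable setT (EFin \o pw_deriv) /\
  \int[leb]_x pw_deriv x = b hi - b lo.
Proof.
have [p Hp] := pw_poly_piece.
pose g (j : 'I_(size br).-1) x := \1_(`]br`_j, br`_j.+1[) x * (deriv (p j)).[x].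
have jlt (j : 'I_(size br).-1) : (j.+1 < size br)%N by have := ltn_ord j; lia.
have E : pw_deriv = (fun x => \sum_j g j x).
  apply/funext => x; rewrite /pw_deriv indic_open_elems mulr_suml.
  apply: eq_bigr => j _; rewrite /g indicE; case: (boolP (x \in _)) => [|_]; last by rewrite !mul0r.
  rewrite inE /= in_itv /= => xj.
  by have [_ ->] := pw_poly_derive1 (jlt j) (Hp j (jlt j)) xj.
have H j := @Rintegral_poly_deriv R (p (j : 'I_(size br).-1)) br`_j br`_j.+1
  (br_le (leqnSn j) (jlt j)).
rewrite E; split.
  by apply: integrable_sumR => j; exact: (H j).1.
rewrite Rintegral_sum; last by move=> j; exact: (H j).1.
under eq_bigr do rewrite (H _).2.
rewrite (eq_bigr (fun j : 'I_(size br).-1 => b br`_j.+1 - b br`_j)); last first.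
  move=> j _; have lt := br_le (leqnSn j) (jlt j).
  by rewrite !(Hp j (jlt j)) // lexx lt.
rewrite -(big_mkord xpredT (fun j => b br`_j.+1 - b br`_j)).
by rewrite telescope_sumr // -/hi -/lo.
Qed.

End OneFunction.

Lemma open_elems_open : open open_elems.
Proof.
rewrite openE => x /find_open_elem[j [jb xj]] /=.
have : \forall y \near x, y \in `]br`_j, br`_j.+1[ by apply: near_in_itvoo; rewrite in_itv.
by apply: filterS => y; rewrite in_itv /=; exact: open_elemsP.
Qed.

Lemma open_elems_conull : leb.-negligible [set x | lo < x < hi /\ ~ open_elems x].
Proof.
apply: (@negligibleS _ _ _ leb [set` br]); last first.
  exists [set` br]; split => //.
    apply: countable_measurable; first by move=> t; exact: measurable_set1.
    by apply: finite_set_countable; exact: finite_seq.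
  by apply: countable_lebesgue_measure0; apply: finite_set_countable; exact: finite_seq.
move=> x [xh nx] /=; apply: contrapT => xbr; apply: nx; split => //.
exact/negP.
Qed.

End PiecewisePolyCalculus.

(** * Tensor-product splines and the geometry map *)

Section RowAnalysis.
Context (R : realType).

(** Lipschitz for the sup norm, with [r] an arbitrary bound of the coordinate differences, so that
    estimates proceed coordinate by coordinate. *)
Definition row_lipschitz n (A : set 'rV[R]_n) (L : R) (f : 'rV[R]_n -> R) : Prop :=
  forall z z' (r : R), A z -> A z' -> 0 <= r -> (forall i, `|z 0 i - z' 0 i| <= r) -> `|f z - f z'| <= L * r.

Lemma row_lipschitz_continuous n L (f : 'rV[R]_n -> R) :
  0 <= L -> row_lipschitz setT L f -> continuous f.
Proof.
move=> L0 fL z A /nbhs_ballP[e /= e0 eA].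
have L1 : 0 < L + 1 by rewrite ltr_wpDl.
apply/nbhs_ballP; exists (e / (L + 1)) => /=; first by rewrite divr_gt0.
move=> y zy; apply: eA; rewrite /ball /=.
apply: le_lt_trans (fL z y (e / (L + 1)) I I _ _) _.
- by rewrite divr_ge0 // ltW.
- by move=> i; apply/ltW; exact: rowv_ballP.
by rewrite mulrA ltr_pdivrMr // mulrC ltr_pM2l // ltrDl.
Qed.

Lemma rowv_continuous (T : topologicalType) n (f : T -> 'rV[R]_n) :
  (forall i, continuous (fun x => f x 0 i)) -> continuous f.
Proof.
move=> fc x; apply/cvgrPdist_lt => e e0.
have H : \forall y \near x, forall i, `|f x 0 i - f y 0 i| < e.
  by apply: filter_forall => i; have /cvgrPdist_lt/(_ e e0) := fc i x.
apply: filterS H => y H.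
have := rowv_ball _ _ (f x) (f y) e e0 H.
by rewrite -ball_normE.
Qed.

Lemma continuous_prod_at (T : topologicalType) (I : Type) (s : seq I) (P : pred I) (f : I -> T -> R) x :
  (forall i, {for x, continuous (f i)}) ->
  {for x, continuous (fun y => \prod_(i <- s | P i) f i y)}.
Proof.
move=> fc; elim: s => [|i s IHs].
  have -> : (fun y => \prod_(i <- [::] | P i) f i y) = (fun=> 1).
    by apply/funext => y; rewrite big_nil.
  exact: cst_continuous.
have -> : (fun y => \prod_(i <- i :: s | P i) f i y) =
    (fun y => (if P i then f i y else 1) * \prod_(i <- s | P i) f i y).
  by apply/funext => y; rewrite big_cons; case: ifP; rewrite ?mul1r.
apply: continuousM => //.
by case: (P i) => //; exact: cst_continuous.
Qed.

Lemma continuous_sum_at (T : topologicalType) (I : Type) (s : seq I) (f : I -> T -> R) x :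
  (forall i, {for x, continuous (f i)}) ->
  {for x, continuous (fun y => \sum_(i <- s) f i y)}.
Proof.
move=> fc; elim: s => [|i s IHs].
  have -> : (fun y => \sum_(i <- [::]) f i y) = (fun=> 0).
    by apply/funext => y; rewrite big_nil.
  exact: cst_continuous.
have -> : (fun y => \sum_(i <- i :: s) f i y) = (fun y => f i y + \sum_(i <- s) f i y).
  by apply/funext => y; rewrite big_cons.
exact: continuousD.
Qed.

Lemma prod_is_derive (I : eqType) (s : seq I) (f : I -> R -> R) (df : I -> R) (x : R) :
  uniq s -> (forall i, is_derive x (1 : R) (f i) (df i)) ->
  is_derive x (1 : R) (fun y => \prod_(i <- s) f i y)
    (\sum_(i <- s) df i * \prod_(j <- s | j != i) f j x).
Proof.
move=> + fd; elim: s => [_|i s IHs /= /andP[ni us]].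
  rewrite big_nil (_ : (fun y => _) = cst 1); first exact: is_derive_cst.
  by apply/funext => y; rewrite big_nil.
rewrite (_ : (fun y => _) = f i * (fun y => \prod_(i <- s) f i y)); last first.
  by apply/funext => y; rewrite big_cons.
have := is_deriveM (fd i) (IHs us).
move/is_derive_eq; apply.
rewrite big_cons big_cons eqxx /= addrC; congr (_ + _).
  rewrite [LHS]mulrC; congr (_ * _); rewrite big_seq [RHS]big_seq_cond.
  apply: eq_big => // j; case: (boolP (j \in s)) => //= js.
  by apply/esym; apply: contraNneq ni => <-.
rewrite /GRing.scale /= mulr_sumr; apply: eq_big_seq => j js.
rewrite big_cons ifT; first by rewrite mulrCA.
by apply: contraNneq ni => ->.
Qed.

Lemma prod_lipschitz (T I : Type) (s : seq I) (f : I -> T -> R) (A : set T) (D : T -> T -> R -> Prop) :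
  (forall i, exists2 C, 0 <= C & (forall z, A z -> `|f i z| <= C) /\
    forall z z' r, A z -> A z' -> 0 <= r -> D z z' r -> `|f i z - f i z'| <= C * r) ->
  exists2 C, 0 <= C & (forall z, A z -> `|\prod_(i <- s) f i z| <= C) /\
    forall z z' r, A z -> A z' -> 0 <= r -> D z z' r ->
      `|\prod_(i <- s) f i z - \prod_(i <- s) f i z'| <= C * r.
Proof.
move=> Hf; elim: s => [|i s [K K0 [Kb Kl]]].
  exists 1 => //; split=> [z _|z z' r _ _ r0 _]; first by rewrite big_nil normr1.
  by rewrite !big_nil subrr normr0 mul1r.
have [C C0 [Cb Cl]] := Hf i.
have M0 : 0 <= C * K by rewrite mulr_ge0.
exists (C * K + C * K); first by rewrite addr_ge0.
split=> [z Az|z z' r Az Az' r0 zr]; rewrite !big_cons.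
  by rewrite normrM ler_wpDr // ler_pM // ?Cb ?Kb.
set p := \prod_(i <- s) f i z; set p' := \prod_(i <- s) f i z'.
have -> : f i z * p - f i z' * p' = (f i z - f i z') * p + f i z' * (p - p') by ring.
apply: le_trans (ler_normD _ _) _; rewrite !normrM mulrDl lerD //.
  rewrite mulrAC; apply: ler_pM => //; [exact: Cl | exact: Kb].
rewrite -mulrA; apply: ler_pM => //; [exact: Cb | exact: Kl].
Qed.

Lemma curve_quotient (V W : normedModType R) (f : V -> W) (a v : V) :
  (fun h : R => h^-1 *: ((f \o shift a) (h *: v) - f a)) =
  (fun h : R => h^-1 *: (((fun h : R => f (a + h *: v)) \o shift 0) (h *: (1 : R)) - f (a + 0 *: v))).
Proof.
apply/funext => h /=; rewrite scale0r !addr0 [a + _]addrC.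
by have -> : h *: (1 : R) = h by exact: mulr1.
Qed.

(** Directional derivatives become derivatives of real curves. This gives a chain rule for
    compositions with [Finv], of which only directional derivatives are available. *)
Lemma derive_curve (V W : normedModType R) (f : V -> W) (a v : V) :
  'D_v f a = 'D_(1 : R) (fun h : R => f (a + h *: v)) (0 : R).
Proof. by rewrite /derive curve_quotient. Qed.

Lemma derivable_curve (V W : normedModType R) (f : V -> W) (a v : V) :
  derivable f a v <-> derivable (fun h : R => f (a + h *: v)) (0 : R) (1 : R).
Proof. by rewrite /derivable curve_quotient. Qed.

Lemma is_derive_row_coord n (g : R -> 'rV[R]_n) (x : R) i : derivable g x (1 : R) ->
  is_derive x (1 : R) (fun h => g h 0 i) ('D_1 g x 0 i).
Proof.
move=> dg; apply: DeriveDef; first by have /derivable_mxP := dg; apply.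
by rewrite (derive_mx dg) mxE.
Qed.

End RowAnalysis.

Lemma sum_is_derive (R : realType) (I : Type) (r : seq I) (f : I -> R -> R) (df : I -> R) (x : R) :
  (forall i, is_derive x (1 : R) (f i) (df i)) ->
  is_derive x (1 : R) (fun h => \sum_(i <- r) f i h) (\sum_(i <- r) df i).
Proof.
move=> fd; elim: r => [|i r IH].
  under eq_fun do rewrite big_nil.
  by rewrite big_nil; exact: is_derive_cst.
under eq_fun do rewrite big_cons.
by rewrite big_cons; exact: is_deriveD.
Qed.

Lemma near_forall (T : topologicalType) (I : finType) (P : I -> set T) (x : T) :
  (forall i, nbhs x (P i)) -> nbhs x [set y | forall i, P i y].
Proof. by move=> H; exact: filter_forall. Qed.

Section TensorSplines.
Context (R : realType) (d m q : nat) (Xi br : 'I_d -> seq R).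
Hypotheses (br2 : forall k, (2 <= size (br k))%N)
  (br_lt : forall k, sorted (fun a b : R => a < b) (br k))
  (br0 : forall k, head 0 (br k) = 0) (br1 : forall k, last 0 (br k) = 1)
  (XiE : forall k, Xi k = nseq q 0 ++ br k ++ nseq q 1) (q0 : (0 < q)%N)
  (Xi_m : forall k, (size (Xi k) <= m)%N).
Notation MI := {ffun 'I_d -> 'I_m}.
Implicit Types (c : MI -> R) (z : 'rV[R]_d).

Definition tb (k : 'I_d) (i : nat) : R -> R := bspline (Xi k) q i.
(** All directions share the index range ['I_m], with [m] at least the number of knots; surplus
    indices carry zero B-splines, so the coefficients of a spline are not unique. *)
Definition tspline c z : R := \sum_I c I * bspline_space Xi q (fun k => I k) z.
Definition mesh_pts : set 'rV[R]_d := [set z | forall k, open_elems (br k) (z 0 k)].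
Definition dtspline (l : 'I_d) c z : R :=
  \sum_I c I * (derive1 (tb l (I l)) (z 0 l) * \prod_(k | k != l) tb k (I k) (z 0 k)).

Let brlt k i j : (i < j)%N -> (j < size (br k))%N -> (br k)`_i < (br k)`_j.
Proof. exact: (breaks_lt (br_lt k)). Qed.

Let lo0 k : (br k)`_0 = 0. Proof. by rewrite nth0. Qed.
Let hi1 k : (br k)`_(size (br k)).-1 = 1. Proof. by rewrite nth_last. Qed.

Lemma tb_pw_poly k i : pw_poly (br k) (tb k i).
Proof. exact: (bspline_pw_poly (br2 k) (br_lt k) (br0 k) (br1 k) (XiE k)). Qed.

Lemma bspline_coef (J : 'I_d -> nat) :
  exists c, forall z, bspline_space Xi q J z = tspline c z.
Proof.
pose c (I : MI) : R := if [forall k, I k == J k :> nat] then 1 else 0.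
exists c => z; rewrite /tspline.
have [Jm|] := boolP [forall k, (J k < m)%N].
  pose I0 : MI := [ffun k => Ordinal (forallP Jm k)].
  rewrite (bigD1 I0) //= big1 ?addr0 => [|I /negbTE II0].
    rewrite /c ifT ?mul1r; last by apply/forallP => k; rewrite ffunE.
    by apply: eq_bigr => k _; rewrite ffunE.
  rewrite /c ifF ?mul0r //; apply/negP => /forallP IJ.
  by move/eqP: II0; apply; apply/ffunP => k; apply/val_inj; rewrite ffunE /=; apply/eqP.
rewrite negb_forall => /existsP[k]; rewrite -leqNgt => mJ.
rewrite big1 => [|I _].
  rewrite /bspline_space (bigD1 k) //= /bspline ifF ?mul0r //.
  by apply/negbTE; rewrite -leqNgt; have := Xi_m k; lia.
rewrite /c ifF ?mul0r //; apply/negP => /forallP /(_ k) /eqP IJ.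
by have := ltn_ord (I k); rewrite IJ ltnNge mJ.
Qed.

Lemma tsplineD c c' z : tspline (fun I => c I + c' I) z = tspline c z + tspline c' z.
Proof. by rewrite -big_split /=; apply: eq_bigr => I _; rewrite mulrDl. Qed.

Lemma tsplineZ a c z : tspline (fun I => a * c I) z = a * tspline c z.
Proof. by rewrite mulr_sumr; apply: eq_bigr => I _; rewrite mulrA. Qed.

Lemma spline_space_coef g : spline_space Xi q g -> exists c, forall z, g z = tspline c z.
Proof.
move=> [s gE]; suff [c cE] : exists c, forall z,
    \sum_(p <- s) p.2 * bspline_space Xi q p.1 z = tspline c z.
  by exists c => z; rewrite gE cE.
elim: {gE} s => [|p s [c cE]].
  exists (fun=> 0) => z; rewrite big_nil /tspline big1 // => I _; exact: mul0r.
have [c' c'E] := bspline_coef p.1.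
exists (fun I => p.2 * c' I + c I) => z.
by rewrite big_cons tsplineD tsplineZ -c'E cE.
Qed.

Lemma mesh_open_cube z : mesh_pts z -> open_cube d z.
Proof. by move=> zm k; have [] := zm k; rewrite lo0 hi1. Qed.

Lemma open_closed_cube z : open_cube d z -> closed_cube d z.
Proof. by move=> zc k; have /andP[h1 h2] := zc k; rewrite !ltW. Qed.

Lemma mesh_pts_open : open mesh_pts.
Proof.
suff H (z : 'rV[R]_d) : mesh_pts z -> \forall y \near z, mesh_pts y by rewrite openE => z /H.
move=> zm.
have : nbhs z [set y : 'rV[R]_d | forall k, open_elems (br k) (y 0 k)].
  apply: (@near_forall _ _ (fun k (y : 'rV[R]_d) => open_elems (br k) (y 0 k))) => k.
  have o : open (open_elems (br k)) by apply: open_elems_open; [exact: br2 | exact: brlt].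
  have cc : {for z, continuous (fun y : 'rV[R]_d => y 0 k)} by exact: coord_continuous.
  exact: (cc _ (open_nbhs_nbhs (conj o (zm k)))).
by apply: filterS.
Qed.

(** Only the coordinates of the curve are differentiated, so the chain rule covers both straight
    lines and the image of a line under [Finv]. *)
Lemma tspline_curve c (g : R -> 'rV[R]_d) (w : 'rV[R]_d) (x : R) : mesh_pts (g x) ->
  (forall k, is_derive x (1 : R) (fun h => g h 0 k) (w 0 k)) ->
  is_derive x (1 : R) (fun h => tspline c (g h)) (\sum_l dtspline l c (g x) * w 0 l).
Proof.
move=> gm gd.
have dI (I : MI) : is_derive x (1 : R) (fun h => c I * bspline_space Xi q (fun k => I k) (g h))
   (c I * \sum_l (derive1 (tb l (I l)) (g x 0 l) * w 0 l) * \prod_(k | k != l) tb k (I k) (g x 0 k)).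
  have df k : is_derive x (1 : R) (fun h => tb k (I k) (g h 0 k)) (derive1 (tb k (I k)) (g x 0 k) * w 0 k).
    apply: (@is_derive1_comp _ (tb k (I k)) (fun h => g h 0 k)) => //.
    by apply: (pw_poly_is_derive (br2 k) (@tb_pw_poly k (I k))); exact: gm.
  have := prod_is_derive (index_enum_uniq _) df.
  by move/(is_deriveZ (c I)); rewrite /GRing.scale /=.
have := sum_is_derive (index_enum _) dI; rewrite -/(tspline _ _).
move/is_derive_eq; apply; rewrite /dtspline.
under [RHS]eq_bigr do rewrite mulr_suml.
rewrite exchange_big /=; apply: eq_bigr => I _.
by rewrite mulr_sumr; apply: eq_bigr => l _; ring.
Qed.

Let tb_lip k i : exists2 C : R, 0 <= C & (forall z, closed_cube d z -> `|tb k i (z 0 k)| <= C) /\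
  forall z z' (r : R), closed_cube d z -> closed_cube d z' -> 0 <= r ->
    (forall k, `|z 0 k - z' 0 k| <= r) -> `|tb k i (z 0 k) - tb k i (z' 0 k)| <= C * r.
Proof.
have [L L0] := pw_poly_lipschitz (br2 k) (@tb_pw_poly k i).
rewrite lo0 hi1 => HL.
exists (L + `|tb k i 0|); first by rewrite addr_ge0.
split=> [z zc|z z' r zc zc' r0 zr].
  have z1 := zc k; have h := HL (z 0 k) 0 z1; rewrite lexx ler01 subr0 in h.
  have -> : tb k i (z 0 k) = (tb k i (z 0 k) - tb k i 0) + tb k i 0 by ring.
  apply: le_trans (ler_normD _ _) _; rewrite lerD2r; apply: le_trans (h isT) _.
  by case/andP: z1 => z1 z2; rewrite ger0_norm // ler_piMr.
apply: le_trans (HL _ _ (zc k) (zc' k)) _.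
by rewrite ler_pM ?addr_ge0 // lerDl.
Qed.

Lemma tspline_lipschitz c : exists2 L : R, 0 <= L &
  row_lipschitz (@closed_cube R d) L (tspline c) /\
  forall z, closed_cube d z -> `|tspline c z| <= L.
Proof.
have HI (I : MI) := prod_lipschitz (index_enum 'I_d) (fun k => tb_lip k (I k)).
have HL (I : MI) := cid2 (HI I).
pose K I := s2val (HL I).
have K0 I : 0 <= K I := s2valP (HL I).
exists (\sum_I `|c I| * K I); first by apply: sumr_ge0 => I _; rewrite mulr_ge0.
have [Kb Kl] : (forall I z, closed_cube d z -> `|bspline_space Xi q (fun k => (I : MI) k) z| <= K I) /\
  forall (I : MI) z z' (r : R), closed_cube d z -> closed_cube d z' -> 0 <= r ->
   (forall k, `|z 0 k - z' 0 k| <= r) ->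
   `|bspline_space Xi q (fun k => I k) z - bspline_space Xi q (fun k => I k) z'| <= K I * r.
  by split=> I; have [] := s2valP' (HL I).
split=> [z z' r zc zc' r0 zr|z zc].
  rewrite /tspline -sumrB; apply: le_trans (ler_norm_sum _ _ _) _.
  rewrite mulr_suml; apply: ler_sum => I _.
  by rewrite -mulrBr normrM -mulrA ler_wpM2l // Kl.
apply: le_trans (ler_norm_sum _ _ _) _; apply: ler_sum => I _.
by rewrite normrM ler_wpM2l // Kb.
Qed.

Lemma dtspline_bounded l c : exists C : R, forall z, mesh_pts z -> `|dtspline l c z| <= C.
Proof.
have HI (I : MI) := prod_lipschitz (index_enum 'I_d) (fun k => tb_lip k (I k)).
have H1 k i := cid2 (tb_lip k i).
have H2 i := cid (pw_poly_derive1_bounded (br2 l) (@tb_pw_poly l i)).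
exists (\sum_I `|c I| * (`|projT1 (H2 (I l))| * \prod_(k | k != l) s2val (H1 k (I k)))) => z zm.
apply: le_trans (ler_norm_sum _ _ _) _; apply: ler_sum => I _.
rewrite !normrM ler_wpM2l // ler_pM //.
  by apply: le_trans (ler_norm _); apply: (projT2 (H2 (I l))); exact: zm.
rewrite normr_prod; apply: ler_prod => k _; rewrite normr_ge0 /=.
by have [h _] := s2valP' (H1 k (I k)); apply/h/open_closed_cube/mesh_open_cube.
Qed.

Lemma dtspline_continuous l c z : mesh_pts z -> {for z, continuous (dtspline l c)}.
Proof.
move=> zm; apply: continuous_sum_at => I.
apply: continuousM; first exact: cst_continuous.
have cc k : {for z, continuous (fun y : 'rV[R]_d => y 0 k)} by exact: coord_continuous.
apply: continuousM.
  apply: (@continuous_comp _ _ _ (fun y : 'rV[R]_d => y 0 l) (derive1 (tb l (I l)))) => //.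
  by apply: (pw_poly_derive1_continuous (br2 l) (@tb_pw_poly l (I l))); exact: zm.
apply: continuous_prod_at => k.
apply: (@continuous_comp _ _ _ (fun y : 'rV[R]_d => y 0 k) (tb k (I k))) => //.
apply: differentiable_continuous; apply/derivable1_diffP.
have := pw_poly_is_derive (br2 k) (@tb_pw_poly k (I k)) (zm k).
by move=> h; apply: ex_derive.
Qed.

(** B-splines may jump at 0 and 1. Composing with this projection yields functions that are
    continuous everywhere and unchanged on the closed cube. *)
Definition clamp01 (x : R) : R := Num.min (Num.max x 0) 1.

Lemma clamp01_in x : 0 <= clamp01 x <= 1.
Proof. by rewrite /clamp01 le_min le_max lexx orbT ler01 ge_min lexx orbT. Qed.

Lemma clamp01_id x : 0 <= x <= 1 -> clamp01 x = x.
Proof. by move=> /andP[x0 x1]; rewrite /clamp01 max_l // min_l. Qed.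

Lemma clamp01_lip x y : `|clamp01 x - clamp01 y| <= `|x - y|.
Proof.
have cE u : clamp01 u = if u < 0 then 0 else if 1 < u then 1 else u.
  rewrite /clamp01; case: (ltP u 0) => u0; first by rewrite min_l.
  by case: (ltP 1 u).
have h1 := ler_norm (x - y); have h2 := ler_norm (y - x); rewrite [`|y - x|]distrC in h2.
rewrite !cE; case: (ltP x 0) => ?; case: (ltP y 0) => ?; case: (ltP 1 x) => ?; case: (ltP 1 y) => ?;
  rewrite ler_norml; apply/andP; split; lra.
Qed.

Definition clamp_row z : 'rV[R]_d := \row_k clamp01 (z 0 k).

Lemma clamp_row_cube z : closed_cube d (clamp_row z).
Proof. by move=> k; rewrite mxE clamp01_in. Qed.

Lemma clamp_row_id z : closed_cube d z -> clamp_row z = z.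
Proof. by move=> zc; apply/rowP => k; rewrite mxE clamp01_id. Qed.

Lemma tspline_clamp_continuous c : continuous (fun z => tspline c (clamp_row z)).
Proof.
have [L L0 [HL _]] := tspline_lipschitz c.
apply: (row_lipschitz_continuous L0) => z z' r _ _ r0 zr.
apply: HL => //; [exact: clamp_row_cube|exact: clamp_row_cube|] => i.
by rewrite !mxE; apply: le_trans (clamp01_lip _ _) (zr i).
Qed.

End TensorSplines.

Section Boxes.
Context (R : realType) (n : nat).

Lemma closed_box_compact (a b : 'I_n -> R) : compact [set z : 'rV[R]_n | forall k, a k <= z 0 k <= b k].
Proof.
have := @rV_compact R n (fun k => `[a k, b k]%classic) (fun k => @segment_compact R (a k) (b k)).
suff -> : [set v : 'rV[R]_n | forall i, `[a i, b i]%classic (v ord0 i)] = [set z : 'rV[R]_n | forall k, a k <= z 0 k <= b k] by [].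
by apply/seteqP; split=> z zc k; have := zc k; rewrite /= in_itv.
Qed.

Lemma coord_le_norm (x : 'rV[R]_n) k : `|x 0 k| <= `|x|.
Proof.
rewrite [`|x|]mx_normrE.
exact: (le_bigmax (0 : R) (fun i : 'I_1 * 'I_n => `|x i.1 i.2|) (0, k)).
Qed.

Definition pospart2 (x : R) : R := x + `|x|.

Lemma pospart2_ge0 x : 0 <= pospart2 x.
Proof. by rewrite /pospart2 -lerBlDl sub0r -normrN ler_norm. Qed.

Lemma pospart2_gt0 x : (0 < pospart2 x) = (0 < x).
Proof.
rewrite /pospart2; have [x0|x0] := ltP 0 x; first by rewrite addr_gt0 // normr_gt0 gt_eqF.
by rewrite ler0_norm // subrr ltxx.
Qed.

Lemma pospart2_continuous : continuous pospart2.
Proof. by move=> x; apply: continuousD => //; exact: norm_continuous. Qed.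

(** A continuous function that is positive exactly on the open cube: it writes open sets as
    superlevel sets, which compact sets exhaust. *)
Definition cube_bump (z : 'rV[R]_n) : R := \prod_k pospart2 (z 0 k * (1 - z 0 k)).

Lemma cube_bumpP z : 0 < cube_bump z <-> open_cube n z.
Proof.
have unitE (x : R) : 0 < x * (1 - x) <-> 0 < x < 1.
  split=> [h|/andP[h1 h2]]; last by rewrite mulr_gt0 // subr_gt0.
  have [x0|x0] := ltP 0 x; first by rewrite (pmulr_rgt0 _ x0) subr_gt0 in h.
  by move: h; rewrite ltNge mulr_le0_ge0 // subr_ge0 (le_trans x0).
split=> [h k|zc].
  apply/unitE; rewrite -pospart2_gt0 lt_neqAle pospart2_ge0 andbT eq_sym.
  by move/lt0r_neq0: h => /prodf_neq0; apply.
by apply: prodr_gt0 => k _; rewrite pospart2_gt0; apply/unitE.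
Qed.

Lemma cube_bump_ge0 z : 0 <= cube_bump z.
Proof. by apply: prodr_ge0 => k _; exact: pospart2_ge0. Qed.

Lemma cube_bump_continuous : continuous cube_bump.
Proof.
move=> z; apply: continuous_prod_at => k.
have cc : {for z, continuous (fun y : 'rV[R]_n => y 0 k)} by exact: coord_continuous.
apply: (@continuous_comp _ _ _ (fun y : 'rV[R]_n => y 0 k) (fun x => pospart2 (x * (1 - x)))) => //.
apply: (@continuous_comp _ _ _ (fun x : R => x * (1 - x)) pospart2); last exact: pospart2_continuous.
by apply: continuousM => //; apply: continuousB => //; exact: cst_continuous.
Qed.

End Boxes.

(** * The geometry map: measurable images and null sets *)

Section Geometry.
Context (R : realType) (d m q : nat) (Xi br : 'I_d -> seq R).
Hypotheses (br2 : forall k, (2 <= size (br k))%N)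
  (br_lt : forall k, sorted (fun a b : R => a < b) (br k))
  (br0 : forall k, head 0 (br k) = 0) (br1 : forall k, last 0 (br k) = 1)
  (XiE : forall k, Xi k = nseq q 0 ++ br k ++ nseq q 1) (q0 : (0 < q)%N)
  (Xi_m : forall k, (size (Xi k) <= m)%N).
Context (F Finv : 'rV[R]_d -> 'rV[R]_d) (Om : set 'rV[R]_d).
Hypotheses (FS : forall k, spline_space Xi q (fun z => F z 0 k))
  (FOm : F @` open_cube d = Om) (FinvK : forall z, open_cube d z -> Finv (F z) = z)
  (Finv_bd : forall J, bounded_derivatives_on Finv (F @` mesh_elem Xi J)) (Om_open : open Om).
Notation rvec n := (g_sigma_algebraType (@open 'rV[R]_n)).
Notation mu := (row_measure R d).
Notation MI := {ffun 'I_d -> 'I_m}.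
Notation mesh := (mesh_pts br).
Notation ts := (tspline q Xi).
Implicit Types (c : MI -> R) (z : 'rV[R]_d).

Let meshc z : mesh z -> open_cube d z. Proof. exact: mesh_open_cube. Qed.

Definition Fcoef (k : 'I_d) : MI -> R := projT1 (cid (spline_space_coef q0 Xi_m (FS k))).

Lemma FcoefE k z : F z 0 k = ts (Fcoef k) z.
Proof. exact: (projT2 (cid (spline_space_coef q0 Xi_m (FS k)))). Qed.

Lemma F_lipschitz : exists2 L : R, 0 < L &
  forall z z' (r : R), closed_cube d z -> closed_cube d z' -> 0 <= r ->
   (forall i, `|z 0 i - z' 0 i| <= r) -> forall i, `|F z 0 i - F z' 0 i| <= L * r.
Proof.
have H k := cid2 (tspline_lipschitz br2 br_lt br0 br1 XiE q0 (Fcoef k)).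
exists (1 + \sum_k s2val (H k)).
  by rewrite ltr_pwDl // sumr_ge0 // => k _; exact: (s2valP (H k)).
move=> z z' r zc zc' r0 zr i; rewrite !FcoefE.
have [h _] := s2valP' (H i).
apply: le_trans (h _ _ _ zc zc' r0 zr) _; rewrite ler_wpM2r //.
rewrite (bigD1 i) //= addrCA lerDl addr_ge0 // sumr_ge0 // => k _; exact: (s2valP (H k)).
Qed.

Lemma F_clamp_continuous : continuous (fun z => F (clamp_row z)).
Proof.
apply: rowv_continuous => i.
rewrite (_ : (fun x => _) = fun z => ts (Fcoef i) (clamp_row z)).
  exact: (tspline_clamp_continuous br2 br_lt br0 br1 XiE q0).
by apply/funext => z; exact: FcoefE.
Qed.

(** The set is the union of the compact sets where [g >= 1/(n+1)] in the closed cube; their images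
    under a continuous map are compact, hence closed. *)
Lemma image_superlevel_measurable (g : 'rV[R]_d -> R) : continuous g ->
  (forall z, 0 < g z -> closed_cube d z) ->
  measurable (F @` [set z | 0 < g z] : set (rvec d)).
Proof.
move=> gc gcube.
pose K n : set 'rV[R]_d := [set z : 'rV[R]_d | forall k, 0 <= z 0 k <= 1] `&` g @^-1` [set y | n.+1%:R^-1 <= y].
have -> : F @` [set z | 0 < g z] = \bigcup_n ((fun z => F (clamp_row z)) @` K n).
  apply/seteqP; split=> [_ [z gz <-]|x [n _ [z [zc gz] <-]]].
    have [n] := ltr_add_invr gz; rewrite add0r => ng; exists n => //.
    exists z; last by rewrite clamp_row_id //; exact: gcube.
    by split; [exact: gcube | exact: ltW].
  exists z; last by rewrite clamp_row_id.
  by apply: lt_le_trans gz; rewrite invr_gt0 ltr0n.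
apply: bigcup_measurable => n _.
have Kc : compact (K n).
  apply: compact_closedI; first exact: (@closed_box_compact R d (fun=> 0) (fun=> 1)).
  by apply: preimage_closed; [move=> z _; exact: gc | exact: closed_ge].
have /compact_closed cK : compact ((fun z => F (clamp_row z)) @` K n).
  by apply: continuous_compact => //; apply: continuous_subspaceT; exact: F_clamp_continuous.
rewrite -[X in measurable X]setCK; apply: measurableC; apply: rvec_open; apply: closed_openC.
by apply: cK; exact: norm_hausdorff.
Qed.

Definition mesh_bump z : R := cube_bump z * \prod_k \prod_(xi <- br k) `|z 0 k - xi|.

Lemma mesh_bumpP z : 0 < mesh_bump z <-> mesh z.
Proof.
have lo0 k : (br k)`_0 = 0 by rewrite nth0.
have hi1 k : (br k)`_(size (br k)).-1 = 1 by rewrite nth_last.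
have p0 : 0 <= \prod_k \prod_(xi <- br k) `|z 0 k - xi|.
  by apply: prodr_ge0 => k _; apply: prodr_ge0.
split=> [h|zm].
  have c0 : 0 < cube_bump z.
    rewrite lt_neqAle cube_bump_ge0 andbT; apply: contraTneq h => cz.
    by rewrite /mesh_bump -cz mul0r ltxx.
  have zc := (cube_bumpP z).1 c0.
  have P0 : \prod_k \prod_(xi <- br k) `|z 0 k - xi| != 0.
    by apply: contraTneq h => cz; rewrite /mesh_bump cz mulr0 ltxx.
  move=> k; split; first by rewrite lo0 hi1; exact: zc.
  apply/negP => zb; have /prodf_neq0 /(_ k isT) := P0.
  by rewrite (big_rem _ zb) /= subrr normr0 mul0r eqxx.
rewrite /mesh_bump mulr_gt0 //; first by apply/cube_bumpP/meshc.
apply: prodr_gt0 => k _; rewrite big_seq; apply: prodr_gt0 => xi xib.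
rewrite normr_gt0 subr_eq0; have [_] := zm k.
by apply: contraNneq => ->.
Qed.

Lemma mesh_bump_continuous : continuous mesh_bump.
Proof.
move=> z; apply: continuousM; first exact: cube_bump_continuous.
apply: continuous_prod_at => k; apply: continuous_prod_at => xi.
have cc : {for z, continuous (fun y : 'rV[R]_d => y 0 k)} by exact: coord_continuous.
apply: (@continuous_comp _ _ _ (fun y : 'rV[R]_d => y 0 k - xi) Num.norm); last exact: norm_continuous.
by apply: continuousB => //; exact: cst_continuous.
Qed.

Notation Fmesh := (F @` mesh).

Lemma measurable_Fmesh : measurable (Fmesh : set (rvec d)).
Proof.
have -> : mesh = [set z | 0 < mesh_bump z].
  by apply/seteqP; split=> z /= /mesh_bumpP.
apply: image_superlevel_measurable; first exact: mesh_bump_continuous.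
by move=> z /mesh_bumpP /meshc zc; exact: open_closed_cube.
Qed.

Lemma Fmesh_Om : Fmesh `<=` Om.
Proof. by move=> _ [z zm <-]; rewrite -FOm; exists z => //; exact: meshc. Qed.

(** What is left out lies in the Lipschitz image of finitely many slabs, one for each direction and
    breakpoint. *)
Lemma skeleton_negligible : mu.-negligible (Om `\` Fmesh : set (rvec d)).
Proof.
have [L L0 FL] := F_lipschitz.
have N k xi := lipschitz_slab_negligible k xi L0 FL.
have sub : (Om `\` Fmesh : set (rvec d)) `<=` \bigcup_(k in setT)
    \bigcup_(xi in [set` br k]) (F @` [set z | closed_cube d z /\ z 0 k = xi] : set (rvec d)).
  move=> x [xO xm]; move: xO; rewrite -FOm => -[z zc zx].
  have [k /negP] : exists k, ~ (z 0 k \notin br k).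
    apply: contrapT => /forallNP H; apply: xm; exists z => // k; split; last exact: (contrapT (H k)).
    have := zc k; by rewrite nth0 br0 nth_last br1.
  rewrite negbK => zk; exists k => //; exists (z 0 k) => //.
  by exists z => //; split => //; exact: open_closed_cube.
have fin (I : finType) (A : I -> set (rvec d)) : (forall i, mu.-negligible (A i)) -> mu.-negligible (\bigcup_i A i).
  move=> HA; have -> : \bigcup_i A i = \bigcup_(i in [set` enum I]) A i.
    by apply/seteqP; split=> x [i _ Ax]; exists i => //=; rewrite mem_enum.
  rewrite bigcup_seq; elim/big_ind : _ => //; [exact: negligible_set0 | exact: negligibleU].
apply: (negligibleS sub); apply: fin => k.
rewrite bigcup_seq; elim/big_ind : _ => //; [exact: negligible_set0 | exact: negligibleU].
Qed.

Definition pullback (g : 'rV[R]_d -> R) : rvec d -> R :=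
  fun x => \1_Om (x : 'rV[R]_d) * g (Finv x).

(** Continuity of [Finv] on all of [Om] is not at hand; instead, the points of [Om] where
    [g (Finv x)] exceeds [c] form the image under [F] of a superlevel set. *)
Lemma measurable_pullback g : continuous g -> measurable_fun setT (pullback g).
Proof.
move=> gc; have mOm : measurable (Om : set (rvec d)) by exact: rvec_open.
have -> : pullback g = (fun x : rvec d => g (Finv x)) \_ (Om : set (rvec d)).
  by apply/funext => x; rewrite /pullback patchE indicE; case: ifP; rewrite ?mul1r ?mul0r.
apply: (measurable_restrictT _ mOm).1.
apply: (measurability _ (RGenOInfty.measurableE R)).
move=> _ [_ [c ->] <-].
have := @image_superlevel_measurable (fun z => cube_bump z * pospart2 (g z - c)).
suff -> : F @` [set z | 0 < cube_bump z * pospart2 (g z - c)] = Om `&` (fun x => g (Finv x)) @^-1` `]c, +oo[.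
  apply.
    move=> z; apply: continuousM; first exact: cube_bump_continuous.
    apply: (@continuous_comp _ _ _ (fun y : 'rV[R]_d => g y - c) (@pospart2 R)); last exact: pospart2_continuous.
    by apply: continuousB; [exact: gc | exact: cst_continuous].
  move=> z; have := cube_bump_ge0 z; rewrite le_eqVlt => /orP[/eqP <-|]; first by rewrite mul0r ltxx.
  by move=> /cube_bumpP zc _; exact: open_closed_cube.
apply/seteqP; split=> [_ [z /= zg <-]|x []].
  have : 0 < cube_bump z.
    by rewrite lt_neqAle cube_bump_ge0 andbT; apply: contraTneq zg => <-; rewrite mul0r ltxx.
  move=> cz; have zc := (cube_bumpP z).1 cz; split; first by rewrite -FOm; exists z.
  by move: zg; rewrite /= (pmulr_rgt0 _ cz) pospart2_gt0 subr_gt0 in_itv /= andbT FinvK.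
rewrite -{1}FOm => -[z zc <-]; rewrite /= in_itv /= andbT FinvK // => cg.
exists z => //=; rewrite mulr_gt0 ?pospart2_gt0 ?subr_gt0 //; exact/cube_bumpP.
Qed.

End Geometry.

(** * Derivatives in the physical domain *)

Section GeometryDerivatives.
Context (R : realType) (d m q : nat) (Xi br : 'I_d -> seq R).
Hypotheses (br2 : forall k, (2 <= size (br k))%N)
  (br_lt : forall k, sorted (fun a b : R => a < b) (br k))
  (br0 : forall k, head 0 (br k) = 0) (br1 : forall k, last 0 (br k) = 1)
  (XiE : forall k, Xi k = nseq q 0 ++ br k ++ nseq q 1) (q0 : (0 < q)%N)
  (Xi_m : forall k, (size (Xi k) <= m)%N).
Context (F Finv : 'rV[R]_d -> 'rV[R]_d) (Om : set 'rV[R]_d).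
Hypotheses (FS : forall k, spline_space Xi q (fun z => F z 0 k))
  (FOm : F @` open_cube d = Om) (FinvK : forall z, open_cube d z -> Finv (F z) = z)
  (Finv_bd : forall J, bounded_derivatives_on Finv (F @` mesh_elem Xi J)) (Om_open : open Om).
Notation rvec n := (g_sigma_algebraType (@open 'rV[R]_n)).
Notation mu := (row_measure R d).
Notation MI := {ffun 'I_d -> 'I_m}.
Notation mesh := (mesh_pts br).
Notation ts := (tspline q Xi).
Notation dts := (dtspline q Xi).
Notation Fmesh := (F @` mesh).
Implicit Types (c : MI -> R) (z : 'rV[R]_d).

Let meshc z : mesh z -> open_cube d z. Proof. exact: mesh_open_cube. Qed.
Let mFmesh : measurable (Fmesh : set (rvec d)).
Proof. exact: (measurable_Fmesh br2 br_lt br0 br1 XiE q0 Xi_m). Qed.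
Let FmeshOm : Fmesh `<=` Om. Proof. exact: (Fmesh_Om br0 br1). Qed.

Lemma mesh_elem_exists z : mesh z -> exists J : MI, mesh_elem Xi (fun k => J k) z.
Proof.
move=> zm; have H k := cid (find_open_elem (br2 k) (zm k)).
have lt k : (q + sval (H k) < m)%N.
  have [h _] := svalP (H k); apply: leq_trans (Xi_m k).
  by rewrite (size_knots (XiE k)); lia.
exists [ffun k => Ordinal (lt k)] => k; rewrite ffunE /=.
have [h1 h2] := svalP (H k).
by rewrite -addnS !(nth_knots (XiE k)) // (ltn_trans _ h1).
Qed.

Definition Jinv (k l : 'I_d) (x : 'rV[R]_d) : R := ('D_(evec R k) Finv x) 0 l.

Lemma Jinv_bounded : exists C, forall k l z, mesh z -> `|Jinv k l (F z)| <= C.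
Proof.
have H (J : MI) k : {C | forall x, (F @` mesh_elem Xi (fun k => J k)) x -> `|'D_(evec R k) Finv x| <= C}.
  by apply: cid; have [_ [C HC]] := Finv_bd (fun k => J k) [:: k]; exists C.
exists (\sum_J \sum_k `|sval (H J k)|) => k l z zm.
have [J zJ] := mesh_elem_exists zm.
apply: le_trans (coord_le_norm _ _) _.
have h : `|'D_(evec R k) Finv (F z)| <= sval (H J k) by apply: (svalP (H J k)); exists z.
apply: le_trans h (le_trans (ler_norm _) _).
rewrite (bigD1 J) //= (bigD1 k) //= -addrA lerDl addr_ge0 // sumr_ge0 // => j _.
by rewrite sumr_ge0.
Qed.

Lemma Finv_derivable k z : mesh z -> derivable Finv (F z) (evec R k).
Proof.
move=> zm; have [J zJ] := mesh_elem_exists zm.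
have [H _] := Finv_bd (fun k => J k) [::].
by apply: H; exists z.
Qed.

(** As [Om] is open, [u] coincides near [F z] with the spline composed with [Finv]; the chain rule
    along the line in direction [k] applies. *)
Lemma pull_is_derive c (u : 'rV[R]_d -> R) k z :
  (forall z, open_cube d z -> u (F z) = ts c z) -> mesh z ->
  is_derive (F z) (evec R k) u (\sum_l dts l c z * Jinv k l (F z)).
Proof.
move=> uE zm; have OF : Om (F z) by apply: FmeshOm; exists z.
apply: (@near_eq_is_derive _ _ _ (fun x => ts c (Finv x))).
  have : nbhs (F z) Om by apply: open_nbhs_nbhs.
  apply: filterS => x; rewrite -FOm => -[y yc <-].
  by rewrite FinvK // uE.
have dF : derivable Finv (F z) (evec R k) by exact: Finv_derivable.
have dg := (derivable_curve Finv (F z) (evec R k)).1 dF.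
have g0 : Finv (F z + (0 : R) *: evec R k) = z by rewrite scale0r addr0 FinvK //; exact: meshc.
have gd l : is_derive (0 : R) (1 : R) (fun h => Finv (F z + h *: evec R k) 0 l) (('D_(evec R k) Finv (F z)) 0 l).
  by rewrite derive_curve; exact: is_derive_row_coord.
have := @tspline_curve _ _ m _ _ _ br2 br_lt br0 br1 XiE q0 c (fun h => Finv (F z + h *: evec R k)) _ 0.
move/(_ _ _ gd); rewrite g0 => /(_ zm) [D1 D2].
apply: DeriveDef; first exact/derivable_curve.
by rewrite derive_curve D2.
Qed.

(** The spline transported to [Om] and extended by 0; the clamp changes nothing on [Om] and makes
    [measurable_pullback] applicable. *)
Definition wfun c : rvec d -> R := pullback Finv Om (fun z => ts c (clamp_row z)).

Lemma wfunE c z : open_cube d z -> wfun c (F z) = ts c z.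
Proof.
move=> zc; rewrite /wfun /pullback indicE mem_set ?mul1r; last by rewrite -FOm; exists z.
by rewrite FinvK // clamp_row_id //; exact: open_closed_cube.
Qed.

Lemma wfun_off c x : ~ Om x -> wfun c x = 0.
Proof. by move=> xO; rewrite /wfun /pullback indicE memNset ?mul0r. Qed.

Lemma measurable_wfun c : measurable_fun setT (wfun c).
Proof.
apply: (measurable_pullback br2 br_lt br0 br1 XiE q0 Xi_m FS FOm FinvK Om_open).
exact: (tspline_clamp_continuous br2 br_lt br0 br1 XiE q0).
Qed.

Lemma wfun_bounded c : exists C, forall x, `|wfun c x| <= C.
Proof.
have [L L0 [_ H]] := tspline_lipschitz br2 br_lt br0 br1 XiE q0 c.
exists L => x; have [|xO] := pselect (Om x); last by rewrite wfun_off // normr0.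
by rewrite -FOm => -[z zc <-]; rewrite wfunE //; apply/H/open_closed_cube.
Qed.

Lemma wfun_sum c x : wfun c x = \sum_I c I * wfun (fun J => (J == I)%:R) x.
Proof.
rewrite /wfun /pullback /tspline mulr_sumr; apply: eq_bigr => I _.
rewrite mulrCA; congr (_ * (_ * _)); rewrite (bigD1 I) //= eqxx mul1r big1 ?addr0 // => J /negbTE ->; exact: mul0r.
Qed.

(** The cut-off removes the points where the derivative may be a default value. *)
Definition pgrad c k : rvec d -> R := fun x => \1_Fmesh (x : 'rV[R]_d) * 'D_(evec R k) (wfun c) x.

Lemma pgradE c k z : mesh z -> pgrad c k (F z) = \sum_l dts l c z * Jinv k l (F z).
Proof.
move=> zm; rewrite /pgrad indicE mem_set ?mul1r; last by exists z.
by have [_ ->] := pull_is_derive k (wfunE c) zm.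
Qed.

Lemma pgrad_off c k x : ~ Fmesh x -> pgrad c k x = 0.
Proof. by move=> xO; rewrite /pgrad indicE memNset ?mul0r. Qed.

(** On the image of the mesh points it is the limit of difference quotients with step [1/(n+1)],
    each of them measurable. *)
Lemma measurable_pgrad c k : measurable_fun setT (pgrad c k).
Proof.
have -> : pgrad c k = (fun x : rvec d => 'D_(evec R k) (wfun c) x) \_ (Fmesh : set (rvec d)).
  by apply/funext => x; rewrite /pgrad patchE indicE; case: ifP; rewrite ?mul1r ?mul0r.
apply: (measurable_restrictT _ mFmesh).1.
pose h (n : nat) (x : rvec d) : R := n.+1%:R * (wfun c ((x : 'rV[R]_d) + n.+1%:R^-1 *: evec R k) - wfun c x).
apply: (@measurable_fun_cvg _ _ _ _ h).
  move=> n; apply: measurable_funTS; apply: measurable_funM; first exact: measurable_cst.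
  apply: measurable_funB; last exact: measurable_wfun.
  apply: (measurableT_comp (measurable_wfun c)).
  apply: rvec_continuous_measurable_rvec => x.
  by apply: (@continuousD _ _ _ (fun x : 'rV[R]_d => x) (fun=> n.+1%:R^-1 *: evec R k)); [exact: cvg_id | exact: cst_continuous].
move=> _ [z zm <-].
have [D1 _] := pull_is_derive k (wfunE c) zm.
have : (fun t : R => t^-1 * (wfun c (F z + t *: evec R k) - wfun c (F z))) x @[x --> 0^'] --> 'D_(evec R k) (wfun c) (F z).
  have : derivable (wfun c : 'rV[R]_d -> R) (F z) (evec R k) by [].
  rewrite /derivable /derive.
  set f1 := (fun h0 : R => _ *: _); set f2 := (fun t : R => _ * _).
  have -> : f1 = f2 by apply/funext => t; rewrite /f1 /f2 /= [F z + _]addrC.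
  by [].
move/cvgr_dnbhsP => /(_ (fun n => n.+1%:R^-1)) H.
have := H (conj (fun n => lt0r_neq0 _) _).
move=> /(_ _) H2.
have : (fun n : nat => n.+1%:R^-1) n @[n --> \oo] --> (0 : R) by exact: cvg_harmonic.
have pos (n : nat) : n.+1%:R^-1 != 0 :> R by rewrite invr_eq0 pnatr_eq0.
move=> cv; have := H (conj pos cv).
by under eq_fun do rewrite invrK.
Qed.

Lemma pgrad_bounded c k : exists C, forall x, `|pgrad c k x| <= C.
Proof.
have [C HC] := Jinv_bounded.
have HD l := cid (dtspline_bounded br2 br_lt br0 br1 XiE q0 l c).
exists (\sum_l `|sval (HD l)| * `|C|) => x.
have [[z zm <-]|xm] := pselect (Fmesh x); last first.
  by rewrite pgrad_off // normr0 sumr_ge0 // => l _; rewrite mulr_ge0.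
rewrite pgradE //; apply: le_trans (ler_norm_sum _ _ _) _; apply: ler_sum => l _.
rewrite normrM ler_pM //; last by apply: le_trans (ler_norm _); exact: HC.
by apply: le_trans (ler_norm _); apply: (svalP (HD l)).
Qed.

Lemma dtspline_sum c l z : dts l c z = \sum_I c I * dts l (fun J => (J == I)%:R) z.
Proof.
rewrite /dtspline; apply: eq_bigr => I _; congr (_ * _).
rewrite (bigD1 I) //= eqxx mul1r [X in _ = _ + X]big1 ?addr0 // => J /negbTE ->; exact: mul0r.
Qed.

Lemma pgrad_sum c k x : pgrad c k x = \sum_I c I * pgrad (fun J => (J == I)%:R) k x.
Proof.
have [[z zm <-]|xm] := pselect (Fmesh x); last first.
  by rewrite pgrad_off // big1 // => I _; rewrite pgrad_off ?mulr0.
rewrite pgradE //; under [RHS]eq_bigr do rewrite pgradE // mulr_sumr.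
rewrite exchange_big /=; apply: eq_bigr => l _; rewrite dtspline_sum mulr_suml.
by apply: eq_bigr => I _; rewrite mulrA.
Qed.

(** The coordinate functions pull back to the components of [F], so [pull_is_derive] says that the
    Jacobians of [Finv] and [F] multiply to the identity; for square matrices the product in the
    other order follows. *)
Lemma jacobian_mulV z l l' : mesh z -> \sum_k dts l' (Fcoef q0 Xi_m FS k) z * Jinv k l (F z) = (l == l')%:R.
Proof.
move=> zm; pose A : 'M[R]_d := \matrix_(k, l) Jinv k l (F z).
pose B : 'M[R]_d := \matrix_(l, i) dts l (Fcoef q0 Xi_m FS i) z.
have AB : A *m B = 1%:M.
  apply/matrixP => k i; rewrite !mxE.
  have [_ D] := pull_is_derive (u := fun x : 'rV[R]_d => x 0 i) k (fun z _ => FcoefE q0 Xi_m FS i z) zm.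
  have cd : 'D_(evec R k) (fun x : 'rV[R]_d => x 0 i) (F z) = (k == i)%:R.
    have -> : (k == i)%:R = (evec R k) 0 i :> R by rewrite mxE eqxx eq_sym.
    rewrite derive_curve; apply: derive_val.
    have -> : (fun h : R => (F z + h *: evec R k) 0 i) = (fun h : R => F z 0 i + h * evec R k 0 i).
      by apply/funext => h; rewrite !mxE.
    have := is_deriveD (is_derive_cst (F z 0 i) (0 : R) (1 : R)) (is_deriveZ (evec R k 0 i) (is_derive_id (0 : R) (1 : R))).
    move/is_derive_eq => H; set b := evec R k 0 i in H *.
    rewrite (_ : (fun h : R => _) = cst (F z 0 i) + b \*: id); last first.
      by apply/funext => h; rewrite /= mulrC.
    by apply: H; rewrite add0r; exact: mulr1.
  rewrite -cd D; apply: eq_bigr => l0 _; by rewrite !mxE mulrC.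
have /matrixP /(_ l' l) := mulmx1C AB; rewrite !mxE eq_sym => <-.
by apply: eq_bigr => k _; rewrite !mxE.
Qed.

Lemma jacobian_inj z (v : 'I_d -> R) : mesh z ->
  (forall k, \sum_l v l * Jinv k l (F z) = 0) -> forall l, v l = 0.
Proof.
move=> zm H l'.
have : \sum_k dts l' (Fcoef q0 Xi_m FS k) z * (\sum_l v l * Jinv k l (F z)) = 0.
  by rewrite big1 // => k _; rewrite H mulr0.
under eq_bigr do rewrite mulr_sumr.
rewrite exchange_big /= => <-.
under [RHS]eq_bigr => l _ do (under eq_bigr do rewrite mulrCA; rewrite -mulr_sumr jacobian_mulV //).
by rewrite (bigD1 l') //= eqxx mulr1 big1 ?addr0 // => j /negbTE ->; rewrite mulr0.
Qed.

Lemma jacobian_inj' z (v : 'I_d -> R) : mesh z ->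
  (forall l, \sum_k v k * dts l (Fcoef q0 Xi_m FS k) z = 0) -> forall k, v k = 0.
Proof.
move=> zm H k'.
pose A : 'M[R]_d := \matrix_(k, l) Jinv k l (F z).
pose B : 'M[R]_d := \matrix_(l, i) dts l (Fcoef q0 Xi_m FS i) z.
have BA : B *m A = 1%:M.
  apply/matrixP => l' l; rewrite !mxE eq_sym -(jacobian_mulV l l' zm).
  by apply: eq_bigr => k _; rewrite !mxE.
pose V : 'cV[R]_d := \col_k v k.
have BV : B *m V = 0.
  apply/matrixP => l j; rewrite !mxE -[RHS](H l); apply: eq_bigr => k _.
  by rewrite !mxE mulrC.
have : V = 0 by rewrite -(mul1mx V) -(mulmx1C BA) -mulmxA BV mulmx0.
by move/matrixP => /(_ k' 0); rewrite !mxE.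
Qed.

End GeometryDerivatives.

Lemma pw_poly_const (R : realType) (br : seq R) (b : R -> R) : (2 <= size br)%N ->
  (forall i j, (i < j)%N -> (j < size br)%N -> br`_i < br`_j) -> pw_poly br b ->
  (forall x, open_elems br x -> derive1 b x = 0) ->
  forall x, br`_0 <= x <= br`_(size br).-1 -> b x = b br`_0.
Proof.
move=> br2 brlt pb db.
have step j x : (j.+1 < size br)%N -> br`_j <= x <= br`_j.+1 -> b x = b br`_j.
  move=> js /andP[jx xj]; have [p bp] := pb j js.
  rewrite !bp ?lexx ?jx ?xj //; last by rewrite (le_trans jx).
  apply/eqP; rewrite -subr_eq0 -(Rintegral_poly_deriv p jx).2; apply/eqP.
  rewrite (_ : (fun y : measurableTypeR R => _) = cst 0); first by rewrite Rintegral_cst ?mul0r.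
  apply/funext => y; rewrite indicE; case: (boolP (y \in _)) => [|_]; last by rewrite mul0r.
  rewrite inE /= in_itv /= => /andP[y1 y2]; have yj : br`_j < y < br`_j.+1 by rewrite y1 (lt_le_trans y2).
  have [_ <-] := pw_poly_derive1 js bp yj.
  by rewrite db ?mulr0 //; exact: open_elemsP yj.
have H j : (j < size br)%N -> b br`_j = b br`_0.
  elim: j => // j IH js; rewrite (step j) //; first by apply: IH; exact: ltn_trans js.
  by rewrite lexx andbT; apply/ltW/brlt.
move=> x xr; have [j [js xj]] := find_elem br2 xr.
by rewrite (step j) // H // (ltn_trans _ js).
Qed.

Lemma sqr_is_derive (R : realType) (u : R -> R) (x y du : R) : is_derive x (1 : R) u du ->
  is_derive x (1 : R) (fun h => (u h - y) ^+ 2) (2 * ((u x - y) * du)).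
Proof.
move=> ud; have := is_deriveX 2 (is_deriveB ud (is_derive_cst y x (1 : R))).
move/is_derive_eq => H; apply: H; rewrite subr0 /GRing.scale /= expr1.
by rewrite mulrA.
Qed.

(** * Definiteness of the gradient *)

Section GeometryPositivity.
Context (R : realType) (d m q : nat) (Xi br : 'I_d -> seq R).
Hypotheses (br2 : forall k, (2 <= size (br k))%N)
  (br_lt : forall k, sorted (fun a b : R => a < b) (br k))
  (br0 : forall k, head 0 (br k) = 0) (br1 : forall k, last 0 (br k) = 1)
  (XiE : forall k, Xi k = nseq q 0 ++ br k ++ nseq q 1) (q0 : (0 < q)%N)
  (Xi_m : forall k, (size (Xi k) <= m)%N).
Context (F Finv : 'rV[R]_d -> 'rV[R]_d) (Om : set 'rV[R]_d).
Hypotheses (FS : forall k, spline_space Xi q (fun z => F z 0 k))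
  (FOm : F @` open_cube d = Om) (FinvK : forall z, open_cube d z -> Finv (F z) = z)
  (Finv_bd : forall J, bounded_derivatives_on Finv (F @` mesh_elem Xi J)) (Om_open : open Om).
Notation rvec n := (g_sigma_algebraType (@open 'rV[R]_n)).
Notation mu := (row_measure R d).
Notation MI := {ffun 'I_d -> 'I_m}.
Notation mesh := (mesh_pts br).
Notation ts := (tspline q Xi).
Notation dts := (dtspline q Xi).
Implicit Types (c : MI -> R) (z : 'rV[R]_d).

Let meshc z : mesh z -> open_cube d z. Proof. exact: mesh_open_cube. Qed.
Notation Fc := (Fcoef q0 Xi_m FS).

Let ts_line c z l (h : R) : mesh (z + h *: evec R l) ->
  is_derive h (1 : R) (fun h => ts c (z + h *: evec R l)) (dts l c (z + h *: evec R l)).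
Proof.
move=> zm.
have gd k : is_derive h (1 : R) (fun h : R => (z + h *: evec R l) 0 k) (evec R l 0 k).
  have := is_deriveD (is_derive_cst (z 0 k) h (1 : R)) (is_deriveZ (evec R l 0 k) (is_derive_id h (1 : R))).
  move/is_derive_eq => H; set b := evec R l 0 k in H *.
  rewrite (_ : (fun h : R => _) = cst (z 0 k) + b \*: id); last first.
    by apply/funext => t; rewrite !mxE /= /b mxE mulrC.
  by apply: H; rewrite add0r; exact: mulr1.
have := @tspline_curve _ _ m _ _ _ br2 br_lt br0 br1 XiE q0 c (fun h => z + h *: evec R l) _ h zm gd.
move/is_derive_eq; apply; rewrite (bigD1 l) //= mxE !eqxx mulr1 big1 ?addr0 // => k kl.
by rewrite mxE (negbTE kl) andbF mulr0.
Qed.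

(** A local inverse by least squares: the squared distance of [F z] to [y] attains its minimum over
    the box; injectivity of [F] keeps the minimiser away from the rim, so it is critical, and the
    invertible Jacobian makes the residual vanish. The index [k0] supplies a point of the rim. *)
Lemma F_open_at (k0 : 'I_d) z0 (r : R) : 0 < r ->
  (forall z, (forall k, `|z0 0 k - z 0 k| <= r) -> mesh z) ->
  exists2 e : R, 0 < e & forall y : 'rV[R]_d, (forall k, `|F z0 0 k - y 0 k| < e) ->
    exists2 z : 'rV[R]_d, (forall k, `|z0 0 k - z 0 k| <= r) & F z = y.
Proof.
move=> r0 rm; pose B := [set z : 'rV[R]_d | forall k, z0 0 k - r <= z 0 k <= z0 0 k + r].
have BE z : B z <-> forall k, `|z0 0 k - z 0 k| <= r.
  by split=> h k; have := h k; rewrite ler_norml => /andP[h1 h2]; apply/andP; split; lra.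
have Bc : compact B by apply: (@closed_box_compact R d (fun k => z0 0 k - r) (fun k => z0 0 k + r)).
have Bm z : B z -> mesh z by move=> /BE; exact: rm.
pose Phi (y z : 'rV[R]_d) : R := \sum_k (ts (Fc k) (clamp_row z) - y 0 k) ^+ 2.
have Phic y : continuous (Phi y).
  move=> z; apply: continuous_sum_at => k.
  apply: (@continuous_comp _ _ _ (fun z : 'rV[R]_d => ts (Fc k) (clamp_row z) - y 0 k) (fun x : R => x ^+ 2)).
    by apply: continuousB; [exact: (tspline_clamp_continuous br2 br_lt br0 br1 XiE q0) | exact: cst_continuous].
  exact: exprn_continuous.
have PhiE y z : B z -> Phi y z = \sum_k (F z 0 k - y 0 k) ^+ 2.
  move=> Bz; apply: eq_bigr => k _; rewrite (FcoefE q0 Xi_m FS) clamp_row_id //.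
  by apply/open_closed_cube/meshc/Bm.
have Bz0 : B z0 by apply/BE => k; rewrite subrr normr0 ltW.
pose dist z : R := \sum_k `|z0 0 k - z 0 k|.
have distc : continuous dist.
  move=> z; apply: continuous_sum_at => k.
  apply: (@continuous_comp _ _ _ (fun y : 'rV[R]_d => z0 0 k - y 0 k) Num.norm); last exact: norm_continuous.
  by apply: continuousB; [exact: cst_continuous | exact: coord_continuous].
pose S := B `&` dist @^-1` [set t | r / 2 <= t].
have Sc : compact S.
  by apply: compact_closedI => //; apply: preimage_closed; [move=> z _; exact: distc | exact: closed_ge].
have S0 : S !=set0.
  exists (z0 + r *: evec R k0); split.
    apply/BE => k; rewrite !mxE eqxx /= opprD addNKr normrN normrM gtr0_norm //.
    by apply: ler_piMr; [exact: ltW | case: eqP => _; rewrite ?normr1 ?normr0].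
  rewrite /= /dist (bigD1 k0) //= !mxE !eqxx mulr1 opprD addNKr normrN gtr0_norm //.
  have : 0 <= \sum_(i < d | i != k0) `|z0 0 i - (z0 + r *: evec R k0) 0 i| by apply: sumr_ge0.
  lra.
have [zs zsS zsmin] := EVT_min_rV S0 Sc (continuous_subspaceT (Phic (F z0))).
rewrite inE in zsS; have [zsB zsd] := zsS.
pose del := Phi (F z0) zs.
have sq_ge0 (a b : 'I_d -> R) : 0 <= \sum_k (a k - b k) ^+ 2 by apply: sumr_ge0 => k _; exact: sqr_ge0.
have del0 : 0 < del.
  rewrite lt_neqAle /del PhiE // sq_ge0 andbT eq_sym; apply/negP => /eqP h.
  have Fe : F zs = F z0.
    apply/rowP => k; apply/eqP; rewrite -subr_eq0 -sqrf_eq0.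
    by have /(_ k isT) -> := psumr_eq0P (fun i _ => sqr_ge0 _) h.
  move: zsd; rewrite /= /dist.
  have -> : zs = z0 by rewrite -(FinvK (meshc (Bm _ zsB))) Fe FinvK //; apply/meshc/Bm.
  by rewrite big1 => [|k _]; [lra | rewrite subrr normr0].
pose D : R := d%:R + 1.
have D0 : 0 < D by rewrite ltr_wpDl.
(* This makes the squared distance of [y] and [F z0] less than [del / 4]. The minimum over the box
   is then below [del / 4] too, and a minimiser in [S] would give
   [del < 2 * (del / 4) + 2 * (del / 4)]. *)
pose e := Num.min 1 (del / (8 * D)).
have e0 : 0 < e by rewrite /e lt_min ltr01 divr_gt0 // mulr_gt0.
have e1 : e <= 1 by rewrite /e ge_min lexx.
have eD : e * D <= del / 8.
  have : e <= del / (8 * D) by rewrite /e ge_min lexx orbT.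
  by rewrite -(ler_pM2r D0) => /le_trans; apply; rewrite invfM mulrA mulfVK // gt_eqF.
exists e => // y Fy.
have y4 : \sum_k (F z0 0 k - y 0 k) ^+ 2 < del / 4.
  apply: (@le_lt_trans _ _ (\sum_(k < d) e)).
    apply: ler_sum => k _; rewrite -real_normK ?num_real // expr2.
    have := Fy k; have := normr_ge0 (F z0 0 k - y 0 k); set t := `|_| => t0 te.
    by apply: (@le_trans _ _ (1 * t)); [rewrite ler_wpM2r // (le_trans (ltW te)) | rewrite mul1r ltW].
  rewrite sumr_const card_ord -[X in X < _]mulr_natr; apply: le_lt_trans (_ : e * D < _).
    by rewrite ler_wpM2l ?ltW // /D ltrDl.
  lra.
have [z1 z1B z1min] := EVT_min_rV (ex_intro _ z0 Bz0) Bc (continuous_subspaceT (Phic y)).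
rewrite inE in z1B.
have z1y : Phi y z1 < del / 4.
  by apply: le_lt_trans (z1min z0 _) _; [rewrite inE | rewrite PhiE].
have z1d : dist z1 < r / 2.
  rewrite ltNge; apply/negP => h; have := zsmin z1; rewrite inE => /(_ (conj z1B h)).
  apply/negP; rewrite -ltNge -/del.
  apply: (@le_lt_trans _ _ (2 * Phi y z1 + 2 * \sum_k (F z0 0 k - y 0 k) ^+ 2)); last by lra.
  rewrite !PhiE // !mulr_sumr -big_split /=; apply: ler_sum => k _.
  by have := sqr_ge0 (F z1 0 k - 2 * y 0 k + F z0 0 k); nra.
have z1k k : `|z0 0 k - z1 0 k| < r / 2.
  apply: le_lt_trans z1d; rewrite /dist (bigD1 k) //= lerDl; exact: sumr_ge0.
have lineB l (h : R) : h \in `]- (r / 2), r / 2[ -> B (z1 + h *: evec R l).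
  rewrite in_itv /= => hr; apply/BE => k; rewrite !mxE opprD addrA.
  apply: le_trans (ler_normB _ _) _.
  have : `|h * (true && (k == l))%:R| <= r / 2.
    rewrite normrM; apply: (@le_trans _ _ (`|h| * 1)).
      by rewrite ler_wpM2l //; case: (k == l); rewrite ?normr1 ?normr0.
    by rewrite mulr1 ltW // ltr_norml.
  by have := z1k k; rewrite eqxx /=; lra.
have Fz1 : forall k, F z1 0 k - y 0 k = 0.
  apply: (jacobian_inj' br2 br_lt br0 br1 XiE (q0 := q0) (Xi_m := Xi_m) (FS := FS) FOm FinvK Finv_bd Om_open (Bm _ z1B) (v := fun k => F z1 0 k - y 0 k)) => l.
  pose phi (h : R) := \sum_k (ts (Fc k) (z1 + h *: evec R l) - y 0 k) ^+ 2.
  have phid (h : R) : h \in `]- (r / 2), r / 2[ -> is_derive h (1 : R) phi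
     (\sum_k 2 * ((ts (Fc k) (z1 + h *: evec R l) - y 0 k) * dts l (Fc k) (z1 + h *: evec R l))).
    move=> hr; apply: sum_is_derive => k.
    by apply: sqr_is_derive; apply: ts_line; apply/Bm/lineB.
  have z00 : (0 : R) \in `]- (r / 2), r / 2[ by rewrite in_itv /=; apply/andP; split; lra.
  have phi_min : is_derive (0 : R) (1 : R) phi 0.
    apply: (@derive1_at_min R phi (- (r / 2)) (r / 2)) => //; first by lra.
      by move=> t /phid [].
    have phiE (t : R) : t \in `]- (r / 2), r / 2[ -> phi t = Phi y (z1 + t *: evec R l).
      by move=> tr; rewrite PhiE; [apply: eq_bigr => k _; rewrite (FcoefE q0 Xi_m FS) | exact: lineB].
    move=> t tr; rewrite !phiE // scale0r addr0; apply: z1min; rewrite inE; exact: lineB.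
  have [_ d1] := phid 0 z00; have [_ d2] := phi_min.
  move: d1; rewrite d2 scale0r addr0 -mulr_sumr => /esym /eqP.
  rewrite mulf_eq0 pnatr_eq0 /= => /eqP h; rewrite -[RHS]h.
  by apply: eq_bigr => k _; rewrite (FcoefE q0 Xi_m FS).
exists z1; first exact/BE.
by apply/rowP => k; apply/eqP; rewrite -subr_eq0 Fz1.
Qed.

Notation pg := (pgrad q Xi br F Finv Om).

(** A nonzero derivative persists on a box around [z0]. By [F_open_at] the image of that box
    contains a box of positive measure, and by injectivity of the Jacobian some component of the
    gradient is nonzero at each of its points. *)
Lemma dtspline_zero c z0 : (forall k, mu.-negligible [set x | pg c k x <> 0]) ->
  mesh z0 -> forall l, dts l c z0 = 0.
Proof.
move=> H z0m l; apply/eqP/negP => /negP dn0.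
have : nbhs z0 (mesh `&` [set z | dts l c z != 0]).
  apply: filterI; first by apply: open_nbhs_nbhs; split => //; exact: mesh_pts_open.
  have dc := dtspline_continuous br2 br_lt br0 br1 XiE q0 (l := l) (c := c) z0m.
  have : nbhs (dts l c z0) [set t : R | t != 0].
    by apply: open_nbhs_nbhs; split => //; exact: open_neq.
  exact: dc.
move=> /nbhs_ballP[r /= r0 rm].
have r20 : 0 < r / 2 by rewrite divr_gt0.
have rm2 z : (forall k, `|z0 0 k - z 0 k| <= r / 2) -> mesh z /\ dts l c z != 0.
  move=> zr; apply: rm; apply: (rowv_ball _ _ _ _ _ r0) => k.
  by have := zr k; lra.
have [e e0 He] := F_open_at l r20 (fun z h => (rm2 z h).1).
pose a : 'rV[R]_d := \row_k (F z0 0 k - e); pose b : 'rV[R]_d := \row_k (F z0 0 k + e).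
have boxN : mu.-negligible (row_box a b).
  have sub : row_box a b `<=` \bigcup_(k in [set` enum 'I_d]) ([set x | pg c k x <> 0] : set (rvec d)).
    move=> y yb; have [] := He y.
      by move=> k; have := yb k; rewrite !mxE ltr_distl => /andP[h1 h2]; apply/andP; split; lra.
    move=> z /rm2 [zm zd] yE; apply: contrapT => hn.
    have /eqP : dts l c z = 0.
      apply: (jacobian_inj br2 br_lt br0 br1 XiE q0 Xi_m FS FOm FinvK Finv_bd Om_open zm (v := fun l => dts l c z)) => k.
      rewrite -(pgradE br2 br_lt br0 br1 XiE q0 Xi_m FOm FinvK Finv_bd Om_open c k zm) yE.
      by apply: contrapT => h; apply: hn; exists k => //=; rewrite mem_enum.
    by apply/negP.
  apply: (negligibleS sub); rewrite bigcup_seq.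
  elim/big_ind : _ => //; [exact: negligible_set0 | exact: negligibleU].
have mu0 := (negligibleP _ (measurable_row_box a b)).1 boxN.
have muE : mu (row_box a b) = (\prod_i (b 0 i - a 0 i))%:E.
  by apply: row_measure_box => k; rewrite !mxE; lra.
have := etrans (esym muE) mu0.
move/eqP; rewrite eqe; apply/negP; rewrite gt_eqF //; apply: prodr_gt0 => k _.
by rewrite !mxE; lra.
Qed.

(** On the line through [z] in direction [l] the spline is piecewise polynomial with zero
    derivative, hence equal to its value on the face where coordinate [l] is 0. *)
Lemma tspline_zero c (l : 'I_d) : (forall z, cube_boundary d z -> ts c z = 0) ->
  (forall z, mesh z -> dts l c z = 0) -> forall z, mesh z -> ts c z = 0.
Proof.
move=> bd0 d0 z zm.
pose g (h : R) : 'rV[R]_d := z + (h - z 0 l) *: evec R l.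
have gl (h : R) : g h 0 l = h by rewrite !mxE !eqxx mulr1 addrC subrK.
have gk (h : R) k : k != l -> g h 0 k = z 0 k by move=> kl; rewrite !mxE (negbTE kl) andbF mulr0 addr0.
have pphi : pw_poly (br l) (fun h => ts c (g h)).
  have -> : (fun h => ts c (g h)) = fun h => \sum_I ((c I * \prod_(k | k != l) tb q Xi k (I k) (z 0 k))%:P).[h] * tb q Xi l (I l) h.
    apply/funext => h; apply: eq_bigr => I _; rewrite hornerC -mulrA; congr (_ * _).
    rewrite /bspline_space (bigD1 l) //= gl mulrC; congr (_ * _).
    by apply: eq_bigr => k kl; rewrite gk.
  apply: pw_poly_sum => I; apply: pw_polyM; first exact: pw_poly_horner.
  exact: (tb_pw_poly br2 br_lt br0 br1 XiE q0).
have cst := pw_poly_const (br2 l) (@breaks_lt _ _ (br_lt l)) pphi.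
have lo0 : (br l)`_0 = 0 by rewrite nth0.
have hi1 : (br l)`_(size (br l)).-1 = 1 by rewrite nth_last.
rewrite lo0 hi1 in cst.
have zl : z = g (z 0 l) by rewrite /g subrr scale0r addr0.
rewrite {1}zl cst; last by have := open_closed_cube (meshc zm); apply.
  apply: bd0; split=> [k|/(_ l)]; last by rewrite gl ltxx.
  have [->|kl] := eqVneq k l; first by rewrite gl lexx ler01.
  by rewrite gk //; apply: open_closed_cube; exact: meshc.
move=> x xo; have gm : mesh (z + (x - z 0 l) *: evec R l).
  move=> k; have [->|kl] := eqVneq k l; first by rewrite -/(g x) gl.
  by rewrite -/(g x) gk //; exact: zm.
have D := @ts_line c (z - z 0 l *: evec R l) l x.
have gE (h : R) : z - z 0 l *: evec R l + h *: evec R l = g h.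
  by rewrite /g scalerBl -addrA [- _ + _]addrC.
rewrite gE in D; have [_ D2] := D gm.
rewrite derive1E -(d0 _ gm) -/(g x) -D2; congr ('D_1 _ x).
by apply/funext => h; rewrite gE.
Qed.

End GeometryPositivity.

(** * The purely temporal problem: truncated powers and zero counting *)

Lemma mul_pos_trans (R : realDomainType) (a b c : R) : 0 < a * b -> 0 < b * c -> 0 < a * c.
Proof.
move=> ab bc; have b0 : b != 0 by apply: contraTneq ab => ->; rewrite mulr0 ltxx.
have b2 : 0 < b ^+ 2 by rewrite exprn_even_gt0.
have : 0 < b ^+ 2 * (a * c).
  by rewrite (_ : b ^+ 2 * (a * c) = (a * b) * (b * c)); [exact: mulr_gt0 | ring].
by rewrite (pmulr_rgt0 _ b2).
Qed.

Lemma mul_neg_trans (R : realDomainType) (a b c : R) : 0 < a * b -> b * c < 0 -> a * c < 0.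
Proof. by rewrite -(oppr_gt0 (b * c)) -(oppr_gt0 (a * c)) -!mulrN; exact: mul_pos_trans. Qed.

Section PiecewiseDerivative.
Context (R : realType) (br : seq R).
Hypotheses (br2 : (2 <= size br)%N)
  (brlt : forall i j, (i < j)%N -> (j < size br)%N -> br`_i < br`_j).
Notation leb := (@lebesgue_measure R).
Let lo := br`_0.
Let hi := br`_(size br).-1.
Implicit Types g f : R -> R.

Let brle i j : (i <= j)%N -> (j < size br)%N -> br`_i <= br`_j.
Proof. by rewrite leq_eqVlt => /orP[/eqP -> //|ij js]; exact/ltW/brlt. Qed.

Lemma poly_zero_on_itv (p : {poly R}) (a b : R) : a < b ->
  (forall x, a < x < b -> p.[x] = 0) -> p = 0.
Proof.
move=> ab H; pose rs := [seq a + (b - a) / i.+2%:R | i <- iota 0 (size p)].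
have ba : 0 < b - a by rewrite subr_gt0.
apply: (@roots_geq_poly_eq0 _ p rs); last by rewrite size_map size_iota.
- apply/allP => _ /mapP[i _ ->]; apply/rootP; apply: H; apply/andP; split.
    by rewrite ltrDl divr_gt0 // ltr0n.
  rewrite -ltrBrDl ltr_pdivrMr ?ltr0n // ltr_pMr // ltr1n //.
- rewrite map_inj_uniq ?iota_uniq // => i j /addrI /(mulfI (lt0r_neq0 ba)) /invr_inj /eqP.
  by rewrite eqr_nat => /eqP [].
Qed.

(** The values of [f] at breakpoints are free: [g] stays continuous while [f] may jump, as the top
    derivative of a spline does. *)
Definition pw_deriv_pair g f := forall j, (j.+1 < size br)%N -> exists p : {poly R},
  (forall x, br`_j <= x <= br`_j.+1 -> g x = p.[x]) /\
  (forall x, br`_j < x < br`_j.+1 -> f x = (deriv p).[x]).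

Lemma pw_deriv_pairD g f g' f' : pw_deriv_pair g f -> pw_deriv_pair g' f' ->
  pw_deriv_pair (fun x => g x + g' x) (fun x => f x + f' x).
Proof.
move=> H H' j js; have [p [gp fp]] := H j js; have [p' [gp' fp']] := H' j js.
by exists (p + p'); split=> x xj; rewrite ?derivD hornerD ?gp ?gp' ?fp ?fp'.
Qed.

Lemma pw_deriv_pairM g f g' f' : pw_deriv_pair g f -> pw_deriv_pair g' f' ->
  pw_deriv_pair (fun x => g x * g' x) (fun x => f x * g' x + g x * f' x).
Proof.
move=> H H' j js; have [p [gp fp]] := H j js; have [p' [gp' fp']] := H' j js.
exists (p * p'); split=> x xj; first by rewrite hornerM gp ?gp'.
have xj' : br`_j <= x <= br`_j.+1 by case/andP: xj => h1 h2; rewrite !ltW.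
by rewrite derivM hornerD !hornerM fp ?fp' ?gp ?gp'.
Qed.

Lemma pw_deriv_pairZ a g f : pw_deriv_pair g f -> pw_deriv_pair (fun x => a * g x) (fun x => a * f x).
Proof.
move=> H j js; have [p [gp fp]] := H j js.
by exists (a *: p); split=> x xj; rewrite ?derivZ hornerZ ?gp ?fp.
Qed.

Lemma pw_deriv_pair_sum (I : Type) (s : seq I) (g f : I -> R -> R) :
  (forall i, pw_deriv_pair (g i) (f i)) ->
  pw_deriv_pair (fun x => \sum_(i <- s) g i x) (fun x => \sum_(i <- s) f i x).
Proof.
move=> H; elim: s => [|i s IH].
  by move=> j _; exists 0; split=> x _; rewrite big_nil ?deriv0 horner0.
have E (h : I -> R -> R) : (fun x => \sum_(j <- i :: s) h j x) = fun x => h i x + \sum_(j <- s) h j x.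
  by apply/funext => x; rewrite big_cons.
by rewrite !E; exact: pw_deriv_pairD.
Qed.

Lemma pw_deriv_pair_pw_poly g f : pw_deriv_pair g f -> pw_poly br g.
Proof. by move=> H j js; have [p [gp _]] := H j js; exists p. Qed.

Lemma pw_deriv_pair_derive1 g f x : pw_deriv_pair g f -> open_elems br x -> derive1 g x = f x.
Proof.
move=> H xo; have [j [js xj]] := find_open_elem br2 xo; have [p [gp fp]] := H j js.
by have [_ ->] := pw_poly_derive1 js gp xj; rewrite fp.
Qed.

Lemma pw_deriv_pair_FTC g f : pw_deriv_pair g f ->
  \int[leb]_x (\1_(open_elems br) x * f x) = g hi - g lo.
Proof.
move=> H; rewrite -(pw_deriv_FTC br2 brlt (pw_deriv_pair_pw_poly H)).2.
apply: eq_Rintegral => x _; rewrite /pw_deriv indicE.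
case: (boolP (x \in _)) => [|_]; last by rewrite !mul0r.
by rewrite inE => xo; rewrite (pw_deriv_pair_derive1 H).
Qed.

Lemma pw_poly_eq g g' : pw_poly br g -> pw_poly br g' ->
  (forall x, open_elems br x -> g x = g' x) -> forall x, lo <= x <= hi -> g x = g' x.
Proof.
move=> H H' gg x xr; have [j [js xj]] := find_elem br2 xr.
have [p gp] := H j js; have [p' gp'] := H' j js.
rewrite gp // gp' //; congr (_.[x]); apply/eqP; rewrite -subr_eq0; apply/eqP.
apply: (poly_zero_on_itv (brlt (ltnSn j) js)) => y yj.
have yj' : br`_j <= y <= br`_j.+1 by case/andP: yj => h1 h2; rewrite !ltW.
by rewrite hornerD hornerN -gp // -gp' // gg ?subrr //; exact: open_elemsP yj.
Qed.

Lemma pw_deriv_pair_zero g f j : pw_deriv_pair g f -> (j.+1 < size br)%N ->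
  (forall x, br`_j < x < br`_j.+1 -> g x = 0) ->
  (forall x, br`_j <= x <= br`_j.+1 -> g x = 0) /\ (forall x, br`_j < x < br`_j.+1 -> f x = 0).
Proof.
move=> H js g0; have [p [gp fp]] := H j js.
have p0 : p = 0.
  apply: (poly_zero_on_itv (brlt (ltnSn j) js)) => y yj.
  by rewrite -gp ?g0 //; case/andP: yj => h1 h2; rewrite !ltW.
by split=> x xj; rewrite ?gp ?fp // p0 ?deriv0 horner0.
Qed.

(** A mean value theorem for signs: with kinks the mean slope itself may be attained nowhere, but on
    some element in between [g] moves in the direction of the total change. *)
Lemma pw_mean_value g f x y : pw_deriv_pair g f -> lo <= x -> x < y -> y <= hi -> g x != g y ->
  exists2 t, x < t < y & 0 < f t * (g y - g x).
Proof.
move=> H lx xy yh gxy.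
have step j u w : (j.+1 < size br)%N -> br`_j <= u -> u < w -> w <= br`_j.+1 -> g u != g w ->
    exists2 t, u < t < w & 0 < f t * (g w - g u).
  move=> js ju uw wj guw; have [p [gp fp]] := H j js.
  have dp t : is_derive t (1 : R) (fun x : R => p.[x]) (deriv p).[t] by exact: is_derive_poly.
  have cp : {within `[u, w], continuous (fun x : R => p.[x])}.
    by apply: continuous_subspaceT => t; apply: differentiable_continuous; apply/derivable1_diffP; have [] := dp t.
  have [t] := MVT uw (fun t _ => dp t) cp; rewrite in_itv /= => tuw E.
  have E2 : g w - g u = (deriv p).[t] * (w - u).
    by rewrite -E !gp // ?ju ?wj ?(ltW (le_lt_trans ju uw)) ?(ltW (lt_le_trans uw wj)).
  exists t => //; case/andP: tuw => ut tw.
  rewrite fp; last by rewrite (le_lt_trans ju ut) (lt_le_trans tw wj).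
  rewrite E2 mulrA -expr2 mulr_gt0 ?subr_gt0 // exprn_even_gt0 //=.
  by apply: contraNneq guw => d0; rewrite -subr_eq0 -oppr_eq0 opprB E2 d0 mul0r.
have main j : forall x y, (j.+1 < size br)%N -> lo <= x -> x < y -> y <= br`_j.+1 -> g x != g y ->
    exists2 t, x < t < y & 0 < f t * (g y - g x).
  elim: j => [|j IH] u w js lu uw wj guw; first exact: (step 0).
  have [ju|uj] := leP br`_j.+1 u; first exact: (step j.+1).
  have [wj'|jw] := leP w br`_j.+1; first by apply: IH => //; exact: ltnW.
  have [e|ne] := eqVneq (g u) (g br`_j.+1).
    have [|t /andP[t1 t2] tp] := step j.+1 br`_j.+1 w js (lexx _) jw wj; first by rewrite -e.
    by exists t; [rewrite (lt_trans uj) | rewrite e].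
  have [t /andP[t1 t2] tp] := IH u br`_j.+1 (ltnW js) lu uj (lexx _) ne.
  (* If the part up to the breakpoint does not move in the direction of the total change, the part
     after it must. *)
  have [h|h] := ltP 0 ((g br`_j.+1 - g u) * (g w - g u)).
    exists t; first by rewrite t1 (lt_trans t2).
    exact: mul_pos_trans tp h.
  have ne2 : g br`_j.+1 != g w.
    by apply: contraTneq h => ->; rewrite -ltNge -expr2 exprn_even_gt0 //= subr_eq0 eq_sym.
  have [t' /andP[t1' t2'] tp'] := step j.+1 br`_j.+1 w js (lexx _) jw wj ne2.
  exists t'; first by rewrite (lt_trans uj).
  have hh : 0 < (g w - g u) * (g w - g br`_j.+1).
    have : 0 < (g w - g u) ^+ 2 by rewrite exprn_even_gt0 //= subr_eq0 eq_sym.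
    have -> : (g w - g u) * (g w - g br`_j.+1) = (g w - g u) ^+ 2 - (g br`_j.+1 - g u) * (g w - g u) by ring.
    by move=> h2; rewrite subr_gt0 (le_lt_trans h).
  by apply: mul_pos_trans tp' _; rewrite mulrC.
apply: (main (size br).-2 x y) => //; first by lia.
by rewrite (_ : (size br).-2.+1 = (size br).-1) //; lia.
Qed.

End PiecewiseDerivative.

(** * Rolle's theorem for sign alternations *)

Section SignAlternation.
Context (R : realDomainType).
Implicit Types (g f : R -> R) (s : seq R).

Definition alternates g : rel R := fun x y => (x < y) && (g x * g y < 0).

Definition alternating_in g (A B : R) s := sorted (alternates g) s /\
  forall x, x \in s -> A < x < B /\ g x != 0.

Definition mean_value g f (A B : R) := forall x y, A <= x -> x < y -> y <= B -> g x != g y ->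
  exists2 t, x < t < y & 0 < f t * (g y - g x).

Context (g f : R -> R) (A B : R) (mv : mean_value g f A B).

(** The induction carries a point [y] from which [g] moves towards the sign of [g x]; the point of
    [f] found between them has that sign. The last point found precedes the last given one and
    shares its sign, which leaves room for one more at a zero on the right. *)
Let rolle_path s : forall y x, A <= y -> y < x -> 0 < (g x - g y) * g x ->
  path (alternates g) x s -> (forall t, t \in x :: s -> A < t < B /\ g t != 0) ->
  exists u r, [/\ y < u < x, 0 < f u * g x, size r = size s & path (alternates f) u r] /\
    [/\ last u r < last x s, 0 < f (last u r) * g (last x s) &
      forall t, t \in u :: r -> A < t < B /\ f t != 0].
Proof.
elim: s => [|x1 s IH] y x Ay yx gyx.
  move=> _ xP; have [/andP[Ax xB] gx0] := xP x (mem_head _ _).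
  have [|u /andP[yu ux] fu] := mv Ay yx (ltW xB).
    by apply: contraTneq gyx => ->; rewrite subrr mul0r ltxx.
  have fux : 0 < f u * g x.
    exact: mul_pos_trans fu gyx.
  exists u, [::]; split; split => //=; rewrite ?yu //.
  move=> t; rewrite inE => /eqP ->; rewrite (le_lt_trans Ay yu) (lt_trans ux xB); split => //.
  by apply: contraTneq fux => ->; rewrite mul0r ltxx.
move=> /= /andP[/andP[xx1 gxx1] ps] xP.
have [/andP[Ax xB] gx0] := xP x (mem_head _ _).
have g1 : 0 < (g x1 - g x) * g x1.
  have [_ g10] : A < x1 < B /\ g x1 != 0 by apply: xP; rewrite !inE eqxx orbT.
  by rewrite mulrBl subr_gt0 (lt_trans gxx1) // -expr2 exprn_even_gt0.
have [|u1 [r [[/andP[xu1 ux1] f1 sr pr] [lr fr rP]]]] := IH x x1 (ltW Ax) xx1 g1 ps.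
  by move=> t ts; apply: xP; rewrite inE ts orbT.
have [|u /andP[yu ux] fu] := mv Ay yx (ltW xB).
  by apply: contraTneq gyx => ->; rewrite subrr mul0r ltxx.
have fux : 0 < f u * g x.
  exact: mul_pos_trans fu gyx.
exists u, (u1 :: r); split; split => //=; rewrite ?yu //; first by rewrite sr.
  rewrite pr andbT /alternates (lt_trans ux xu1) /=.
  by rewrite mulrC; apply: (mul_neg_trans f1); rewrite mulrC; exact: mul_neg_trans fux gxx1.
move=> t; rewrite inE => /orP[/eqP ->|]; last exact: rP.
rewrite (le_lt_trans Ay yu) (lt_trans ux xB); split => //.
by apply: contraTneq fux => ->; rewrite mul0r ltxx.
Qed.

(** Between alternating points Rolle loses one point, and each end of the interval where [g]
    vanishes gives one back. The three variants have one, two and no such ends. *)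
Lemma rolle_left s : g A = 0 -> alternating_in g A B s ->
  exists2 r, size r = size s & alternating_in f A B r.
Proof.
move=> gA; case: s => [|x s] [ss sP]; first by exists [::].
have [/andP[Ax xB] gx] := sP x (mem_head _ _).
have [|u [r [[_ _ sr pr] [_ _ rP]]]] := rolle_path (lexx A) Ax _ ss sP.
  by rewrite gA subr0 -expr2 exprn_even_gt0.
by exists (u :: r); [rewrite /= sr | split].
Qed.

Lemma rolle_both s : (0 < size s)%N -> g A = 0 -> g B = 0 -> alternating_in g A B s ->
  exists2 r, size r = (size s).+1 & alternating_in f A B r.
Proof.
move=> s0 gA gB; case: s s0 => // x s _ [ss sP].
have [/andP[Ax xB] gx] := sP x (mem_head _ _).
have [|u [r [[_ _ sr pr] [lr fr rP]]]] := rolle_path (lexx A) Ax _ ss sP.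
  by rewrite gA subr0 -expr2 exprn_even_gt0.
have [/andP[Al lB] gl] := sP (last x s) (mem_last _ _).
have [|w /andP[lw wB] fw] := mv (ltW Al) lB (lexx B); first by rewrite gB.
have fw0 : f w * g (last x s) < 0 by move: fw; rewrite gB sub0r mulrN oppr_gt0.
exists (rcons (u :: r) w); first by rewrite size_rcons /= sr.
split.
  rewrite /= rcons_path pr /alternates (lt_trans lr lw) /=.
  by apply: (mul_neg_trans fr); rewrite mulrC.
move=> t; rewrite mem_rcons inE => /orP[/eqP ->|]; last exact: rP.
rewrite (lt_trans Al lw) wB; split => //.
by apply: contraTneq fw0 => ->; rewrite mul0r ltxx.
Qed.

Lemma rolle_inner s : alternating_in g A B s ->
  exists2 r, size r = (size s).-1 & alternating_in f A B r.
Proof.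
case: s => [|x [|x1 s]] [ss sP]; [by exists [::] | by exists [::] |].
have [/andP[Ax xB] gx] := sP x (mem_head _ _).
have [_ gx1] : A < x1 < B /\ g x1 != 0 by apply: sP; rewrite !inE eqxx orbT.
move: ss => /= /andP[/andP[xx1 gxx1] ps].
have [||u [r [[_ _ sr pr] [_ _ rP]]]] := rolle_path (ltW Ax) xx1 _ ps.
- by rewrite mulrBl subr_gt0 (lt_trans gxx1) // -expr2 exprn_even_gt0.
- by move=> t ts; apply: sP; rewrite inE ts orbT.
by exists (u :: r); [rewrite /= sr | split].
Qed.

End SignAlternation.

(** * Truncated powers and the zero count *)

Section TruncatedPowers.
Context (R : realType) (br : seq R).
Hypotheses (br2 : (2 <= size br)%N)
  (brlt : forall i j, (i < j)%N -> (j < size br)%N -> br`_i < br`_j) (lo0 : br`_0 = 0).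
Notation leb := (@lebesgue_measure R).
Notation hi := br`_(size br).-1.
Notation oe_int f := (\int[leb]_x (\1_(open_elems br) x * f x)).

Let brle i j : (i <= j)%N -> (j < size br)%N -> br`_i <= br`_j.
Proof. by rewrite leq_eqVlt => /orP[/eqP -> //|ij js]; exact/ltW/brlt. Qed.

Lemma poly_antideriv (p : {poly R}) : exists P : {poly R}, deriv P = p /\ P.[0] = 0.
Proof.
exists (\poly_(i < (size p).+1) (if i is j.+1 then p`_j / j.+1%:R else 0)); split.
  apply/polyP => i; rewrite coef_deriv coef_poly ltnS; case: ltnP => ip.
    by rewrite -[LHS]mulr_natr divfK // pnatr_eq0.
  by rewrite mul0rn nth_default.
by rewrite horner_coef0 coef_poly.
Qed.

Lemma open_poly_integrable (f : R -> R) :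
  (forall j, (j.+1 < size br)%N -> exists p : {poly R}, forall x, br`_j < x < br`_j.+1 -> f x = p.[x]) ->
  leb.-integrable setT (EFin \o (fun x => \1_(open_elems br) x * f x)).
Proof.
move=> H; have jlt (j : 'I_(size br).-1) : (j.+1 < size br)%N by have := ltn_ord j; lia.
have Hp (j : 'I_(size br).-1) : {P : {poly R} | forall x, br`_j < x < br`_j.+1 -> f x = (deriv P).[x]}.
  apply: cid; have [p fp] := H j (jlt j); have [P [PE _]] := poly_antideriv p.
  by exists P => x xj; rewrite PE fp.
have -> : (fun x => \1_(open_elems br) x * f x) =
    (fun x => \sum_(j < (size br).-1) \1_(`]br`_j, br`_j.+1[) x * (deriv (sval (Hp j))).[x]).
  apply/funext => x; rewrite (indic_open_elems br2 brlt) mulr_suml.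
  apply: eq_bigr => j _; rewrite indicE; case: (boolP (x \in _)) => [|_]; last by rewrite !mul0r.
  by rewrite inE /= in_itv /= => xj; rewrite (svalP (Hp j) x xj).
apply: integrable_sumR => j.
exact: (Rintegral_poly_deriv (sval (Hp j)) (brle (leqnSn j) (jlt j))).1.
Qed.

Definition open_poly (f : R -> R) := forall j, (j.+1 < size br)%N ->
  exists p : {poly R}, forall x, br`_j < x < br`_j.+1 -> f x = p.[x].

Lemma open_polyM f g : open_poly f -> open_poly g -> open_poly (fun x => f x * g x).
Proof.
move=> H H' j js; have [p fp] := H j js; have [p' gp] := H' j js.
by exists (p * p') => x xj; rewrite hornerM fp ?gp.
Qed.

Lemma pw_deriv_pair_open_poly g f : pw_deriv_pair br g f -> open_poly g /\ open_poly f.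
Proof.
move=> H; split=> j js; have [p [gp fp]] := H j js; last by exists (deriv p).
by exists p => x /andP[h1 h2]; rewrite gp // !ltW.
Qed.

Lemma pw_poly_open_poly g : pw_poly br g -> open_poly g.
Proof.
move=> H j js; have [p gp] := H j js.
by exists p => x /andP[h1 h2]; rewrite gp // !ltW.
Qed.

Lemma pw_poly_derive1_open_poly g : pw_poly br g -> open_poly (derive1 g).
Proof.
move=> H j js; have [p gp] := H j js; exists (deriv p) => x xj.
by have [_ ->] := pw_poly_derive1 js gp xj.
Qed.

Lemma oe_intD f g : open_poly f -> open_poly g ->
  oe_int (fun x => f x + g x) = oe_int f + oe_int g.
Proof.
move=> H H'; rewrite -RintegralD //; try exact: open_poly_integrable.
by apply: eq_Rintegral => x _; rewrite mulrDr.
Qed.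

(** The factorial makes [tpow k] the derivative of [tpow k.+1]; the strict inequality settles the
    value of the step function [tpow 0] at its knot. *)
Definition tpow (k : nat) (xi x : R) : R := if xi < x then (x - xi) ^+ k / k`!%:R else 0.

Lemma tpow_le k xi x : x <= xi -> tpow k xi x = 0.
Proof. by rewrite /tpow ltNge => ->. Qed.

Lemma tpow_poly k xi x : xi <= x -> tpow k.+1 xi x = (k.+1`!%:R^-1 *: ('X - xi%:P) ^+ k.+1).[x].
Proof.
rewrite hornerZ horner_exp hornerXsubC /tpow le_eqVlt => /orP[/eqP <-|->]; last by rewrite mulrC.
by rewrite ltxx subrr expr0n mulr0.
Qed.

Lemma tpow_pair k i : pw_deriv_pair br (tpow k.+1 br`_i) (tpow k br`_i).
Proof.
move=> j js.
have [ij|ji] : br`_i <= br`_j \/ br`_j.+1 <= br`_i.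
  have [is_|si] := ltnP i (size br); last first.
    by left; rewrite (nth_default _ si) -[X in X <= _]lo0; apply: brle => //; exact: ltnW.
  by have [ij|ji] := leqP i j; [left; apply: brle => //; exact: ltnW | right; exact: brle].
- exists (k.+1`!%:R^-1 *: ('X - (br`_i)%:P) ^+ k.+1); split=> x /andP[jx xj].
    by rewrite tpow_poly // (le_trans ij).
  rewrite derivZ deriv_exp derivXsubC mul1r hornerZ hornerMn horner_exp hornerXsubC /tpow (le_lt_trans ij jx) /=.
  rewrite factS natrM -mulr_natl; field.
  by rewrite nat1r !pnatr_eq0 -lt0n fact_gt0.
- exists 0; split=> x /andP[jx xj]; rewrite ?deriv0 horner0 tpow_le //; first exact: le_trans ji.
  by rewrite (le_trans (ltW xj)).
Qed.

Section HFun.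
Context (q : nat) (Q : {poly R}) (c : nat -> R).
Hypothesis sQ : (size Q <= (2 * q).+1)%N.

(** The [j]-th derivative of a spline of degree [2 * q] with knots at the interior breakpoints. *)
Definition hfun j x := (derivn j Q).[x] + \sum_(i <- iota 1 (size br).-2) c i * tpow (2 * q - j) br`_i x.

Lemma hfun_pair j : (j < 2 * q)%N -> pw_deriv_pair br (hfun j) (hfun j.+1).
Proof.
move=> jq; apply: pw_deriv_pairD.
  by move=> i _; exists (derivn j Q); rewrite derivnS.
apply: pw_deriv_pair_sum => i; apply: pw_deriv_pairZ.
by rewrite (_ : (2 * q - j)%N = (2 * q - j.+1).+1); [exact: tpow_pair | lia].
Qed.

Lemma hfun_last_const i x y : (i.+1 < size br)%N -> br`_i < x <= br`_i.+1 -> br`_i < y <= br`_i.+1 ->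
  hfun (2 * q) x = hfun (2 * q) y.
Proof.
move=> is_ /andP[x1 x2] /andP[y1 y2]; congr (_ + _).
  have -> : derivn (2 * q) Q = ((derivn (2 * q) Q)`_0)%:P.
    apply/polyP => k; rewrite coefC; case: k => // k /=.
    by rewrite coef_derivn nth_default ?mul0rn // (leq_trans sQ) // addnS ltnS leq_addr.
  by rewrite !hornerC.
rewrite big_seq [RHS]big_seq; apply: eq_bigr => k; rewrite mem_iota => kr.
rewrite subnn /tpow !expr0; congr (_ * _).
have ks : (k < size br)%N by lia.
have [ki|ik] := leqP k i.
  have h : br`_k <= br`_i by apply: brle => //; exact: ltnW.
  by rewrite (le_lt_trans h x1) (le_lt_trans h y1).
have h : br`_i.+1 <= br`_k by exact: brle.
by rewrite !ltNge (le_trans x2) // (le_trans y2).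
Qed.

Section Run.
Context (a b : nat).
Hypotheses (ab : (a < b)%N) (bs : (b < size br)%N) (q0 : (0 < q)%N).
Hypotheses (HA : forall j, (j <= q)%N -> hfun j br`_a = 0) (HB : forall j, (j < q)%N -> hfun j br`_b = 0)
  (HK : forall i, (a <= i <= b)%N -> hfun 0 br`_i = 0)
  (HN : forall i, (a <= i < b)%N -> exists2 x, br`_i < x < br`_i.+1 & hfun 0 x != 0).
Notation A := br`_a.
Notation B := br`_b.
Let Alo : br`_0 <= A. Proof. by apply: brle => //; exact: ltn_trans bs. Qed.

Let Bhi : B <= hi. Proof. by apply: brle; lia. Qed.

Let mv j : (j < 2 * q)%N -> mean_value (hfun j) (hfun j.+1) A B.
Proof.
move=> jq x y Ax xy yB; apply: (pw_mean_value br2 (hfun_pair jq)) => //.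
  exact: le_trans Ax.
exact: le_trans Bhi.
Qed.

(** From a zero at one end of the element through a nonzero value to a zero at the other end, the
    function moves both ways. *)
Let elem i : (a <= i < b)%N -> exists u w, [/\ br`_i < u < br`_i.+1, br`_i < w < br`_i.+1 & hfun 1 u * hfun 1 w < 0].
Proof.
move=> /andP[ai ib]; have [|x /andP[x1 x2] x0] := HN (i := i); first by rewrite ai.
have z1 : hfun 0 br`_i = 0 by apply: HK; lia.
have z2 : hfun 0 br`_i.+1 = 0 by apply: HK; lia.
have q1 : (0 < 2 * q)%N by lia.
have h1 : A <= br`_i by apply: brle => //; lia.
have h2 : br`_i.+1 <= B by apply: brle => //; lia.
have [|u /andP[u1 u2] hu] := mv q1 h1 x1 (ltW (lt_le_trans x2 h2)); first by rewrite z1 eq_sym.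
have [|w /andP[w1 w2] hw] := mv q1 (ltW (le_lt_trans h1 x1)) x2 h2; first by rewrite z2.
exists u, w; split; [by rewrite u1 (lt_trans u2) | by rewrite w2 (lt_trans x1) |].
rewrite z1 subr0 in hu; rewrite z2 sub0r in hw.
by apply: (mul_neg_trans hu); rewrite -oppr_gt0 mulrC -mulrN.
Qed.

(** Each further element offers both signs of the first derivative, so one alternation can always be
    appended: [k + 1] elements give [k + 2] points. *)
Let base k : (k.+1 <= b - a)%N -> exists y s, [/\ size s = k.+1, path (alternates (hfun 1)) y s &
  forall x, x \in y :: s -> A < x < br`_(a + k.+1) /\ hfun 1 x != 0].
Proof.
have nz u w : hfun 1 u * hfun 1 w < 0 -> hfun 1 u != 0 /\ hfun 1 w != 0.
  move=> h; split; apply: contraTneq h => ->; rewrite ?mul0r ?mulr0 ltxx //.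
elim: k => [|k IH] kb.
  have [|u [w [/andP[u1 u2] /andP[w1 w2] uw]]] := elem (i := a); first by lia.
  have [hu hw] := nz _ _ uw; rewrite addn1.
  have [lt|lt] : u < w \/ w < u.
    have [||e] := ltgtP u w; [by left | by right |].
    by move: uw; rewrite e ltNge -expr2 sqr_ge0.
  - exists u, [:: w]; split; rewrite //= ?/alternates ?lt ?uw // => x.
    by rewrite !inE => /orP[] /eqP ->; rewrite ?u1 ?w1.
  - have uw' : hfun 1 w * hfun 1 u < 0 by rewrite mulrC.
    exists w, [:: u]; split; rewrite //= ?/alternates ?lt ?uw' // => x.
    by rewrite !inE => /orP[] /eqP ->; rewrite ?u1 ?w1.
have [|y [s [ss ps sP]]] := IH; first exact: ltnW.
have [/andP[l1 l2] l0] := sP (last y s) (mem_last _ _).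
have [|u [w [/andP[u1 u2] /andP[w1 w2] uw]]] := elem (i := (a + k.+1)%N); first by lia.
have [hu hw] := nz _ _ uw.
have [t [t1 t2 t0 lt]] : exists t, [/\ br`_(a + k.+1) < t, t < br`_(a + k.+1).+1, hfun 1 t != 0 &
    hfun 1 (last y s) * hfun 1 t < 0].
  have [lu|ul] := ltP (hfun 1 (last y s) * hfun 1 u) 0; first by exists u.
  exists w; split => //; apply: mul_neg_trans uw.
  by rewrite lt_neqAle ul andbT eq_sym mulf_neq0.
exists y, (rcons s t); split; first by rewrite size_rcons ss.
  by rewrite rcons_path ps /alternates lt (lt_trans l2 t1).
move=> x; rewrite -rcons_cons mem_rcons inE addnS => /orP[/eqP ->|/sP [/andP[x1 x2] x0]].
  by rewrite t2 (lt_trans l1 (lt_trans l2 t1)).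
by rewrite x1 (lt_trans x2) // (lt_trans t1 t2).
Qed.

(** The first derivative has [b - a + 1] alternating points. Each differentiation up to order [q]
    gains one (zeros at both ends), the next keeps the number (zero at [A] only), and each of the
    remaining [q - 1] loses one. So the derivative of order [2 * q] has [b - a + 1] alternating
    points, yet it is constant on each of only [b - a] spans. *)
Lemma zero_run_contra : False.
Proof.
have B1 : exists s, size s = (b - a).+1 /\ alternating_in (hfun 1) A B s.
  have [|y [s [ss ps sP]]] := base (k := (b - a).-1); first by lia.
  exists (y :: s); split; first by rewrite /= ss; lia.
  by split=> // x /sP; rewrite (_ : (a + (b - a).-1.+1)%N = b); last by lia.
have Bj j : (j < q)%N -> exists s, size s = (b - a + j.+1)%N /\ alternating_in (hfun j.+1) A B s.
  elim: j => [_|j IH jq]; first by rewrite addn1.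
  have [|s [ss sa]] := IH; first exact: ltnW.
  have [||||r rs ra] := rolle_both (mv (j := j.+1) _) _ _ _ sa; first by lia.
  - by rewrite ss; lia.
  - by apply: HA; lia.
  - by apply: HB.
  by exists r; split=> //; rewrite rs ss; lia.
have Bq : exists s, size s = (b - a + q)%N /\ alternating_in (hfun q.+1) A B s.
  have [|s [ss sa]] := Bj q.-1; first by lia.
  rewrite prednK // in ss sa.
  have [||r rs ra] := rolle_left (mv (j := q) _) _ sa; first by lia.
    exact: HA.
  by exists r; split=> //; rewrite rs.
have Bi i : (i < q)%N -> exists s, size s = (b - a + q - i)%N /\ alternating_in (hfun (q.+1 + i)) A B s.
  elim: i => [_|i IH iq]; first by rewrite subn0 addn0.
  have [|s [ss sa]] := IH; first exact: ltnW.
  have [|r rs ra] := rolle_inner (mv (j := (q.+1 + i)%N) _) sa; first by lia.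
  by exists r; split; [rewrite rs ss; lia | rewrite addnS].
have [|s [ss [sa sP]]] := Bi q.-1; first by lia.
have E : (q.+1 + q.-1 = 2 * q)%N by lia.
rewrite E in sa sP.
(* Consecutive alternating points lie in different spans; below, [k] is the span that holds [x],
   taken as the last one starting before it. *)
have count r : forall i x, (a <= i)%N -> (i < b)%N -> br`_i < x -> path (alternates (hfun (2 * q))) x r ->
    (forall t, t \in x :: r -> t < B) -> (size r < b - i)%N.
  elim: r => [|y r IH] i x ai ib ix; first by rewrite subn_gt0.
  move=> /= /andP[/andP[xy hxy] pr] rP.
  pose P k := (a <= k < b)%N && (br`_k < x).
  have exP : exists k, P k by exists i; rewrite /P ai ib ix.
  have ubP k : P k -> (k <= b)%N by rewrite /P => /andP[/andP[_ /ltnW]].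
  case: (ex_maxnP exP ubP) => k /andP[/andP[ak kb] kx] kmax.
  have ik : (i <= k)%N by apply: kmax; rewrite /P ai ib ix.
  have xB : x < B by apply: rP; rewrite inE eqxx.
  have yB : y < B by apply: rP; rewrite !inE eqxx orbT.
  have xk : x <= br`_k.+1.
    rewrite leNgt; apply/negP => kx1.
    have [kb1|bk] := ltnP k.+1 b; first by have := kmax k.+1; rewrite /P kx1 kb1 ltnn (leq_trans ak) // => /(_ isT).
    have bE : b = k.+1 by apply/eqP; rewrite eqn_leq bk kb.
    by move: xB; rewrite bE ltNge (ltW kx1).
  have ky : br`_k.+1 < y.
    rewrite ltNge; apply/negP => yk; move: hxy.
    rewrite (hfun_last_const (i := k) (y := y)) ?kx ?xk ?yk ?(lt_trans kx) //; last exact: leq_ltn_trans bs.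
    by rewrite ltNge -expr2 sqr_ge0.
  have kb1 : (k.+1 < b)%N.
    rewrite ltnNge; apply/negP => bk.
    have bE : b = k.+1 by apply/eqP; rewrite eqn_leq bk kb.
    by move: yB; rewrite bE ltNge (ltW ky).
  have := IH k.+1 y (leq_trans ak (leqnSn k)) kb1 ky pr.
  have rP' t : t \in y :: r -> t < B by move=> ts; apply: rP; rewrite inE ts orbT.
  move/(_ rP') => H; have bki : ((b - k.+1).+1 <= b - i)%N by clear -kb1 ik; lia.
  exact: leq_trans (H : (size r).+2 <= (b - k.+1).+1)%N bki.
case: s ss sa sP => [|x r] /= ss sa sP.
  by clear -ss ab q0; exfalso; lia.
have [/andP[Ax _] _] := sP x (mem_head _ _).
have sE : size r = (b - a)%N by apply: succn_inj; apply: (etrans ss); clear -ab q0; lia.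
have := count r a x (leqnn a) ab Ax sa; rewrite sE ltnn.
by move=> H; have : false by apply: H => t /sP [/andP[]].
Qed.

End Run.
End HFun.
End TruncatedPowers.

Lemma coef_XsubC_exp (R : comNzRingType) (q i : nat) (x : R) : (i <= q)%N ->
  (('X - x%:P) ^+ q)`_(q - i) = (- x) ^+ i *+ 'C(q, i).
Proof.
move=> iq; rewrite exprDn coef_sum (bigD1 (inord i)) //= big1 => [|k ki].
  by rewrite addr0 inordK // coefMn -rmorphN -rmorphXn /= coefMC coefXn eqxx mul1r.
rewrite coefMn -rmorphN -rmorphXn /= coefMC coefXn; case: eqP => h; last by rewrite mul0r mul0rn.
case/eqP: ki; apply/val_inj; rewrite /= inordK //.
by have := ltn_ord k; lia.
Qed.

(** * Marsden's identity *)

Section Marsden.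
Context (R : realType) (q : nat) (Xi br : seq R).
Hypotheses (br2 : (2 <= size br)%N) (br_lt : sorted (fun a b : R => a < b) br)
  (br0 : head 0 br = 0) (br1 : last 0 br = 1) (XiE : Xi = nseq q 0 ++ br ++ nseq q 1).

Section AtPoint.
Context (e : nat) (x : R).
Hypotheses (es : (e.+1 < size br)%N) (xe : br`_e < x < br`_e.+1).
Notation m := (q + e)%N.

Let x_gt0 : 0 < x.
Proof.
case/andP: xe => h _; apply: le_lt_trans h; apply: (breaks_ge0 br_lt br0).
exact: ltnW.
Qed.

Let cdb0E j : cdb Xi 0 j x = (j == m)%:R.
Proof.
have [js|sj] := ltnP j.+1 (size Xi).
  by rewrite (cdb0_elem br2 br_lt br0 br1 XiE (j := e)) //; case/andP: xe => h1 h2; rewrite ltW.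
have -> : (j == m) = false.
  by apply/negbTE/eqP => jm; move: sj; rewrite jm (size_knots XiE); lia.
rewrite /= (nth_default _ sj) ifF // ltNge (ltW x_gt0) andbF /=.
by rewrite (gt_eqF x_gt0) andbF.
Qed.

Lemma cdb_support p j : ((m < j) || (j + p < m))%N -> cdb Xi p j x = 0.
Proof.
elim: p j => [|p IH] j h; first by rewrite cdb0E; case: eqP => // jm; lia.
by rewrite [LHS]/= !IH ?mulr0 ?addr0 //; lia.
Qed.

(** The dual polynomial of the B-spline [j] of degree [p]: its roots are the knots strictly between
    the first and the last knot of that B-spline. *)
Definition dual_poly p j : {poly R} := \prod_(1 <= i < p.+1) ('X - (Xi`_(j + i))%:P).

(** In the recursion [dual_poly p j.+1] receives two contributions, with factors [X - b] and [X - a]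
    and weights [(x - a) / (b - a)] and [(b - x) / (b - a)]; together they make [X - x]. *)
Lemma marsden p M : (p <= q)%N -> (m < M)%N ->
  \sum_(j < M) cdb Xi p j x *: dual_poly p j = ('X - x%:P) ^+ p.
Proof.
elim: p M => [|p IH] M pm mM.
  rewrite expr0 (bigD1 (Ordinal mM)) // cdb0E eqxx scale1r big1 ?addr0.
    by rewrite /dual_poly big_geq //; exact: addr0.
  move=> j /andP[_ jm]; rewrite cdb0E; case: eqP => [jE|_]; last exact: scale0r.
  by case/eqP: jm; apply/val_inj.
case: M mM => // M mM.
have b0 : cdb Xi p 0 x = 0 by apply: cdb_support; lia.
have bM : cdb Xi p M.+1 x = 0 by apply: cdb_support; lia.
pose w j := (x - Xi`_j) / (Xi`_(j + p.+1) - Xi`_j).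
pose w' j := (Xi`_(j + p.+1 + 1) - x) / (Xi`_(j + p.+1 + 1) - Xi`_j.+1).
have cE j : cdb Xi p.+1 j x = w j * cdb Xi p j x + w' j * cdb Xi p j.+1 x by [].
rewrite (eq_bigr (fun j : 'I_M.+1 => (w j * cdb Xi p j x) *: dual_poly p.+1 j +
  (w' j * cdb Xi p j.+1 x) *: dual_poly p.+1 j)); last by move=> j _; rewrite cE scalerDl.
rewrite big_split /= big_ord_recl b0 mulr0 scale0r add0r big_ord_recr /= bM mulr0 scale0r addr0.
rewrite exprS -(IH M.+1 (ltnW pm) mM) big_ord_recl b0 scale0r add0r mulr_sumr.
rewrite -big_split /=; apply: eq_bigr => -[j jM] _ /=; rewrite /bump /= add1n.
have [b00|bn0] := eqVneq (cdb Xi p j.+1 x) 0; first by rewrite b00 !mulr0 !scale0r addr0 mulr0.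
have jm : (j.+1 <= m <= j.+1 + p)%N.
  rewrite leqNgt [(m <= _)%N]leqNgt; apply/andP; split; apply: contraNN bn0 => h; apply/eqP; apply: cdb_support; rewrite h ?orbT //.
(* A nonzero factor means that the support contains the element of [x], so its end knots differ and
   the division is not by 0. *)
have D : Xi`_(j.+1 + p.+1) - Xi`_j.+1 != 0.
  rewrite subr_eq0 gt_eqF //; case/andP: jm => jm1 jm2.
  case/andP: xe => x1 x2; have es' : (e < size br)%N by exact: ltnW.
  have sX := size_knots XiE.
  apply: (@le_lt_trans _ _ x).
    by apply: le_trans (ltW x1); rewrite -(nth_knots XiE es') (knots_le br2 br_lt br0 br1 XiE) //; lia.
  by apply: lt_le_trans x2 _; rewrite -(nth_knots XiE es) (knots_le br2 br_lt br0 br1 XiE) //; lia.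
have E1 : dual_poly p.+1 j.+1 = dual_poly p j.+1 * ('X - (Xi`_(j.+1 + p.+1))%:P).
  by rewrite /dual_poly big_nat_recr.
have E2 : dual_poly p.+1 j = ('X - (Xi`_j.+1)%:P) * dual_poly p j.+1.
  rewrite /dual_poly big_nat_recl // addn1; congr (_ * _).
  by apply: eq_bigr => i _; rewrite addnS addSn.
rewrite E1 E2 /w /w' (_ : (j + p.+1 + 1)%N = (j.+1 + p.+1)%N); last by lia.
move: D; set a := Xi`_j.+1; set b := Xi`_(j.+1 + p.+1); set c := cdb _ _ _ _; set chi := dual_poly _ _ => D.
rewrite -!mul_polyC.
have -> : ((x - a) / (b - a) * c)%:P = c%:P * ((x - a) / (b - a))%:P by rewrite mulrC polyCM.
have -> : ((b - x) / (b - a) * c)%:P = c%:P * (1 - ((x - a) / (b - a)))%:P.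
  by rewrite mulrC polyCM; congr (_ * _%:P); field.
have -> : x%:P = (a + (x - a) / (b - a) * (b - a))%:P by rewrite divfK //; congr (_%:P); ring.
by rewrite !(polyCD, polyCN, polyCM); ring.
Qed.

End AtPoint.

Notation nB := (size Xi - q.+1)%N.

(** The truncated power basis: normalised monomials up to degree [q], then one truncated power for
    each interior breakpoint. *)
Definition tfam i (x : R) : R := if (i <= q)%N then tpow i br`_0 x else tpow q br`_(i - q) x.

(** Marsden's identity read in two ways. Its coefficients give the monomials. Its value at a knot
    [y] gives the truncated powers: the dual polynomials of the B-splines straddling [y] vanish
    there, and of the others only those to the right of [y] are kept. *)
Lemma tfam_span i : (i < nB)%N -> exists c : 'I_nB -> R,
  forall x, open_elems br x -> tfam i x = \sum_j c j * bspline Xi q j x.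
Proof.
move=> inB; have sX := size_knots XiE.
have main x : open_elems br x -> exists e, [/\ (e.+1 < size br)%N, br`_e < x < br`_e.+1,
    0 < x, \sum_(j < nB) bspline Xi q j x *: dual_poly q j = ('X - x%:P) ^+ q &
    forall j, ((q + e < j) || (j + q < q + e))%N -> bspline Xi q j x = 0].
  move=> xo; have [e [es xe]] := find_open_elem br2 xo; exists e; split => //.
  - case/andP: xe => h _; apply: le_lt_trans h; apply: (breaks_ge0 br_lt br0); exact: ltnW.
  - rewrite -(marsden es xe (M := nB)); [|lia|lia].
    by apply: eq_bigr => j _; rewrite /bspline ltn_ord.
  - by move=> j h; rewrite /bspline; case: ifP => // _; exact: (cdb_support es xe).
rewrite /tfam; case: leqP => iq.
  exists (fun j => (dual_poly q j)`_(q - i) * (-1) ^+ i / 'C(q, i)%:R / i`!%:R) => x /main [e [es xe x0 mE _]].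
  have := congr1 (fun p : {poly R} => p`_(q - i)) mE.
  rewrite coef_sum coef_XsubC_exp // => H.
  rewrite nth0 br0 /tpow x0 subr0.
  have -> : x ^+ i / i`!%:R = ((- x) ^+ i *+ 'C(q, i)) * ((-1) ^+ i / 'C(q, i)%:R / i`!%:R).
    rewrite (exprNn x) -[X in _ = X * _]mulr_natr.
    have h1 : 'C(q, i)%:R != 0 :> R by rewrite pnatr_eq0 -lt0n bin_gt0.
    have h2 : i`!%:R != 0 :> R by rewrite pnatr_eq0 -lt0n fact_gt0.
    have h3 : (-1) ^+ i * (-1) ^+ i = 1 :> R by rewrite -exprD addnn -mul2n exprM sqrrN expr1n expr1n.
    transitivity (((-1) ^+ i * (-1) ^+ i) * (x ^+ i / i`!%:R)); first by rewrite h3 mul1r.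
    by field; rewrite h1 h2.
  rewrite -H mulr_suml; apply: eq_bigr => j _; rewrite coefZ.
  by ring.
pose y := br`_(i - q).
have yE : y = Xi`_i by rewrite /y -(nth_knots XiE) ?subnKC ?(ltnW iq) //; lia.
exists (fun j => if (i <= j)%N then (dual_poly q j).[y] * (-1) ^+ q / q`!%:R else 0) => x /main [e [es xe x0 mE sup]].
have psi0 (j : nat) : (i - q <= j < i)%N -> (dual_poly q j).[y] = 0.
  move=> /andP[j1 j2]; rewrite /dual_poly horner_prod yE big_nat.
  apply/eqP; rewrite prodf_seq_eq0; apply/hasP; exists (i - j)%N; first by rewrite mem_index_iota; lia.
  have -> : (0 < i - j < q.+1)%N by lia.
  by rewrite subnKC ?(ltnW j2) // hornerXsubC subrr eqxx.
have is_ : (i - q < size br)%N by lia.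
have [yx|xy] := ltP y x.
  have ie : (i - q <= e)%N.
    rewrite leqNgt; apply/negP => ei; case/andP: xe => _ x2.
    have : br`_e.+1 <= y by exact: (breaks_le br_lt).
    by rewrite leNgt (lt_trans yx).
  rewrite /tpow yx; have := congr1 (fun p : {poly R} => p.[y]) mE.
  rewrite horner_sum horner_exp hornerXsubC => H.
  have -> : (x - y) ^+ q / q`!%:R = (y - x) ^+ q * ((-1) ^+ q / q`!%:R).
    by rewrite mulrA -exprMn mulrN1 opprB.
  rewrite -H mulr_suml; apply: eq_bigr => j _; rewrite hornerZ.
  case: leqP => ij; first by ring.
  have [ji|ij2] := leqP (i - q) j; first by rewrite psi0 ?ji ?ij // mulr0 !mul0r.
  by rewrite sup ?mul0r ?mulr0 //; lia.
rewrite tpow_le // big1 // => j _; case: leqP => ij; last by rewrite mul0r.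
rewrite sup ?mulr0 //; have ei : (e < i - q)%N; last by lia.
rewrite ltnNge; apply/negP => ie; case/andP: xe => x1 _.
have : y <= br`_e by apply: (breaks_le br_lt) => //; exact: ltnW.
by rewrite leNgt (lt_le_trans x1).
Qed.

End Marsden.

Section SplineDuality.
Context (R : realType) (br : seq R) (q : nat).
Hypotheses (br2 : (2 <= size br)%N)
  (brlt : forall i j, (i < j)%N -> (j < size br)%N -> br`_i < br`_j) (lo0 : br`_0 = 0) (q0 : (0 < q)%N).
Notation leb := (@lebesgue_measure R).
Notation hi := br`_(size br).-1.
Notation oe_int f := (\int[leb]_x (\1_(open_elems br) x * f x)).
Notation N := (q + (size br).-1)%N.

Let brle i j : (i <= j)%N -> (j < size br)%N -> br`_i <= br`_j.
Proof. by rewrite leq_eqVlt => /orP[/eqP -> //|ij js]; exact/ltW/brlt. Qed.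

Let br_ge0 i : 0 <= br`_i.
Proof.
have [is_|si] := ltnP i (size br); last by rewrite nth_default.
by rewrite -[X in X <= _]lo0; exact: brle.
Qed.

Let br_le_hi i : br`_i <= hi.
Proof.
have [is_|si] := ltnP i (size br); first by apply: brle; lia.
by rewrite [X in X <= _]nth_default.
Qed.

Section Orthogonality.
Context (Q : {poly R}) (c : nat -> R).
Hypothesis sQ : (size Q <= (2 * q).+1)%N.
Notation h := (hfun br q Q c).

Let hp j : (j < 2 * q)%N -> pw_deriv_pair br (h j) (h j.+1).
Proof. exact: hfun_pair. Qed.

Let hop j : (j <= 2 * q)%N -> open_poly br (h j).
Proof.
case: j => [_|j jq]; last exact: (pw_deriv_pair_open_poly (hp jq)).2.
by apply: (pw_deriv_pair_open_poly (hp (j := 0) _)).1; lia.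
Qed.

(** Repeated integration by parts. Boundary terms vanish at the right end by assumption and at 0
    because the truncated power does; the last step, against the step function, leaves a difference
    of point values. *)
Lemma oe_int_hfun_tpow k j i : (k < j)%N -> (j <= 2 * q)%N ->
  (forall l, (j - k <= l < j)%N -> h l hi = 0) ->
  oe_int (fun x => h j x * tpow k br`_i x) = (-1) ^+ k * (h (j - k.+1) hi - h (j - k.+1) br`_i).
Proof.
elim: k j => [|k IH] j kj jq hz.
  case: j kj jq hz => // j _ jq _.
  rewrite expr0 mul1r subSS subn0.
  have P := hp jq.
  (* Subtracting the value at the knot makes the product with the step function continuous, as an
     antiderivative must be. *)
  pose u x := (h j x - h j br`_i) * tpow 0 br`_i x.
  have Pu : pw_deriv_pair br u (fun x => h j.+1 x * tpow 0 br`_i x).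
    move=> l ls; have [p [gp fp]] := P l ls.
    have [il|li] : br`_i <= br`_l \/ br`_l.+1 <= br`_i.
      have [is_|si] := ltnP i (size br); last by left; rewrite (nth_default _ si); exact: br_ge0.
      by have [il|li] := leqP i l; [left; apply: brle => //; exact: ltnW | right; exact: brle].
    - exists (p - (h j br`_i)%:P); split=> x xl.
        rewrite /u hornerD hornerN hornerC -gp //; case/andP: xl => lx _.
        have := le_trans il lx; rewrite /tpow le_eqVlt => /orP[/eqP <-|->]; first by rewrite ltxx mulr0 subrr.
        by rewrite expr0 divr1 mulr1.
      rewrite derivD derivN derivC subr0 fp //; case/andP: xl => lx _.
      by rewrite /tpow (le_lt_trans il lx) expr0 divr1 mulr1.
    - exists 0; split=> x /andP[lx xl]; rewrite ?deriv0 horner0 /u tpow_le ?mulr0 //.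
        exact: le_trans li.
      exact: le_trans (ltW xl) li.
  rewrite (pw_deriv_pair_FTC br2 brlt Pu) /u lo0 [X in _ - X](_ : _ = 0) ?subr0; last first.
    by rewrite tpow_le ?mulr0.
  have := br_le_hi i; rewrite /tpow le_eqVlt => /orP[/eqP ->|->]; first by rewrite ltxx mulr0 subrr.
  by rewrite expr0 divr1 mulr1.
case: j kj jq hz => // j kj jq hz.
have P := hp jq; have P2 := tpow_pair brlt lo0 k i.
have := pw_deriv_pair_FTC br2 brlt (pw_deriv_pairM P P2).
have t0 : tpow k.+1 br`_i br`_0 = 0 by apply: tpow_le; rewrite lo0.
rewrite t0 mulr0 subr0 hz ?mul0r; last by lia.
rewrite (oe_intD br2 brlt).
- rewrite (IH j); [|lia|lia|by move=> l hl; apply: hz; lia].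
  by rewrite subSS => /eqP; rewrite addr_eq0 => /eqP ->; rewrite exprS mulN1r mulNr.
- by apply: open_polyM; [apply: hop | exact: (pw_deriv_pair_open_poly P2).1].
- by apply: open_polyM; [apply: hop; lia | exact: (pw_deriv_pair_open_poly P2).2].
Qed.

Hypotheses (h0 : forall j, (j <= q)%N -> h j 0 = 0)
  (orth_poly : forall k, (k < q)%N -> oe_int (fun x => h q x * tpow k br`_0 x) = 0)
  (orth_tpow : forall i, (0 < i < (size br).-1)%N -> oe_int (fun x => h q x * tpow q.-1 br`_i x) = 0).

Let hidx l : (l < q)%N -> (q - (q - l).-1.+1)%N = l.
Proof. by lia. Qed.

(** Testing with monomials of increasing degree kills the derivatives at the right end, from order
    [q - 1] down to 0. *)
Let hhi k : (k < q)%N -> h (q - k.+1) hi = 0.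
Proof.
elim/ltn_ind: k => k IH kq.
have := orth_poly kq; rewrite oe_int_hfun_tpow //; [|lia|].
  rewrite lo0 h0 ?subr0; last by lia.
  by move/eqP; rewrite mulf_eq0 expf_eq0 oppr_eq0 oner_eq0 andbF /= => /eqP.
move=> l lr; rewrite -(hidx (l := l)); last by case/andP: lr.
by apply: IH; have := hidx (l := l); lia.
Qed.

Let hhi' l : (l < q)%N -> h l hi = 0.
Proof. by move=> lq; rewrite -(hidx lq); apply: hhi; have := hidx lq; lia. Qed.

(** With the right end settled, testing with [tpow q.-1] at an interior breakpoint isolates the
    value of [h] there. *)
Let hknot i : (i < size br)%N -> h 0 br`_i = 0.
Proof.
move=> is_; case: i is_ => [_|i is_]; first by rewrite lo0 h0.
have [->|ne] := eqVneq i.+1 (size br).-1; first exact: hhi'.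
have := @orth_tpow i.+1; rewrite oe_int_hfun_tpow //; [|lia|lia|by move=> l lr; apply: hhi'; lia].
rewrite prednK // subnn hhi' // sub0r mulrN => H.
have /H /eqP : (0 < i.+1 < (size br).-1)%N by lia.
rewrite oppr_eq0 mulf_eq0 expf_eq0 oppr_eq0 oner_eq0 andbF /= => H'.
exact/eqP.
Qed.

Let zero_elem j : (j.+1 < size br)%N -> (forall x, br`_j < x < br`_j.+1 -> h 0 x = 0) ->
  forall l, (l < 2 * q)%N -> forall x, br`_j <= x <= br`_j.+1 -> h l x = 0.
Proof.
move=> js z0.
have H l : (l < 2 * q)%N -> (forall x, br`_j < x < br`_j.+1 -> h l x = 0).
  elim: l => [|l IH] lq //.
  by have [_] := pw_deriv_pair_zero brlt (hp (ltnW lq)) js (IH (ltnW lq)).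
move=> l lq; exact: (pw_deriv_pair_zero brlt (hp lq) js (H l lq)).1.
Qed.

(** At each end of a maximal run the vanishing derivatives come either from the end of the whole
    interval or from a neighbouring element on which [h] is zero. *)
Lemma hfun_zero x : 0 <= x <= hi -> h q x = 0.
Proof.
pose nz j := (j.+1 < size br)%N && `[< exists2 x, br`_j < x < br`_j.+1 & h 0 x != 0 >].
have zE j : (j.+1 < size br)%N -> ~~ nz j -> forall x, br`_j < x < br`_j.+1 -> h 0 x = 0.
  rewrite /nz => -> /= /asboolPn nx y yj; apply/eqP/negP => /negP h0y.
  by apply: nx; exists y.
have no j : ~~ nz j.
  apply/negP => nzj; pose P a := nz a.
  have exP : exists a, P a by exists j.
  case: (ex_minnP exP) => a /[dup] nza /andP[as_ _] amin.
  (* The index [size br] never satisfies [nz], so an end of the run exists. *)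
  pose P' b := ~~ nz b && (a < b)%N.
  have exP' : exists b, P' b.
    by exists (size br); rewrite /P' (ltnW as_) andbT /nz ltnNge leqnSn.
  case: (ex_minnP exP') => b /andP[zb ab] bmin.
  have run i : (a <= i < b)%N -> nz i.
    rewrite leq_eqVlt => /andP[/orP[/eqP <- //|ai] ib]; apply/negPn/negP => zi.
    by have := bmin i; rewrite /P' zi ai => /(_ isT); rewrite leqNgt ib.
  have bs : (b < size br)%N by have := run b.-1; rewrite /nz => /(_ _)/andP[]; lia.
  apply: (zero_run_contra br2 brlt lo0 sQ ab bs q0 (c := c)).
  - move=> l lq; have [a0|ap] := posnP a; first by rewrite a0 lo0 h0.
    have as' : (a.-1.+1 < size br)%N by rewrite prednK // ltnW.
    have az : ~~ nz a.-1 by apply/negP => /amin; rewrite leqNgt prednK // leqnn.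
    apply: (zero_elem as' (zE _ as' az)); first by lia.
    by rewrite prednK // lexx andbT; apply: brle; [exact: leq_pred | exact: ltnW].
  - move=> l lq; have [be|bne] := eqVneq b (size br).-1; first by rewrite be hhi'.
    have bs' : (b.+1 < size br)%N by lia.
    apply: (zero_elem (j := b)) => //; [exact: zE | by lia | by rewrite lexx; apply: brle].
  - by move=> i /andP[_ ib]; apply: hknot; exact: leq_ltn_trans bs.
  - by move=> i /run /andP[_ /asboolP].
move=> xr; have [|j [js xj]] := find_elem br2 (x := x); first by rewrite lo0.
by apply: (zero_elem (j := j)) => //; [exact: zE | lia].
Qed.

End Orthogonality.
End SplineDuality.

(** * Injectivity of the purely temporal problem *)

Section SplineInjectivity.
Context (R : realType) (br : seq R) (q : nat).
Hypotheses (br2 : (2 <= size br)%N)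
  (brlt : forall i j, (i < j)%N -> (j < size br)%N -> br`_i < br`_j) (lo0 : br`_0 = 0) (q0 : (0 < q)%N).
Notation leb := (@lebesgue_measure R).
Notation hi := br`_(size br).-1.
Notation oe_int f := (\int[leb]_x (\1_(open_elems br) x * f x)).
Context (n : nat) (nE : n = (q + (size br).-1)%N).

Let brle i j : (i <= j)%N -> (j < size br)%N -> br`_i <= br`_j.
Proof. by rewrite leq_eqVlt => /orP[/eqP -> //|ij js]; exact/ltW/brlt. Qed.

Let br_ge0 i : 0 <= br`_i.
Proof.
have [is_|si] := ltnP i (size br); last by rewrite nth_default.
by rewrite -[X in X <= _]lo0; exact: brle.
Qed.

(** On the first element only the monomials are seen; each further element sees exactly one new
    truncated power. *)
Let tfam_free (a : nat -> R) :
  (forall x, open_elems br x -> \sum_(i < n) a i * tfam q br i x = 0) -> forall i, (i < n)%N -> a i = 0.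
Proof.
move=> H.
have low k : (k <= q)%N -> a k = 0.
  move=> kq; pose p : {poly R} := \sum_(i < n) (if (i <= q)%N then (a i / i`!%:R) *: 'X^i else 0).
  have p0 : p = 0.
    apply: (poly_zero_on_itv (brlt (ltnSn 0) br2)) => x xe.
    rewrite -[RHS](H x); last exact: open_elemsP xe.
    rewrite horner_sum; apply: eq_bigr => i _; rewrite /tfam; case: leqP => iq.
      by rewrite hornerZ hornerXn lo0 /tpow; case/andP: xe => x0 _; rewrite lo0 in x0; rewrite x0 subr0 mulrAC mulrA.
    rewrite horner0 tpow_le ?mulr0 //; case/andP: xe => _ /ltW x1; apply: le_trans x1 _.
    by apply: brle; have := ltn_ord i; lia.
  have kn : (k < n)%N by lia.
  have := congr1 (fun p : {poly R} => p`_k) p0; rewrite coef0 /p coef_sum (bigD1 (Ordinal kn)) //= kq big1 => [|i ik].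
    rewrite addr0 coefZ coefXn eqxx mulr1 => /eqP; rewrite mulf_eq0 invr_eq0 pnatr_eq0 => /orP[/eqP //|].
    by rewrite eqn0Ngt fact_gt0.
  case: ifP => _; last exact: coef0.
  rewrite coefZ coefXn; case: eqP => ki; last exact: mulr0.
  by case/eqP: ik; apply/val_inj; rewrite /= ki.
elim/ltn_ind => i IH iN; have [iq|qi] := leqP i q; first exact: low.
pose e := (i - q)%N; have es : (e.+1 < size br)%N by rewrite /e; lia.
have elt := brlt (ltnSn e) es.
pose x := (br`_e + br`_e.+1) / 2.
have xe : br`_e < x < br`_e.+1 by rewrite /x; apply/andP; split; lra.
have := H x (open_elemsP br2 brlt es xe); rewrite (bigD1 (Ordinal iN)) //= big1 => [|j ji].
  rewrite addr0 /tfam leqNgt qi /= -/e /tpow; case/andP: (xe) => -> _.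
  move/eqP; rewrite mulf_eq0 => /orP[/eqP //|]; rewrite mulf_eq0 expf_eq0 subr_eq0 invr_eq0 pnatr_eq0.
  by rewrite [x == _]gt_eqF ?andbF /= ?eqn0Ngt ?fact_gt0 //; case/andP: xe.
have [jlt|jgt|jE] := ltngtP j i.
- by rewrite IH ?mul0r.
- rewrite /tfam leqNgt (ltn_trans qi jgt) /= tpow_le ?mulr0 //; case/andP: xe => _ /ltW x1; apply: le_trans x1 _.
  by apply: brle; have := ltn_ord j; rewrite /e; lia.
- by case/eqP: ji; apply/val_inj.
Qed.

Context (beta : 'I_n -> R -> R).
Hypotheses (bpw : forall j, pw_poly br (beta j))
  (bspan : forall i : 'I_n, exists c : 'I_n -> R,
     forall x, open_elems br x -> tfam q br i x = \sum_j c j * beta j x).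

Let comb (y : 'I_n -> R) x := \sum_j y j * beta j x.

Let comb_pw y : pw_poly br (comb y).
Proof.
apply: pw_poly_sum => j; rewrite (_ : (fun x => _) = fun x => (y j)%:P.[x] * beta j x).
  by apply: pw_polyM; [exact: pw_poly_horner | exact: bpw].
by apply/funext => x; rewrite hornerC.
Qed.

(** The [n] truncated powers are independent and lie in the span of the [n] functions [beta]; the
    square matrix between the families is invertible, so the [beta] lie in their span. *)
Let comb_tfam y : exists a : nat -> R, forall x, open_elems br x ->
  comb y x = \sum_(i < n) a i * tfam q br i x.
Proof.
have C i := cid (bspan i).
pose M : 'M[R]_n := \matrix_(i, j) sval (C i) j.
have ME (u : 'rV[R]_n) x : open_elems br x ->
    \sum_i u 0 i * tfam q br i x = \sum_j (u *m M) 0 j * beta j x.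
  move=> xo; under [RHS]eq_bigr do rewrite mxE mulr_suml.
  rewrite exchange_big /=; apply: eq_bigr => i _; rewrite (svalP (C i) x xo) mulr_sumr.
  by apply: eq_bigr => j _; rewrite mxE mulrA.
have Mu : M \in unitmx.
  rewrite -row_free_unit -kermx_eq0; apply/rowV0P => u /sub_kermxP uM.
  pose a i := if insub i is Some j then u 0 j else 0 : R.
  have aE (i : 'I_n) : a i = u 0 i by rewrite /a valK.
  have a0 := @tfam_free a; apply/rowP => i; rewrite mxE -aE a0 // => x xo.
  under eq_bigr do rewrite aE.
  by rewrite ME // uM big1 // => j _; rewrite mxE mul0r.
pose u := (\row_j y j) *m invmx M.
exists (fun i => if insub i is Some j then u 0 j else 0) => x xo.
transitivity (\sum_(i < n) u 0 i * tfam q br i x); last by apply: eq_bigr => i _; rewrite valK.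
by rewrite ME // /u mulmxKV //; apply: eq_bigr => j _; rewrite mxE.
Qed.

Let derive1_eq (g g' : R -> R) (x : R) : open_elems br x -> (forall x : R, open_elems br x -> g x = g' x) ->
  derive1 g x = derive1 g' x.
Proof.
move=> xo gg; rewrite !derive1E; apply: near_eq_derive.
have : nbhs x (open_elems br) by apply: open_nbhs_nbhs; split => //; exact: open_elems_open.
by apply: filterS => y /gg.
Qed.

Lemma spline_deriv_orthogonal y : comb y 0 = 0 ->
  (forall w, comb w 0 = 0 -> oe_int (fun x => derive1 (comb w) x * comb y x) = 0) ->
  forall x, 0 <= x <= hi -> comb y x = 0.
Proof.
move=> y0 orth; have [a aE] := comb_tfam y.
(* [P l] is the [l]-th derivative of [P 0], and [P q] is the polynomial part of the given spline;
   the exponents [i + q - l] make the orders below [q] vanish at 0. *)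
pose P l : {poly R} := \sum_(i < q.+1) (a i / (i + q - l)`!%:R) *: 'X^(i + q - l).
pose c e := a (q + e)%N.
have Pd l : (l <= q)%N -> derivn l (P 0) = P l.
  elim: l => [//|l IH] lq; rewrite derivnS IH 1?ltnW // raddf_sum /=; apply: eq_bigr => i _.
  rewrite derivZ derivXn (_ : (i + q - l)%N = (i + q - l.+1).+1); last by lia.
  set k := (i + q - l.+1)%N; rewrite /= -[X in _ *: X]scaler_nat scalerA; congr (_ *: _).
  have h1 : k`!%:R != 0 :> R by rewrite pnatr_eq0 -lt0n fact_gt0.
  have h2 : k.+1%:R != 0 :> R by rewrite pnatr_eq0.
  by rewrite factS natrM; field; rewrite ?nat1r ?h1 ?h2.
have sP : (size (P 0) <= (2 * q).+1)%N.
  apply: (leq_trans (size_sum _ _ _)); apply/bigmax_leqP => i _.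
  apply: (leq_trans (size_scale_leq _ _)); rewrite size_polyXn; have := ltn_ord i; lia.
have hE x : open_elems br x -> hfun br q (P 0) c q x = comb y x.
  move=> xo; rewrite aE // /hfun Pd // (_ : (2 * q - q)%N = q); last by lia.
  have x0 : 0 < x by have [/andP[h _] _] := xo; rewrite -lo0.
  have -> : n = (q.+1 + (size br).-2)%N by lia.
  rewrite big_split_ord /=; congr (_ + _).
    rewrite horner_sum; apply: eq_bigr => i _.
    have iq : (nat_of_ord i <= q)%N by have := ltn_ord i; rewrite ltnS.
    by rewrite hornerZ hornerXn addnK /tfam iq lo0 /tpow x0 subr0 mulrA mulrAC.
  rewrite -[1%N]addn0 iotaDl big_map -/(index_iota 0 _).
  have -> : iota 0 (size br).-2 = index_iota 0 (size br).-2 by rewrite /index_iota subn0.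
  rewrite big_mkord; apply: eq_bigr => i _; rewrite /tfam /c (_ : (q.+1 + i <= q)%N = false); last by lia.
  by congr (a _ * tpow _ br`_ _ _); lia.
have hpw : pw_poly br (hfun br q (P 0) c q).
  have q2 : (q < 2 * q)%N by lia.
  exact: pw_deriv_pair_pw_poly (@hfun_pair _ _ br2 brlt lo0 q (P 0) c sP q q2).
have hEE x : 0 <= x <= hi -> hfun br q (P 0) c q x = comb y x.
  by rewrite -[X in X <= _ <= _]lo0; apply: (pw_poly_eq br2 brlt hpw (comb_pw y)).
have hi0 : 0 <= hi by exact: br_ge0.
(* The truncated power of one degree more is a spline vanishing at 0, so its derivative is an
   admissible test function. *)
have ortht k i (iN : (i < n)%N) e : (e < size br)%N -> tfam q br i = tpow k.+1 br`_e ->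
    oe_int (fun x => hfun br q (P 0) c q x * tpow k br`_e x) = 0.
  move=> es tE; have [w wE] := bspan (Ordinal iN).
  have w0 : comb w 0 = 0.
    have P2 := pw_deriv_pair_pw_poly (tpow_pair brlt lo0 k e).
    rewrite -(pw_poly_eq br2 brlt P2 (comb_pw w)) ?tpow_le ?lo0 ?lexx ?br_ge0 // => x xo.
    by rewrite -tE; exact: wE.
  apply: etrans (orth w w0); apply: eq_Rintegral => x _; rewrite indicE.
  case: (boolP (x \in _)) => [|_]; last by rewrite !mul0r.
  rewrite inE => xo; rewrite hE // [X in _ * X]mulrC; congr (_ * (_ * _)).
  rewrite -(pw_deriv_pair_derive1 br2 (tpow_pair brlt lo0 k e) xo).
  by apply: derive1_eq => // t to; rewrite -tE; exact: wE.
move=> x xr; rewrite -hEE //.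
apply: (hfun_zero br2 brlt lo0 q0 sP) => //.
- move=> l lq; have [->|lne] := eqVneq l q; first by rewrite hEE ?lexx.
  rewrite /hfun Pd // horner_sum !big1 ?addr0 // => [i _|i _].
    by rewrite tpow_le ?mulr0.
  by rewrite hornerZ hornerXn expr0n (_ : (i + q - l == 0)%N = false) ?mulr0 //; lia.
- move=> k kq; apply: (ortht k k.+1) => //; [lia | lia |].
  by apply/funext => t; rewrite /tfam kq.
- move=> i ir; apply: (ortht q.-1 (q + i)%N); [lia | lia |].
  apply/funext => t; rewrite /tfam prednK // (_ : (q + i <= q)%N = false); last by lia.
  by rewrite addKn.
Qed.

End SplineInjectivity.

(** * The Galerkin system *)

Section Subspaces.
Context (R : realType) (K : nat).
Implicit Types (S : set 'rV[R]_K).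

Definition lin_subset S := S 0 /\ forall a c e, S c -> S e -> S (a *: c + e).

Lemma lin_subsetZ S a c : lin_subset S -> S c -> S (a *: c).
Proof. by move=> [S0 H] Sc; rewrite -[_ *: _]addr0; exact: H. Qed.

Lemma lin_subset_mulmx S N (A : 'M[R]_(N, K)) (x : 'rV[R]_N) : lin_subset S ->
  (forall i, S (row i A)) -> S (x *m A).
Proof.
move=> [S0 H] SA; rewrite mulmx_sum_row; elim/big_rec : _ => // i y _ Sy.
exact: H.
Qed.

(** A longest family in [S] that is independent modulo [S0]; its length is bounded because such a
    family is independent in the ordinary sense. *)
Lemma lin_subset_basis S S0 : lin_subset S -> lin_subset S0 ->
  exists N (A : 'M[R]_(N, K)), [/\ forall i, S (row i A), forall x, S0 (x *m A) -> x = 0 &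
    forall c, S c -> exists x, S0 (c - x *m A)].
Proof.
move=> SS SS0.
pose P N := `[< exists A : 'M[R]_(N, K), (forall i, S (row i A)) /\ forall x, S0 (x *m A) -> x = 0 >].
have exP : exists N, P N.
  by exists 0%N; apply/asboolP; exists 0; split=> [[]//|x _]; apply/rowP => -[].
have ubP N : P N -> (N <= K)%N.
  move=> /asboolP[A [_ A0]]; have : row_free A.
    rewrite -kermx_eq0; apply/rowV0P => u /sub_kermxP uA.
    by apply: A0; rewrite uA; exact: SS0.1.
  by move/eqP <-; exact: rank_leq_col.
case: (ex_maxnP exP ubP) => N /asboolP[A [SA A0]] Nmax.
exists N, A; split=> // c Sc; apply: contrapT => /forallNP nc.
have : P (N + 1)%N.
  apply/asboolP; exists (col_mx A c); split=> [i|x].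
    case: (split_ordP i) => j ->; first by rewrite rowKu.
    by rewrite rowKd (_ : row j c = c) //; apply/rowP => k; rewrite mxE !ord1.
  rewrite -[x]hsubmxK mul_row_col; set y := lsubmx x; set t := rsubmx x => H.
  have tE : t *m c = t 0 0 *: c.
    by rewrite {1}[t]mx11_scalar mul_scalar_mx.
  have [t0|t0] := eqVneq (t 0 0) 0.
    rewrite tE t0 scale0r addr0 in H; rewrite (A0 _ H).
    have -> : t = 0 by apply/rowP => k; rewrite ord1 t0 mxE.
    by rewrite row_mx0.
  case: (nc (- (t 0 0)^-1 *: y)).
  have := lin_subsetZ (t 0 0)^-1 SS0 H; rewrite tE scalerDr scalerA mulVf // scale1r addrC.
  by rewrite -scalemxAl scaleNr opprK.
by move/Nmax; rewrite addn1 ltnn.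
Qed.

Context (S S0 : set 'rV[R]_K) (B : 'rV[R]_K -> 'rV[R]_K -> R) (L : 'rV[R]_K -> R).
Hypotheses (SS : lin_subset S) (SS0 : lin_subset S0)
  (B_lin : forall c a e e', B c (a *: e + e') = a * B c e + B c e')
  (L_lin : forall a e e', L (a *: e + e') = a * L e + L e')
  (B0 : forall c e, S0 e -> B c e = 0) (L0 : forall e, S0 e -> L e = 0).

Let lin_mulmx (f : 'rV[R]_K -> R) N (A : 'M[R]_(N, K)) x :
  (forall a e e', f (a *: e + e') = a * f e + f e') -> f (x *m A) = \sum_i x 0 i * f (row i A).
Proof.
move=> f_lin; have f0 : f 0 = 0.
  by have := f_lin 1 0 0; rewrite scaler0 addr0 mul1r => /eqP; rewrite -subr_eq0 opprD addNKr oppr_eq0 => /eqP.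
rewrite mulmx_sum_row; elim/big_rec2 : _ => // i y1 y2 _ <-.
exact: f_lin.
Qed.

Let solve_basis N (A : 'M[R]_(N, K)) c :
  (forall c, S c -> exists x, S0 (c - x *m A)) ->
  (forall i, B c (row i A) = L (row i A)) -> forall e, S e -> B c e = L e.
Proof.
move=> A1 H e Se; have [x S0x] := A1 e Se.
have -> : e = 1 *: (x *m A) + (e - x *m A) by rewrite scale1r addrC subrK.
rewrite B_lin L_lin (B0 c S0x) (L0 S0x) !(lin_mulmx _ _ (B_lin c)) !(lin_mulmx _ _ L_lin).
by under eq_bigr do rewrite H.
Qed.

(** [B c c] need not be quadratic in [c], so [Q] stands in for it: continuous, homogeneous of degree
    2 and definite modulo [S0], it has a positive minimum [kap] on the unit sphere of a complement,
    and this beats the linear load far out. *)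
Lemma galerkin_coercive (Q : 'rV[R]_K -> R) :
  (forall e, continuous (B^~ e)) -> continuous Q -> (forall a c, Q (a *: c) = a ^+ 2 * Q c) ->
  (forall c, S c -> Q c <= B c c) -> (forall c, S c -> Q c <= 0 -> S0 c) ->
  exists2 c, S c & forall e, S e -> B c e = L e.
Proof.
move=> Bc Qc Qh QB Q0.
have [N [A [SA A0 A1]]] := lin_subset_basis SS SS0.
have Ac : continuous (fun x : 'rV[R]_N => x *m A).
  apply: rowv_continuous => k x.
  rewrite /prop_for (_ : (fun y : 'rV[R]_N => _) = (fun y : 'rV[R]_N => \sum_i y 0 i * A i k)); last first.
    by apply/funext => y; rewrite mxE.
  apply: continuous_sum_at => i.
  by apply: continuousM; [exact: coord_continuous | exact: cst_continuous].
have [kap kap0 Hkap] : exists2 kap, 0 < kap & forall y : 'rV[R]_N, `|y| = 1 -> kap <= Q (y *m A).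
  pose Sph := [set y : 'rV[R]_N | forall k, - 1 <= y 0 k <= 1] `&` (fun y => `|y|) @^-1` [set 1].
  have SphE (y : 'rV[R]_N) : `|y| = 1 -> Sph y.
    move=> y1; split=> // k; rewrite -ler_norml -y1; exact: coord_le_norm.
  have [[y0 y0S]|ns] := pselect (Sph !=set0); last first.
    by exists 1 => // y /SphE yS; case: ns; exists y.
  have Sc : compact Sph.
    apply: compact_closedI; first exact: (@closed_box_compact R N (fun=> - 1) (fun=> 1)).
    apply: preimage_closed; first by move=> y _; exact: norm_continuous.
    exact: closed_eq.
  have cQ : continuous (fun y : 'rV[R]_N => Q (y *m A)).
    by move=> y; apply: (@continuous_comp _ _ _ (fun y : 'rV[R]_N => y *m A) Q); [exact: Ac | exact: Qc].
  have [y1 y1S y1min] := EVT_min_rV (ex_intro _ y0 y0S) Sc (continuous_subspaceT cQ).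
  exists (Q (y1 *m A)); last by move=> y /SphE yS; apply: y1min; rewrite inE.
  rewrite ltNge; apply/negP => /Q0 H; have /A0 y10 : S0 (y1 *m A) by apply: H; exact: lin_subset_mulmx.
  by move: y1S; rewrite inE y10 => -[_ /=]; rewrite normr0 => /eqP; rewrite eq_sym oner_eq0.
pose C := \sum_i `|L (row i A)|.
have C0 : 0 <= C by apply: sumr_ge0.
pose P (x : 'rV[R]_N) : 'rV[R]_N := \row_i (B (x *m A) (row i A) - L (row i A)).
have [x Px] : exists x, P x = 0.
  (* From this radius on [kap * s ^+ 2] exceeds [s * C], the bound of the load on vectors of norm
     [s]. *)
  apply: (@coercive_zero R N P ((C + 1) / kap)); first by rewrite divr_gt0 // ltr_wpDl.
    apply: rowv_continuous => i x; rewrite /prop_for.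
    rewrite (_ : (fun y => _) = (fun y : 'rV[R]_N => B (y *m A) (row i A) - L (row i A))); last first.
      by apply/funext => y; rewrite mxE.
    apply: continuousB; last exact: cst_continuous.
    by apply: (@continuous_comp _ _ _ (fun y : 'rV[R]_N => y *m A) (B^~ (row i A))); [exact: Ac | exact: Bc].
  move=> x k xk; pose s := `|x|.
  have s1 : (C + 1) / kap <= s by apply: le_trans xk _; exact: coord_le_norm.
  have s0 : 0 < s by apply: lt_le_trans s1; rewrite divr_gt0 // ltr_wpDl.
  have -> : \sum_j P x 0 j * x 0 j = B (x *m A) (x *m A) - L (x *m A).
    rewrite (lin_mulmx _ _ (B_lin (x *m A))) (lin_mulmx _ _ L_lin) -sumrB.
    by apply: eq_bigr => j _; rewrite mxE mulrC mulrBr.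
  rewrite subr_gt0; apply: (@lt_le_trans _ _ (Q (x *m A))); last by apply: QB; apply: lin_subset_mulmx.
  have -> : x = s *: (s^-1 *: x) by rewrite scalerA divff ?scale1r // gt_eqF.
  have y1 : `|s^-1 *: x| = 1 by rewrite normrZ gtr0_norm ?invr_gt0 // mulVf // gt_eqF.
  rewrite -scalemxAl Qh; apply: (@lt_le_trans _ _ (s ^+ 2 * kap)); last first.
    by rewrite ler_wpM2l ?sqr_ge0 // Hkap.
  rewrite scalemxAl scalerA divff ?gt_eqF // scale1r (lin_mulmx _ _ L_lin).
  apply: (@le_lt_trans _ _ (s * C)).
    rewrite /C mulr_sumr; apply: ler_sum => i _; apply: le_trans (ler_norm _) _.
    by rewrite normrM ler_wpM2r // coord_le_norm.
  rewrite expr2 -mulrA ltr_pM2l //; move: s1; rewrite ler_pdivrMr // => s1.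
  by apply: lt_le_trans s1; rewrite ltrDl.
exists (x *m A); first exact: lin_subset_mulmx.
apply: (solve_basis A1) => i; apply/eqP; rewrite -subr_eq0; apply/eqP.
by have /rowP /(_ i) := Px; rewrite !mxE.
Qed.

(** The matrix of [B] in a basis modulo [S0] is invertible, since a kernel vector yields an element
    of [S] on which every [B c] vanishes. *)
Lemma galerkin_linear :
  (forall e a c c', B (a *: c + c') e = a * B c e + B c' e) -> (forall c e, S0 c -> B c e = 0) ->
  (forall e, S e -> (forall c, S c -> B c e = 0) -> S0 e) ->
  exists2 c, S c & forall e, S e -> B c e = L e.
Proof.
move=> Bl B0' inj; have [N [A [SA A0 A1]]] := lin_subset_basis SS SS0.
pose G : 'M[R]_N := \matrix_(i, j) B (row i A) (row j A).
have Gu : G \in unitmx.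
  rewrite -unitmx_tr -row_free_unit -kermx_eq0; apply/rowV0P => u /sub_kermxP uG.
  apply: A0; apply: inj => [|c Sc]; first exact: lin_subset_mulmx.
  have [x S0x] := A1 c Sc.
  have -> : c = 1 *: (x *m A) + (c - x *m A) by rewrite scale1r addrC subrK.
  rewrite Bl (B0' _ _ S0x) addr0 mul1r (lin_mulmx _ _ (Bl _)) big1 // => i _.
  rewrite (lin_mulmx _ _ (B_lin _)); apply/eqP; rewrite mulf_eq0; apply/orP; right; apply/eqP.
  have /rowP /(_ i) := uG; rewrite !mxE => uGi; rewrite -[RHS]uGi.
  by apply: eq_bigr => j _; rewrite !mxE.
pose x := (\row_i L (row i A)) *m invmx G.
exists (x *m A); first exact: lin_subset_mulmx.
apply: (solve_basis A1) => i; rewrite (lin_mulmx _ _ (Bl _)).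
have /rowP /(_ i) : x *m G = \row_i L (row i A) by rewrite mulmxKV.
rewrite mxE [X in _ = X -> _]mxE => <-; apply: eq_bigr => j _.
by rewrite [G _ _]mxE.
Qed.

End Subspaces.

Section SpaceTimeSplines.
Context (R : realType) (d m q : nat) (Xi : 'I_d -> seq R).
Hypotheses (q0 : (0 < q)%N) (Xi_m : forall k, (size (Xi k) <= m)%N).
Context (qt : nat) (Th brt : seq R).
Hypotheses (brt2 : (2 <= size brt)%N) (brt_lt : sorted (fun a b : R => a < b) brt)
  (brt0 : head 0 brt = 0) (brt1 : last 0 brt = 1)
  (ThE : Th = nseq qt 0 ++ brt ++ nseq qt 1) (qt0 : (0 < qt)%N).
Context (T : R) (T0 : 0 < T).
Notation MI := {ffun 'I_d -> 'I_m}.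
Notation nB := (size Th - qt.+1)%N.
Notation K := #|{: MI * 'I_nB}|.
Notation cf c p := ((c : 'rV[R]_K) 0 (enum_rank p)).
Notation ts := (tspline q Xi).
Implicit Types (c e : 'rV[R]_K).

Definition slice_coef (b : 'I_nB -> R) c (I : MI) : R := \sum_j cf c (I, j) * b j.
Definition tslice c (tau : R) : MI -> R := slice_coef (fun j => bspline Th qt j tau) c.
Definition stspline c (z : 'rV[R]_d) tau : R := ts (tslice c tau) z.

Lemma slice_coef_lin b a c e I : slice_coef b (a *: c + e) I = a * slice_coef b c I + slice_coef b e I.
Proof.
rewrite /slice_coef mulr_sumr -big_split /=; apply: eq_bigr => j _.
by rewrite !mxE mulrDl mulrA.
Qed.

Lemma tspline_lin a (c c' : MI -> R) z : ts (fun I => a * c I + c' I) z = a * ts c z + ts c' z.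
Proof. by rewrite -tsplineZ -tsplineD. Qed.

Lemma stspline_lin a c e z tau : stspline (a *: c + e) z tau = a * stspline c z tau + stspline e z tau.
Proof.
rewrite /stspline -tspline_lin; congr (ts _ z); apply/funext => I.
exact: slice_coef_lin.
Qed.

Lemma stspline0 z tau : stspline 0 z tau = 0.
Proof.
have := stspline_lin 1 0 0 z tau; rewrite scaler0 addr0 mul1r => /eqP.
by rewrite -subr_eq0 opprD addNKr oppr_eq0 => /eqP.
Qed.

Lemma stsplineE c z tau : stspline c z tau =
  \sum_p cf c p * (bspline_space Xi q (fun k => (p.1 : MI) k) z * bspline Th qt p.2 tau).
Proof.
rewrite /stspline /tspline /tslice /slice_coef.
under eq_bigr do rewrite mulr_suml.
rewrite pair_big /=; apply: eq_bigr => -[I j] _ /=.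
by rewrite -!mulrA [_ * bspline_space _ _ _ _]mulrC.
Qed.

Lemma stspline_space c : spline_spacetime Xi q Th qt (stspline c).
Proof.
exists [seq (((fun k => nat_of_ord ((p.1 : MI) k)), nat_of_ord p.2), cf c p) | p <- index_enum _] => z tau.
rewrite big_map stsplineE; apply: eq_bigr => p _ /=.
by rewrite mulrA.
Qed.

Lemma spline_spacetime_coef g : spline_spacetime Xi q Th qt g -> exists c, forall z tau, g z tau = stspline c z tau.
Proof.
move=> [s gE]; suff [c cE] : exists c, forall z tau, \sum_(p <- s)
    p.2 * bspline_space Xi q p.1.1 z * bspline Th qt p.1.2 tau = stspline c z tau.
  by exists c => z tau; rewrite gE cE.
elim: {gE} s => [|[[J j] a] s [c cE]].
  by exists 0 => z tau; rewrite big_nil stspline0.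
have [c' c'E] := bspline_coef q0 Xi_m J.
pose e : 'rV[R]_K := \row_i (a * c' (enum_val i).1 * (nat_of_ord (enum_val i).2 == j)%:R).
exists (1 *: e + c) => z tau; rewrite big_cons /= stspline_lin cE mul1r; congr (_ + _).
rewrite c'E /stspline /tspline mulr_sumr mulr_suml; apply: eq_bigr => I _.
rewrite /tslice /slice_coef; set B := bspline_space _ _ _ _.
under eq_bigr do rewrite mxE enum_rankK /=.
have [jn|nj] := ltnP j nB.
  rewrite (bigD1 (Ordinal jn)) //= eqxx /= mulr1 [X in _ = (_ + X) * _]big1 => [|i ij]; first by ring.
  rewrite (_ : (nat_of_ord i == j) = false) ?mulr0 ?mul0r //.
  by apply/negbTE; apply: contraNneq ij => ij; apply/eqP/val_inj.
have -> : bspline Th qt j tau = 0 by rewrite /bspline ltnNge nj.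
rewrite mulr0 big1 ?mul0r // => i _.
by rewrite (_ : (nat_of_ord i == j) = false) ?mulr0 ?mul0r //; apply/negbTE; rewrite neq_ltn (leq_trans (ltn_ord i) nj).
Qed.

Definition trial_coefs : set 'rV[R]_K := [set c |
  (forall z tau, cube_boundary d z -> 0 < tau < 1 -> stspline c z tau = 0) /\
  (forall z, open_cube d z -> stspline c z 0 = 0)].

(** Nonzero vectors may occur here, because surplus spatial indices carry zero B-splines. *)
Definition null_coefs : set 'rV[R]_K := [set c |
  forall z tau, open_cube d z -> 0 < tau < 1 -> stspline c z tau = 0].

Lemma lin_subset_trial : lin_subset trial_coefs.
Proof.
split; first by rewrite /trial_coefs /=; split=> [z tau _ _|z _]; rewrite stspline0.
move=> a c e [c1 c2] [e1 e2]; split=> [z tau zb tr|z zc]; rewrite stspline_lin.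
  by rewrite c1 // e1 // mulr0 addr0.
by rewrite c2 // e2 // mulr0 addr0.
Qed.

Lemma lin_subset_null : lin_subset null_coefs.
Proof.
split; first by rewrite /null_coefs /= => z tau _ _; rewrite stspline0.
move=> a c e H1 H2 z tau zc tr; rewrite stspline_lin H1 // H2 // mulr0 addr0 //.
Qed.

Definition brT : seq R := [seq x * T | x <- brt].
Definition bT (j : nat) (t : R) : R := bspline Th qt j (t / T).

Lemma size_brT : size brT = size brt. Proof. by rewrite size_map. Qed.

Lemma brT_nth i : brT`_i = brt`_i * T.
Proof.
have [h|h] := ltnP i (size brt); first by rewrite (nth_map 0).
by rewrite !nth_default ?size_brT // mul0r.
Qed.

Lemma brT2 : (2 <= size brT)%N. Proof. by rewrite size_brT. Qed.

Lemma brT_lt i j : (i < j)%N -> (j < size brT)%N -> brT`_i < brT`_j.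
Proof. by rewrite size_brT !brT_nth ltr_pM2r // => ij js; exact: breaks_lt. Qed.

Lemma brT_lo : brT`_0 = 0.
Proof. by rewrite brT_nth nth0 brt0 mul0r. Qed.

Lemma brT_hi : brT`_(size brT).-1 = T.
Proof. by rewrite brT_nth size_brT nth_last brt1 mul1r. Qed.

Lemma oeT_itv t : open_elems brT t -> 0 < t < T.
Proof. by move=> [+ _]; rewrite brT_lo brT_hi. Qed.

Lemma scaled_time t : 0 < t < T -> 0 < t / T < 1.
Proof. by move=> /andP[t0 tT]; rewrite divr_gt0 // ltr_pdivrMr // mul1r. Qed.

Lemma oeT_scaled t : open_elems brT t <-> open_elems brt (t / T).
Proof.
rewrite /open_elems /= brT_lo brT_hi nth0 brt0 nth_last brt1 ltr_pdivrMr // mul1r pmulr_lgt0 ?invr_gt0 //.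
split=> -[h1 h2]; split => //; apply: contra h2.
  by move=> h; apply/mapP; exists (t / T) => //; rewrite divfK // gt_eqF.
by move=> /mapP[x xb ->]; rewrite mulfK // gt_eqF.
Qed.

Lemma pw_poly_rescale (b : R -> R) : pw_poly brt b -> pw_poly brT (fun t => b (t / T)).
Proof.
move=> H j; rewrite size_brT => js; have [p bp] := H j js.
exists (p \Po (T^-1 *: 'X)) => x; rewrite !brT_nth => /andP[h1 h2].
rewrite horner_comp hornerZ hornerX [T^-1 * x]mulrC bp //.
by rewrite ler_pdivlMr // ler_pdivrMr // h1 h2.
Qed.

Lemma bT_pw_poly j : pw_poly brT (bT j).
Proof. by apply: pw_poly_rescale; exact: (bspline_pw_poly brt2 brt_lt brt0 brt1 ThE). Qed.

(** Rescaling time multiplies a truncated power by a power of [T], so the span property carries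
    over. *)
Lemma bT_tfam_span i : (i < nB)%N -> exists c : 'I_nB -> R,
  forall t, open_elems brT t -> tfam qt brT i t = \sum_j c j * bT j t.
Proof.
move=> iB; have [c cE] := tfam_span brt2 brt_lt brt0 brt1 ThE iB.
have scale k xi t : tpow k (xi * T) t = T ^+ k * tpow k xi (t / T).
  rewrite /tpow ltr_pdivlMr //; case: ifP => _; last by rewrite mulr0.
  rewrite mulrA -exprMn mulrBr [T * (t / T)]mulrC divfK ?gt_eqF // [T * xi]mulrC //.
exists (fun j => T ^+ (if (i <= qt)%N then i else qt) * c j) => t /oeT_scaled /cE.
move=> E; under eq_bigr do rewrite -mulrA; rewrite -mulr_sumr -E /tfam.
by case: ifP => _; rewrite !brT_nth scale.
Qed.

Definition tslice_deriv c (t : R) : MI -> R := slice_coef (fun j => derive1 (bT j) t) c.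

Lemma stspline_deriv c z t : open_elems brT t ->
  is_derive t (1 : R) (fun s => stspline c z (s / T)) (ts (tslice_deriv c t) z).
Proof.
move=> to; rewrite (_ : (fun s => _) = fun s => \sum_I (\sum_j cf c (I, j) * bT j s) * bspline_space Xi q (fun k => (I : MI) k) z) //.
apply: sum_is_derive => I.
have D := sum_is_derive (index_enum _) (fun j : 'I_nB => is_deriveZ (cf c (I, j)) (pw_poly_is_derive brT2 (@bT_pw_poly j) to)).
have := is_deriveZ (bspline_space Xi q (fun k => (I : MI) k) z) D.
move/is_derive_eq => H; rewrite (_ : (fun h : R => _) = bspline_space Xi q (fun k => (I : MI) k) z \*: (fun s => \sum_j (cf c (I, j) \*: bT j) s)); last first.
  by apply/funext => h; rewrite /= /GRing.scale /= mulrC.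
by apply: H; rewrite /GRing.scale /= mulrC.
Qed.

End SpaceTimeSplines.

Lemma Rintegral_lincomb d (X : measurableType d) (R : realType) (m : {measure set X -> \bar R})
    (I : Type) (s : seq I) (c : I -> R) (g : I -> X -> R) :
  (forall i, m.-integrable setT (EFin \o g i)) ->
  \int[m]_x (\sum_(i <- s) c i * g i x) = \sum_(i <- s) c i * \int[m]_x g i x.
Proof.
move=> H; rewrite (@Rintegral_sum R _ X m I s (fun i x => c i * g i x)); last by move=> i; exact: integrableZlR.
by apply: eq_bigr => i _; rewrite RintegralZl.
Qed.

(** * The discrete forms and the integrals they represent *)

Section Forms.
Context (R : realType) (d m q : nat) (Xi br : 'I_d -> seq R).
Hypotheses (br2 : forall k, (2 <= size (br k))%N)
  (br_lt : forall k, sorted (fun a b : R => a < b) (br k))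
  (br0 : forall k, head 0 (br k) = 0) (br1 : forall k, last 0 (br k) = 1)
  (XiE : forall k, Xi k = nseq q 0 ++ br k ++ nseq q 1) (q0 : (0 < q)%N)
  (Xi_m : forall k, (size (Xi k) <= m)%N).
Context (F Finv : 'rV[R]_d -> 'rV[R]_d) (Om : set 'rV[R]_d).
Hypotheses (FS : forall k, spline_space Xi q (fun z => F z 0 k))
  (FOm : F @` open_cube d = Om) (FinvK : forall z, open_cube d z -> Finv (F z) = z)
  (Finv_bd : forall J, bounded_derivatives_on Finv (F @` mesh_elem Xi J)) (Om_open : open Om).
Notation rvec n := (g_sigma_algebraType (@open 'rV[R]_n)).
Notation MI := {ffun 'I_d -> 'I_m}.
Hypothesis Om_bd : exists C, forall x, Om x -> `|x| <= C.
Context (qt : nat) (Th brt : seq R).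
Hypotheses (brt2 : (2 <= size brt)%N) (brt_lt : sorted (fun a b : R => a < b) brt)
  (brt0 : head 0 brt = 0) (brt1 : last 0 brt = 1)
  (ThE : Th = nseq qt 0 ++ brt ++ nseq qt 1) (qt0 : (0 < qt)%N).
Context (T : R) (T0 : 0 < T).
Notation mu := (row_measure R d).
Notation leb := (@lebesgue_measure R).
Notation mesh := (mesh_pts br).
Notation ts := (tspline q Xi).
Notation W := (wfun q Xi Finv Om).
Notation G := (pgrad q Xi br F Finv Om).
Notation dlt I := (fun J : MI => (J == I)%:R : R).
Notation nB := (size Th - qt.+1)%N.
Notation K := #|{: MI * 'I_nB}|.
Notation cf c p := ((c : 'rV[R]_K) 0 (enum_rank p)).
Notation bt := (bT qt Th T).
Notation oe := (open_elems (brT brt T)).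
Notation oe_int f := (\int[leb]_x (\1_oe x * f x)).
Notation sts := (stspline q Xi (qt := qt) (Th := Th)).
Notation tsl := (tslice (m := m) (qt := qt) (Th := Th)).
Notation tsd := (tslice_deriv (d := d) (m := m) (qt := qt) (Th := Th) T).
Implicit Types (c e : 'rV[R]_K) (z : 'rV[R]_d).

Let meshc z : mesh z -> open_cube d z. Proof. exact: mesh_open_cube. Qed.
Let brTl : forall i j, (i < j)%N -> (j < size (brT brt T))%N -> (brT brt T)`_i < (brT brt T)`_j.
Proof. exact: brT_lt. Qed.
Let brT2' : (2 <= size (brT brt T))%N. Proof. exact: brT2. Qed.
Let btpw j : pw_poly (brT brt T) (bt j).
Proof. exact: (bT_pw_poly brt2 brt_lt brt0 brt1 ThE qt0 T0). Qed.
Let mW (f : MI -> R) : measurable_fun setT (W f).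
Proof. exact: (measurable_wfun br2 br_lt br0 br1 XiE q0 Xi_m FS FOm FinvK Om_open). Qed.
Let mG (f : MI -> R) k : measurable_fun setT (G f k).
Proof. exact: (measurable_pgrad br2 br_lt br0 br1 XiE q0 Xi_m FS FOm FinvK Finv_bd Om_open). Qed.
Let Goff (f : MI -> R) k (x : rvec d) : ~ Om x -> G f k x = 0.
Proof. by move=> xO; apply: pgrad_off => /(Fmesh_Om br0 br1 FOm). Qed.

Lemma bounded_Om_integrable (g : rvec d -> R) : measurable_fun setT g ->
  (exists C, forall x, `|g x| <= C) -> (forall x, ~ Om x -> g x = 0) -> mu.-integrable setT (EFin \o g).
Proof.
move=> mg [C gC] g0; have [B OB] := Om_bd.
apply: (bounded_row_integrable (C := C) (r := B + 1)) => // x gx i.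
have xO : Om x by apply: contrapT => /g0 h; rewrite h eqxx in gx.
by apply: le_lt_trans (coord_le_norm _ _) _; apply: le_lt_trans (OB _ xO) _; rewrite ltrDl.
Qed.

Let bdM (g h : rvec d -> R) : (exists C, forall x, `|g x| <= C) -> (exists C, forall x, `|h x| <= C) ->
  exists C, forall x, `|g x * h x| <= C.
Proof.
move=> [C gC] [C' hC]; exists (C * C') => x; rewrite normrM ler_pM //.
Qed.

Let bW (f : MI -> R) : exists C, forall x, `|W f x| <= C.
Proof. exact: (wfun_bounded br2 br_lt br0 br1 XiE q0 FOm FinvK). Qed.

Let bG (f : MI -> R) k : exists C, forall x, `|G f k x| <= C.
Proof. exact: (pgrad_bounded br2 br_lt br0 br1 XiE q0 Xi_m FOm FinvK Finv_bd Om_open). Qed.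

Lemma wfun_integrable (f : MI -> R) : mu.-integrable setT (EFin \o W f).
Proof. by apply: bounded_Om_integrable => //; exact: wfun_off. Qed.

Lemma wfunM_integrable (f g : MI -> R) : mu.-integrable setT (EFin \o (fun x => W f x * W g x)).
Proof.
apply: bounded_Om_integrable; [exact: measurable_funM | exact: bdM |].
by move=> x xO; rewrite wfun_off ?mul0r.
Qed.

Lemma pgradM_integrable (f g : MI -> R) : mu.-integrable setT (EFin \o (fun x => \sum_k G f k x * G g k x)).
Proof.
apply: integrable_sumR => k; apply: bounded_Om_integrable; [exact: measurable_funM | exact: bdM |].
by move=> x xO; rewrite Goff ?mul0r.
Qed.

Definition massc I I' := \int[mu]_x (W (dlt I) x * W (dlt I') x).
Definition stiffc I I' := \int[mu]_x (\sum_k G (dlt I) k x * G (dlt I') k x).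
Definition meanc I := \int[mu]_x W (dlt I) x.

Lemma mass_sum (f g : MI -> R) : \int[mu]_x (W f x * W g x) = \sum_I f I * \sum_I' g I' * massc I I'.
Proof.
transitivity (\int[mu]_x (\sum_(p : MI * MI) (f p.1 * g p.2) * (W (dlt p.1) x * W (dlt p.2) x))).
  apply: eq_Rintegral => x _; rewrite wfun_sum [X in _ * X]wfun_sum mulr_suml.
  under eq_bigr do rewrite mulr_sumr.
  by rewrite pair_big /=; apply: eq_bigr => p _; rewrite mulrACA.
rewrite Rintegral_lincomb; last by move=> p; exact: wfunM_integrable.
under [RHS]eq_bigr do rewrite mulr_sumr.
by rewrite pair_big /=; apply: eq_bigr => p _; rewrite mulrA.
Qed.

Lemma stiff_sum (f g : MI -> R) : \int[mu]_x (\sum_k G f k x * G g k x) = \sum_I f I * \sum_I' g I' * stiffc I I'.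
Proof.
transitivity (\int[mu]_x (\sum_(p : MI * MI) (f p.1 * g p.2) * (\sum_k G (dlt p.1) k x * G (dlt p.2) k x))).
  apply: eq_Rintegral => x _.
  rewrite (eq_bigr (fun k => \sum_(p : MI * MI) (f p.1 * g p.2) * (G (dlt p.1) k x * G (dlt p.2) k x))).
    by rewrite exchange_big /=; apply: eq_bigr => p _; rewrite mulr_sumr.
  move=> k _; rewrite pgrad_sum // [X in _ * X]pgrad_sum // mulr_suml.
  under eq_bigr do rewrite mulr_sumr.
  by rewrite pair_big /=; apply: eq_bigr => p _; rewrite mulrACA.
rewrite Rintegral_lincomb; last by move=> p; exact: pgradM_integrable.
under [RHS]eq_bigr do rewrite mulr_sumr.
by rewrite pair_big /=; apply: eq_bigr => p _; rewrite mulrA.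
Qed.

Lemma mean_sum (f : MI -> R) : \int[mu]_x W f x = \sum_I f I * meanc I.
Proof.
rewrite -Rintegral_lincomb; last by move=> I; exact: wfun_integrable.
by apply: eq_Rintegral => x _; rewrite wfun_sum.
Qed.

Lemma slice_sum (b : 'I_nB -> R) c (X : MI -> R) :
  \sum_I slice_coef b c I * X I = \sum_p cf c p * (b p.2 * X p.1).
Proof.
under eq_bigr do rewrite mulr_suml.
by rewrite pair_big /=; apply: eq_bigr => -[I j] _; rewrite mulrA.
Qed.

Lemma slice_sum2 (b b' : 'I_nB -> R) c e (X : MI -> MI -> R) :
  \sum_I slice_coef b c I * \sum_I' slice_coef b' e I' * X I I' =
  \sum_p cf c p * \sum_p' cf e p' * (X p.1 p'.1 * (b p.2 * b' p'.2)).
Proof.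
rewrite slice_sum; apply: eq_bigr => p _; congr (_ * _).
rewrite slice_sum mulr_sumr; apply: eq_bigr => p' _; ring.
Qed.

(** Derivatives are known at mesh points only; the rest of [Om] is null, and outside [Om] both
    integrands are 0. *)
Lemma int_Omega_mesh (g : 'rV[R]_d -> R) (h : rvec d -> R) : mu.-integrable setT (EFin \o h) ->
  (forall z, mesh z -> g (F z) = h (F z)) -> (forall x, ~ Om x -> h x = 0) ->
  int_Omega Om g = \int[mu]_x h x.
Proof.
move=> hi gh h0; apply: iintE => //.
apply: (negligibleS _ (skeleton_negligible br2 br_lt br0 br1 XiE q0 Xi_m FS FOm)).
move=> x /= ne; have [xO|xO] := pselect (Om x); last first.
  by case: ne; rewrite indicE memNset // mul0r h0.
split=> // -[z zm zx]; apply: ne.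
by rewrite indicE mem_set // mul1r -zx gh.
Qed.

Lemma int_Q_open_elems (g : 'rV[R]_d -> R -> R) (h : R -> R) : (forall t, oe t -> int_Omega Om (fun x => g x t) = h t) ->
  int_Q Om T g = oe_int h.
Proof.
move=> gh; rewrite /int_Q Rintegral_mkcond; apply: Rintegral_off_null.
have N := open_elems_conull (brT brt T).
rewrite brT_lo // brT_hi // in N.
apply: (negligibleS _ N) => t /= [_ ne].
have [to|to] := pselect (oe t).
  case: ne; rewrite patchE indicE (mem_set to) mul1r ifT ?gh //.
  by rewrite inE /= in_itv /=; apply: (oeT_itv brt0 brt1).
have [tT|tT] := boolP (0 < t < T); first by split.
case: ne; rewrite patchE indicE (memNset to) mul0r ifF //.
by apply/negbTE; rewrite notin_setE /= in_itv /=; exact/negP.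
Qed.

(** Membership in [Vh] constrains a function only inside the cylinder; there, this relation ties it
    to a coefficient vector. *)
Definition reps (u : 'rV[R]_d -> R -> R) c := forall z tau, open_cube d z -> 0 < tau < 1 ->
  u (F z) (T * tau) = sts c z tau.

Let Tt (t : R) : T * (t / T) = t. Proof. by rewrite mulrC divfK // gt_eqF. Qed.

Lemma reps_slice u c t z : reps u c -> 0 < t < T -> open_cube d z -> u (F z) t = ts (tsl c (t / T)) z.
Proof.
move=> uc tT zc; have := uc z (t / T) zc; rewrite Tt => -> //.
exact: scaled_time.
Qed.

Lemma reps_dt u c t z : reps u c -> oe t -> open_cube d z -> dt u (F z) t = ts (tsd c t) z.
Proof.
move=> uc to zc.
have D := stspline_deriv q Xi brt2 brt_lt brt0 brt1 ThE qt0 T0 c z to.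
have E : \forall s \near t, sts c z (s / T) = u (F z) s.
  have : nbhs t oe by apply: open_nbhs_nbhs; split => //; exact: open_elems_open.
  apply: filterS => s so; rewrite (reps_slice uc) //; exact: (oeT_itv brt0 brt1).
by have [_ H] := near_eq_is_derive E D; rewrite /dt derive1E.
Qed.

Lemma reps_dx u c t z k : reps u c -> oe t -> mesh z -> dx u k (F z) t = G (tsl c (t / T)) k (F z).
Proof.
move=> uc to zm; have tT := oeT_itv brt0 brt1 to.
have [_ H] := pull_is_derive br2 br_lt br0 br1 XiE q0 Xi_m FOm FinvK Finv_bd Om_open (u := fun y => u y t) k
  (fun z zc => reps_slice uc tT zc) zm.
by rewrite /dx H (pgradE br2 br_lt br0 br1 XiE q0 Xi_m FOm FinvK Finv_bd Om_open).
Qed.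

Let wE (f : MI -> R) z : open_cube d z -> W f (F z) = ts f z.
Proof. exact: wfunE. Qed.

Definition time_form c e :=
  \sum_p cf c p * \sum_p' cf e p' * (massc p.1 p'.1 * oe_int (fun t => derive1 (bt p.2) t * bt p'.2 t)).

Let op_bt j : open_poly (brT brt T) (bt j).
Proof. exact: pw_poly_open_poly. Qed.
Let op_dbt j : open_poly (brT brt T) (derive1 (bt j)).
Proof. exact: pw_poly_derive1_open_poly. Qed.

Lemma oe_int_bilin (X : R -> 'I_nB -> 'I_nB -> R) (Y : MI -> MI -> R) c e :
  (forall j j', leb.-integrable setT (EFin \o (fun t => \1_oe t * X t j j'))) ->
  oe_int (fun t => \sum_p cf c p * \sum_p' cf e p' * (Y p.1 p'.1 * X t p.2 p'.2)) =
  \sum_p cf c p * \sum_p' cf e p' * (Y p.1 p'.1 * oe_int (fun t => X t p.2 p'.2)).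
Proof.
move=> H; transitivity (\int[leb]_t (\sum_(s : (MI * 'I_nB) * (MI * 'I_nB))
    (cf c s.1 * (cf e s.2 * Y s.1.1 s.2.1)) * (\1_oe t * X t s.1.2 s.2.2))).
  apply: eq_Rintegral => t _; rewrite mulr_sumr.
  under eq_bigr do rewrite mulr_sumr mulr_sumr.
  by rewrite pair_big /=; apply: eq_bigr => s _; ring.
rewrite Rintegral_lincomb //; under [RHS]eq_bigr do rewrite mulr_sumr.
by rewrite pair_big /=; apply: eq_bigr => s _; rewrite -!mulrA.
Qed.

Lemma int_Q_dt u v c e : reps u c -> reps v e ->
  int_Q Om T (fun x t => dt u x t * v x t) = time_form c e.
Proof.
move=> uc ve.
rewrite (int_Q_open_elems (h := fun t => \sum_p cf c p * \sum_p' cf e p' * (massc p.1 p'.1 *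
   (derive1 (bt p.2) t * bt p'.2 t)))); last first.
  move=> t to; rewrite (int_Omega_mesh (h := fun x => W (tsd c t) x * W (tsl e (t / T)) x)).
  - by rewrite mass_sum slice_sum2.
  - exact: wfunM_integrable.
  - move=> z /meshc zc; rewrite !wE // (reps_dt uc) // (reps_slice ve) //; exact: (oeT_itv brt0 brt1).
  - by move=> x xO; rewrite wfun_off ?mul0r.
apply: (@oe_int_bilin (fun t j j' => derive1 (bt j) t * bt j' t) massc) => j j'; apply: open_poly_integrable => //.
by apply: open_polyM.
Qed.

End Forms.

Lemma Rintegral_ge0_eq0 d (X : measurableType d) (R : realType) (m : {measure set X -> \bar R}) (f : X -> R) :
  m.-integrable setT (EFin \o f) -> (forall x, 0 <= f x) -> \int[m]_x f x = 0 ->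
  m.-negligible [set x | f x <> 0].
Proof.
move=> fi f0 I0; have mf := measurable_int _ fi.
have E0 : (\int[m]_x `|(EFin \o f) x|)%E = 0%E.
  rewrite (eq_integral (EFin \o f)) => [|x _]; last by rewrite gee0_abs // lee_fin.
  by rewrite -[LHS]fineK ?integrable_fin_num // -/(Rintegral m setT f) I0.
have := (ae_eq_integral_abs m measurableT mf).1 E0.
apply: negligibleS => x /= fx h; apply: fx.
by have := h I => -[].
Qed.

Lemma lipschitz_continuous (R : realType) (f : R -> R) (L : R) : 0 <= L ->
  (forall x y, `|f x - f y| <= L * `|x - y|) -> continuous f.
Proof.
move=> L0 fL x; apply/cvgrPdist_lt => e e0.
have L1 : 0 < L + 1 by rewrite ltr_wpDl.
have : \forall y \near x, `|x - y| < e / (L + 1).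
  by apply: (@cvgr_dist_lt _ _ _ (nbhs x) _ id) => //; rewrite divr_gt0.
apply: filterS => y xy; apply: le_lt_trans (fL x y) _.
apply: (@le_lt_trans _ _ ((L + 1) * `|x - y|)); first by rewrite ler_wpM2r // lerDl.
by rewrite mulrC -ltr_pdivlMr.
Qed.

Lemma bounded_mul_integrable d (X : measurableType d) (R : realType) (m : {measure set X -> \bar R})
    (h g : X -> R) (C : R) : measurable_fun setT h -> (forall x, `|h x| <= C) ->
  m.-integrable setT (EFin \o g) -> m.-integrable setT (EFin \o (fun x => h x * g x)).
Proof.
move=> mh hC gi; have mg : measurable_fun setT g by exact/measurable_EFinP/(measurable_int _ gi).
have Ci := integrableZlR `|C| gi.
apply: (le_integrable measurableT _ _ Ci).
  by apply/measurable_EFinP; exact: measurable_funM.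
move=> x _ /=; rewrite lee_fin !normrM normr_id ler_wpM2r //.
by apply: le_trans (hC x) (ler_norm _).
Qed.

Lemma pw_poly_deriv_pair (R : realType) (br : seq R) (b : R -> R) : pw_poly br b ->
  pw_deriv_pair br b (derive1 b).
Proof.
move=> H j js; have [p bp] := H j js; exists p; split=> // x xj.
by have [_ ->] := pw_poly_derive1 js bp xj.
Qed.

(** * The nonlinear form and its continuity *)

Section Coercivity.
Context (R : realType) (d m q : nat) (Xi br : 'I_d -> seq R).
Hypotheses (br2 : forall k, (2 <= size (br k))%N)
  (br_lt : forall k, sorted (fun a b : R => a < b) (br k))
  (br0 : forall k, head 0 (br k) = 0) (br1 : forall k, last 0 (br k) = 1)
  (XiE : forall k, Xi k = nseq q 0 ++ br k ++ nseq q 1) (q0 : (0 < q)%N)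
  (Xi_m : forall k, (size (Xi k) <= m)%N).
Context (F Finv : 'rV[R]_d -> 'rV[R]_d) (Om : set 'rV[R]_d).
Hypotheses (FS : forall k, spline_space Xi q (fun z => F z 0 k))
  (FOm : F @` open_cube d = Om) (FinvK : forall z, open_cube d z -> Finv (F z) = z)
  (Finv_bd : forall J, bounded_derivatives_on Finv (F @` mesh_elem Xi J)) (Om_open : open Om).
Notation rvec n := (g_sigma_algebraType (@open 'rV[R]_n)).
Notation MI := {ffun 'I_d -> 'I_m}.
Hypothesis Om_bd : exists C, forall x, Om x -> `|x| <= C.
Context (qt : nat) (Th brt : seq R).
Hypotheses (brt2 : (2 <= size brt)%N) (brt_lt : sorted (fun a b : R => a < b) brt)
  (brt0 : head 0 brt = 0) (brt1 : last 0 brt = 1)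
  (ThE : Th = nseq qt 0 ++ brt ++ nseq qt 1) (qt0 : (0 < qt)%N).
Context (T : R) (T0 : 0 < T).
Notation mu := (row_measure R d).
Notation leb := (@lebesgue_measure R).
Notation mesh := (mesh_pts br).
Notation ts := (tspline q Xi).
Notation W := (wfun q Xi Finv Om).
Notation G := (pgrad q Xi br F Finv Om).
Notation nB := (size Th - qt.+1)%N.
Notation K := #|{: MI * 'I_nB}|.
Notation cf c p := ((c : 'rV[R]_K) 0 (enum_rank p)).
Notation bt := (bT qt Th T).
Notation oe := (open_elems (brT brt T)).
Notation oe_int f := (\int[leb]_x (\1_oe x * f x)).
Notation sts := (stspline q Xi (qt := qt) (Th := Th)).
Notation tsl := (tslice (m := m) (qt := qt) (Th := Th)).
Implicit Types (c e : 'rV[R]_K) (z : 'rV[R]_d).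
Notation stiffc := (stiffc q Xi br F Finv Om).
Notation meanc := (meanc q Xi Finv Om).
Notation time_form := (time_form q Xi Finv Om brt T (qt := qt) (Th := Th)).
Notation reps := (reps q Xi F T (qt := qt) (Th := Th)).
Notation S0 := (null_coefs (m := m) (qt := qt) (Th := Th) q Xi).
Let meshc z : mesh z -> open_cube d z. Proof. exact: mesh_open_cube. Qed.
Let brTl : forall i j, (i < j)%N -> (j < size (brT brt T))%N -> (brT brt T)`_i < (brT brt T)`_j.
Proof. exact: brT_lt. Qed.
Let brT2' : (2 <= size (brT brt T))%N. Proof. exact: brT2. Qed.
Let btpw j : pw_poly (brT brt T) (bt j).
Proof. exact: (bT_pw_poly brt2 brt_lt brt0 brt1 ThE qt0 T0). Qed.
Let mW (f : MI -> R) : measurable_fun setT (W f).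
Proof. exact: (measurable_wfun br2 br_lt br0 br1 XiE q0 Xi_m FS FOm FinvK Om_open). Qed.
Let mG (f : MI -> R) k : measurable_fun setT (G f k).
Proof. exact: (measurable_pgrad br2 br_lt br0 br1 XiE q0 Xi_m FS FOm FinvK Finv_bd Om_open). Qed.
Let Goff (f : MI -> R) k (x : rvec d) : ~ Om x -> G f k x = 0.
Proof. by move=> xO; apply: pgrad_off => /(Fmesh_Om br0 br1 FOm). Qed.

Let wE (f : MI -> R) z : open_cube d z -> W f (F z) = ts f z.
Proof. exact: wfunE. Qed.

Let op_bt j : open_poly (brT brt T) (bt j).
Proof. exact: pw_poly_open_poly. Qed.
Let op_dbt j : open_poly (brT brt T) (derive1 (bt j)).
Proof. exact: pw_poly_derive1_open_poly. Qed.

Context (a : R -> R) (am aM La : R) (am0 : 0 < am) (a_bd : forall s, am <= a s <= aM)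
  (La0 : 0 <= La) (a_lip : forall s s', `|a s - a s'| <= La * `|s - s'|).

(** Agrees with [bT] between 0 and [T] but is bounded and Lipschitz on the whole line, which makes
    [diffusivity] continuous there. *)
Definition clamped_basis (j : nat) (t : R) := bspline Th qt j (clamp01 (t / T)).
Notation bc := clamped_basis.

Let brt01 : brt`_0 = 0 /\ brt`_(size brt).-1 = 1.
Proof. by rewrite nth0 nth_last. Qed.

Let bspw j : pw_poly brt (bspline Th qt j).
Proof. exact: (bspline_pw_poly brt2 brt_lt brt0 brt1 ThE). Qed.

Lemma clamped_basis_lip j : exists2 L, 0 <= L & forall x y, `|bc j x - bc j y| <= L * `|x - y|.
Proof.
have [L L0] := pw_poly_lipschitz brt2 (@bspw j); rewrite !(brt01.1, brt01.2) => HL.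
exists (L * T^-1); first by rewrite mulr_ge0 // invr_ge0 ltW.
move=> x y; apply: le_trans (HL _ _ (clamp01_in _) (clamp01_in _)) _.
rewrite -mulrA ler_wpM2l //; apply: le_trans (clamp01_lip _ _) _.
by rewrite -mulrBl normrM [`|T^-1|]gtr0_norm ?invr_gt0 // mulrC.
Qed.

Lemma clamped_basis_bounded j : exists C, forall t, `|bc j t| <= C.
Proof.
have [L L0] := pw_poly_lipschitz brt2 (@bspw j); rewrite !(brt01.1, brt01.2) => HL.
exists (L + `|bspline Th qt j 0|) => t; have c01 := clamp01_in (t / T).
have h := HL _ 0 c01; rewrite lexx ler01 subr0 in h.
rewrite -[bc j t](subrK (bspline Th qt j 0)); apply: le_trans (ler_normD _ _) _.
rewrite lerD2r; apply: le_trans (h isT) _; case/andP: c01 => h1 h2.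
by rewrite ger0_norm // ler_piMr.
Qed.

Lemma clamped_basis_id j t : 0 < t < T -> bc j t = bt j t.
Proof.
move=> /(scaled_time T0) /andP[h1 h2]; rewrite /clamped_basis clamp01_id //.
by rewrite !ltW.
Qed.

Definition mean_at c t := \sum_p cf c p * (bc p.2 t * meanc p.1).
Definition diffusivity c t := a (mean_at c t).

Lemma measurable_diffusivity c : measurable_fun setT (diffusivity c : measurableTypeR R -> R).
Proof.
suff : continuous (diffusivity c) by exact: continuous_measurable_fun.
move=> t; apply: (@continuous_comp _ _ _ (mean_at c) a); last exact: (lipschitz_continuous La0 a_lip).
apply: continuous_sum_at => p; apply: continuousM; first exact: cst_continuous.
apply: continuousM; last exact: cst_continuous.
by have [L L0 HL] := clamped_basis_lip p.2; exact: (lipschitz_continuous L0 HL).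
Qed.

Lemma diffusivity_bounded c t : `|diffusivity c t| <= aM.
Proof.
have /andP[h1 h2] := a_bd (mean_at c t).
by rewrite ger0_norm //; apply: le_trans h1; exact: ltW.
Qed.

Let bb_int j j' : leb.-integrable setT (EFin \o (fun t => \1_oe t * (bt j t * bt j' t))).
Proof. by apply: open_poly_integrable => //; exact: open_polyM. Qed.

Let abb_int c j j' : leb.-integrable setT (EFin \o (fun t => \1_oe t * (diffusivity c t * (bt j t * bt j' t)))).
Proof.
under eq_fun do rewrite mulrCA.
exact: (bounded_mul_integrable (measurable_diffusivity c) (diffusivity_bounded c) (bb_int j j')).
Qed.

Definition diff_weight c j j' := oe_int (fun t => diffusivity c t * (bt j t * bt j' t)).
Definition grad_form c e :=
  \sum_p cf c p * \sum_p' cf e p' * (stiffc p.1 p'.1 * diff_weight c p.2 p'.2).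

Let dx_E u c t z k := @reps_dx _ _ _ _ _ _ br2 br_lt br0 br1 XiE q0 Xi_m _ _ _ FOm FinvK Finv_bd Om_open _ Th _ brt0 brt1 _ T0 u c t z k.

Lemma int_Q_grad u v c e : reps u c -> reps v e ->
  int_Q Om T (fun x t => a (int_Omega Om (fun y => u y t)) * grad_dot u v x t) = grad_form c e.
Proof.
move=> uc ve.
rewrite (int_Q_open_elems brt0 brt1 (h := fun t => \sum_p cf c p * \sum_p' cf e p' * (stiffc p.1 p'.1 *
   (diffusivity c t * (bt p.2 t * bt p'.2 t))))); last first.
  move=> t to; have tT := oeT_itv brt0 brt1 to.
  have -> : int_Omega Om (fun y => u y t) = mean_at c t.
    rewrite (int_Omega_mesh br2 br_lt br0 br1 XiE q0 Xi_m FS FOm (h := W (tsl c (t / T)))).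
    - rewrite (mean_sum br2 br_lt br0 br1 XiE q0 Xi_m FS FOm FinvK Om_open Om_bd) slice_sum.
      by apply: eq_bigr => p _; rewrite clamped_basis_id.
    - exact: (wfun_integrable br2 br_lt br0 br1 XiE q0 Xi_m FS FOm FinvK Om_open Om_bd).
    - by move=> z /meshc zc; rewrite wE // (reps_slice T0 uc).
    - by move=> x xO; rewrite wfun_off.
  rewrite (int_Omega_mesh br2 br_lt br0 br1 XiE q0 Xi_m FS FOm
     (h := fun x => diffusivity c t * \sum_k G (tsl c (t / T)) k x * G (tsl e (t / T)) k x)).
  - have gi := pgradM_integrable br2 br_lt br0 br1 XiE q0 Xi_m FS FOm FinvK Finv_bd Om_open Om_bd (tsl c (t / T)) (tsl e (t / T)).
    rewrite RintegralZl // (stiff_sum br2 br_lt br0 br1 XiE q0 Xi_m FS FOm FinvK Finv_bd Om_open Om_bd) slice_sum2.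
    rewrite mulr_sumr; apply: eq_bigr => p _; rewrite mulrCA; congr (_ * _).
    by rewrite mulr_sumr; apply: eq_bigr => p' _; rewrite mulrCA; congr (_ * _); rewrite mulrCA.
  - apply: integrableZlR.
    exact: (pgradM_integrable br2 br_lt br0 br1 XiE q0 Xi_m FS FOm FinvK Finv_bd Om_open Om_bd).
  - move=> z zm; congr (_ * _); apply: eq_bigr => k _.
    by rewrite (dx_E k uc to zm) (dx_E k ve to zm).
  - by move=> x xO; rewrite big1 ?mulr0 // => k _; rewrite Goff ?mul0r.
exact: (oe_int_bilin (X := fun t j j' => diffusivity c t * (bt j t * bt j' t)) stiffc c e (fun j j' => abb_int c j j')).
Qed.

(** The spatial mean is linear in [c] with bounded time factors, so the Lipschitz bound of [a]
    passes to the weight: [Cm] bounds the mean per unit change of the coefficients, and [P] is the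
    integral of the absolute basis product. *)
Lemma diff_weight_continuous j j' : continuous (fun c => diff_weight c j j').
Proof.
have B (p : MI * 'I_nB) := cid (clamped_basis_bounded p.2).
pose Cm := \sum_p `|sval (B p)| * `|meanc p.1|.
pose P := \int[leb]_t `|\1_oe t * (bt j t * bt j' t)|.
have P0 : 0 <= P by apply: Rintegral_ge0.
have Cm0 : 0 <= Cm by apply: sumr_ge0 => p _; rewrite mulr_ge0.
apply: (@row_lipschitz_continuous _ _ (La * Cm * P)); first by rewrite !mulr_ge0.
move=> c c' r _ _ r0 cr.
have Dt t : `|diffusivity c t - diffusivity c' t| <= La * Cm * r.
  apply: le_trans (a_lip _ _) _; rewrite -mulrA ler_wpM2l // /mean_at -sumrB.
  apply: le_trans (ler_norm_sum _ _ _) _; rewrite /Cm mulr_suml; apply: ler_sum => p _.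
  rewrite -mulrBl !normrM mulrC ler_pM //.
  by rewrite ler_wpM2r //; apply: le_trans (svalP (B p) t) (ler_norm _).
rewrite /diff_weight -RintegralB //.
have E : (fun t => \1_oe t * (diffusivity c t * (bt j t * bt j' t)) - \1_oe t * (diffusivity c' t * (bt j t * bt j' t))) =
  (fun t => (diffusivity c t - diffusivity c' t) * (\1_oe t * (bt j t * bt j' t))).
  by apply/funext => t; ring.
rewrite E; have md : measurable_fun setT (fun t : measurableTypeR R => diffusivity c t - diffusivity c' t).
  by apply: measurable_funB; exact: measurable_diffusivity.
have i1 := bounded_mul_integrable md Dt (bb_int j j').
apply: le_trans (le_normr_Rintegral measurableT i1) _.
have ni : leb.-integrable setT (EFin \o (fun t => `|\1_oe t * (bt j t * bt j' t)|)).
  by have := integrable_abse (bb_int j j'); under eq_fun do rewrite /=.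
rewrite mulrAC -RintegralZl //; apply: le_Rintegral => //.
- by have := integrable_abse i1; under eq_fun do rewrite /=.
- exact: integrableZlR.
- by move=> t _; rewrite normrM ler_wpM2r // (le_trans (Dt t)).
Qed.

Lemma time_form_linr c b e e' : time_form c (b *: e + e') = b * time_form c e + time_form c e'.
Proof.
rewrite /time_form mulr_sumr -big_split /=; apply: eq_bigr => p _.
rewrite mulrCA -mulrDr; congr (_ * _); rewrite mulr_sumr -big_split /=; apply: eq_bigr => p' _.
by rewrite !mxE; ring.
Qed.

Lemma time_form_linl e b c c' : time_form (b *: c + c') e = b * time_form c e + time_form c' e.
Proof.
rewrite /time_form mulr_sumr -big_split /=; apply: eq_bigr => p _.
by rewrite !mxE; ring.
Qed.

Lemma grad_form_linr c b e e' : grad_form c (b *: e + e') = b * grad_form c e + grad_form c e'.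
Proof.
rewrite /grad_form mulr_sumr -big_split /=; apply: eq_bigr => p _.
rewrite mulrCA -mulrDr; congr (_ * _); rewrite mulr_sumr -big_split /=; apply: eq_bigr => p' _.
by rewrite !mxE; ring.
Qed.

Let cf_continuous (p : MI * 'I_nB) : continuous (fun c : 'rV[R]_K => cf c p).
Proof. by move=> c; exact: coord_continuous. Qed.

Lemma forms_continuous e : continuous (fun c => time_form c e + grad_form c e).
Proof.
move=> c; apply: (@continuousD _ _ _ (fun c => time_form c e) (fun c => grad_form c e)).
  apply: continuous_sum_at => p; apply: continuousM; first exact: cf_continuous.
  exact: cst_continuous.
apply: continuous_sum_at => p; apply: continuousM; first exact: cf_continuous.
apply: continuous_sum_at => p'; apply: continuousM; first exact: cst_continuous.
apply: continuousM; first exact: cst_continuous.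
exact: diff_weight_continuous.
Qed.

Let reps_zero e : S0 e -> reps (fun _ _ => 0) e.
Proof. by move=> H z tau zc tr; rewrite H. Qed.

Definition trial_fun c : 'rV[R]_d -> R -> R := fun x t => sts c (Finv x) (t / T).

Lemma reps_trial c : reps (trial_fun c) c.
Proof.
by move=> z tau zc tr; rewrite /trial_fun FinvK // [T * tau]mulrC mulfK // gt_eqF.
Qed.

Let null0 : S0 0. Proof. exact: (lin_subset_null m q Xi qt Th).1. Qed.

Let dt_E := int_Q_dt br2 br_lt br0 br1 XiE q0 Xi_m FS FOm FinvK Om_open Om_bd brt2 brt_lt brt0 brt1 ThE qt0 T0.

(** A null vector represents the zero function, as the vector 0 does, and the integral depends on
    the function only. *)
Lemma time_form_nullr c e : S0 e -> time_form c e = 0.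
Proof.
move=> e0; rewrite -(dt_E (reps_trial c) (reps_zero e0)) (dt_E (reps_trial c) (reps_zero null0)).
by have := time_form_linr c 1 0 0; rewrite scaler0 addr0 mul1r => /eqP; rewrite -subr_eq0 opprD addNKr oppr_eq0 => /eqP.
Qed.

Lemma time_form_nulll c e : S0 c -> time_form c e = 0.
Proof.
move=> c0; rewrite -(dt_E (reps_zero c0) (reps_trial e)) (dt_E (reps_zero null0) (reps_trial e)).
by have := time_form_linl e 1 0 0; rewrite scaler0 addr0 mul1r => /eqP; rewrite -subr_eq0 opprD addNKr oppr_eq0 => /eqP.
Qed.

Lemma grad_form_nullr c e : S0 e -> grad_form c e = 0.
Proof.
move=> e0; rewrite -(int_Q_grad (reps_trial c) (reps_zero e0)) (int_Q_grad (reps_trial c) (reps_zero null0)).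
by have := grad_form_linr c 1 0 0; rewrite scaler0 addr0 mul1r => /eqP; rewrite -subr_eq0 opprD addNKr oppr_eq0 => /eqP.
Qed.

End Coercivity.

Lemma mulr_ge0_sqr (R : realDomainType) (x : R) : 0 <= x * x.
Proof. by rewrite -expr2 sqr_ge0. Qed.

(** * Energy estimates *)

Section Energy.
Context (R : realType) (d m q : nat) (Xi br : 'I_d -> seq R).
Hypotheses (br2 : forall k, (2 <= size (br k))%N)
  (br_lt : forall k, sorted (fun a b : R => a < b) (br k))
  (br0 : forall k, head 0 (br k) = 0) (br1 : forall k, last 0 (br k) = 1)
  (XiE : forall k, Xi k = nseq q 0 ++ br k ++ nseq q 1) (q0 : (0 < q)%N)
  (Xi_m : forall k, (size (Xi k) <= m)%N).
Context (F Finv : 'rV[R]_d -> 'rV[R]_d) (Om : set 'rV[R]_d).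
Hypotheses (FS : forall k, spline_space Xi q (fun z => F z 0 k))
  (FOm : F @` open_cube d = Om) (FinvK : forall z, open_cube d z -> Finv (F z) = z)
  (Finv_bd : forall J, bounded_derivatives_on Finv (F @` mesh_elem Xi J)) (Om_open : open Om).
Notation rvec n := (g_sigma_algebraType (@open 'rV[R]_n)).
Notation MI := {ffun 'I_d -> 'I_m}.
Hypothesis Om_bd : exists C, forall x, Om x -> `|x| <= C.
Context (qt : nat) (Th brt : seq R).
Hypotheses (brt2 : (2 <= size brt)%N) (brt_lt : sorted (fun a b : R => a < b) brt)
  (brt0 : head 0 brt = 0) (brt1 : last 0 brt = 1)
  (ThE : Th = nseq qt 0 ++ brt ++ nseq qt 1) (qt0 : (0 < qt)%N).
Context (T : R) (T0 : 0 < T).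
Notation mu := (row_measure R d).
Notation leb := (@lebesgue_measure R).
Notation mesh := (mesh_pts br).
Notation ts := (tspline q Xi).
Notation W := (wfun q Xi Finv Om).
Notation G := (pgrad q Xi br F Finv Om).
Notation nB := (size Th - qt.+1)%N.
Notation K := #|{: MI * 'I_nB}|.
Notation cf c p := ((c : 'rV[R]_K) 0 (enum_rank p)).
Notation bt := (bT qt Th T).
Notation oe := (open_elems (brT brt T)).
Notation oe_int f := (\int[leb]_x (\1_oe x * f x)).
Notation sts := (stspline q Xi (qt := qt) (Th := Th)).
Notation tsl := (tslice (m := m) (qt := qt) (Th := Th)).
Implicit Types (c e : 'rV[R]_K) (z : 'rV[R]_d).
Notation massc := (massc q Xi Finv Om).
Notation stiffc := (stiffc q Xi br F Finv Om).
Notation time_form := (time_form q Xi Finv Om brt T (qt := qt) (Th := Th)).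
Notation S := (trial_coefs (m := m) (qt := qt) (Th := Th) q Xi).
Notation S0 := (null_coefs (m := m) (qt := qt) (Th := Th) q Xi).
Let meshc z : mesh z -> open_cube d z. Proof. exact: mesh_open_cube. Qed.
Let brTl : forall i j, (i < j)%N -> (j < size (brT brt T))%N -> (brT brt T)`_i < (brT brt T)`_j.
Proof. exact: brT_lt. Qed.
Let brT2' : (2 <= size (brT brt T))%N. Proof. exact: brT2. Qed.
Let btpw j : pw_poly (brT brt T) (bt j).
Proof. exact: (bT_pw_poly brt2 brt_lt brt0 brt1 ThE qt0 T0). Qed.
Let mW (f : MI -> R) : measurable_fun setT (W f).
Proof. exact: (measurable_wfun br2 br_lt br0 br1 XiE q0 Xi_m FS FOm FinvK Om_open). Qed.
Let mG (f : MI -> R) k : measurable_fun setT (G f k).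
Proof. exact: (measurable_pgrad br2 br_lt br0 br1 XiE q0 Xi_m FS FOm FinvK Finv_bd Om_open). Qed.
Let Goff (f : MI -> R) k (x : rvec d) : ~ Om x -> G f k x = 0.
Proof. by move=> xO; apply: pgrad_off => /(Fmesh_Om br0 br1 FOm). Qed.

Let wE (f : MI -> R) z : open_cube d z -> W f (F z) = ts f z.
Proof. exact: wfunE. Qed.

Let op_bt j : open_poly (brT brt T) (bt j).
Proof. exact: pw_poly_open_poly. Qed.
Let op_dbt j : open_poly (brT brt T) (derive1 (bt j)).
Proof. exact: pw_poly_derive1_open_poly. Qed.

Context (a : R -> R) (am aM La : R) (am0 : 0 < am) (a_bd : forall s, am <= a s <= aM)
  (La0 : 0 <= La) (a_lip : forall s s', `|a s - a s'| <= La * `|s - s'|).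
Notation diffusivity := (diffusivity q Xi Finv Om T a (qt := qt) (Th := Th)).
Notation grad_form := (grad_form q Xi br F Finv Om brt T a (qt := qt) (Th := Th)).

(** Mesh points are dense: a small move from [z] towards the midpoint of a containing element
    reaches one, and the spline is Lipschitz. *)
Lemma tspline_zero_dense (f : MI -> R) : (forall z, mesh z -> ts f z = 0) ->
  forall z, open_cube d z -> ts f z = 0.
Proof.
move=> H z zc; have [L L0 [Ll _]] := tspline_lipschitz br2 br_lt br0 br1 XiE q0 f.
have zc' := open_closed_cube zc.
have el k : {j | (j.+1 < size (br k))%N /\ (br k)`_j <= z 0 k <= (br k)`_j.+1}.
  by apply: cid; apply: (find_elem (br2 k)); rewrite nth0 br0 nth_last br1; exact: zc'.
apply/eqP; rewrite -normr_le0; apply/ler_addgt0Pl => e e0; rewrite addr0.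
pose s := Num.min 1 (e / (L + 1)).
have L1 : 0 < L + 1 by rewrite ltr_wpDl.
have s0 : 0 < s by rewrite lt_min ltr01 divr_gt0.
have s1 : s <= 1 by rewrite ge_min lexx.
have se : s <= e / (L + 1) by rewrite ge_min lexx orbT.
pose mid k := ((br k)`_(sval (el k)) + (br k)`_(sval (el k)).+1) / 2.
pose y : 'rV[R]_d := \row_k (z 0 k + s * (mid k - z 0 k)).
have brlt k := breaks_lt (br_lt k).
have ym : mesh y.
  move=> k; rewrite mxE; have [js /andP[z1 z2]] := svalP (el k).
  have lt := brlt k _ _ (ltnSn (sval (el k))) js.
  apply: (open_elemsP (br2 k) (brlt k) js); rewrite /mid; apply/andP; split; nra.
have yz k : `|z 0 k - y 0 k| <= s.
  rewrite mxE; have [js /andP[z1 z2]] := svalP (el k).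
  have lt := brlt k _ _ (ltnSn (sval (el k))) js.
  have m0 : 0 <= (br k)`_(sval (el k)) by apply: (breaks_ge0 (br_lt k) (br0 k)); exact: ltnW.
  have m1 : (br k)`_(sval (el k)).+1 <= 1 by apply: (breaks_le1 (br := br k)).
  rewrite opprD addNKr normrN normrM gtr0_norm //.
  apply: ler_piMr; first exact: ltW.
  by rewrite ler_norml /mid; apply/andP; split; lra.
rewrite -[ts f z]subr0 -(H y ym); apply: le_trans (Ll z y s zc' _ (ltW s0) yz) _.
  exact: (open_closed_cube (meshc ym)).
apply: (@le_trans _ _ ((L + 1) * s)); first by rewrite ler_wpM2r ?ltW // ltrDl.
by rewrite mulrC -ler_pdivlMr.
Qed.

Definition grad_energy c t := \int[mu]_x (\sum_k G (tsl c (t / T)) k x * G (tsl c (t / T)) k x).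

Let stiffE (f g : MI -> R) := stiff_sum br2 br_lt br0 br1 XiE q0 Xi_m FS FOm FinvK Finv_bd Om_open Om_bd f g.

Let grad_energyE c t : grad_energy c t =
  \sum_p cf c p * \sum_p' cf c p' * (stiffc p.1 p'.1 * (bt p.2 t * bt p'.2 t)).
Proof. by rewrite /grad_energy stiffE slice_sum2. Qed.

Lemma grad_energy_ge0 c t : 0 <= grad_energy c t.
Proof. by apply: Rintegral_ge0 => x _; apply: sumr_ge0 => k _; rewrite -expr2 sqr_ge0. Qed.

Let grad_energy_pw c : pw_poly (brT brt T) (grad_energy c).
Proof.
rewrite (_ : grad_energy c = fun t => \sum_p \sum_p' ((cf c p * (cf c p' * stiffc p.1 p'.1))%:P).[t] * (bt p.2 t * bt p'.2 t)).
  apply: pw_poly_sum => p; apply: pw_poly_sum => p'; apply: pw_polyM; first exact: pw_poly_horner.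
  by apply: pw_polyM.
apply/funext => t; rewrite grad_energyE; apply: eq_bigr => p _; rewrite mulr_sumr.
by apply: eq_bigr => p' _; rewrite hornerC; ring.
Qed.

Let grad_energy_int c : leb.-integrable setT (EFin \o (fun t => \1_oe t * grad_energy c t)).
Proof. by apply: open_poly_integrable => //; exact: pw_poly_open_poly. Qed.

Let bb_int j j' : leb.-integrable setT (EFin \o (fun t => \1_oe t * (bt j t * bt j' t))).
Proof. by apply: open_poly_integrable => //; exact: open_polyM. Qed.

Let mdiff c := measurable_diffusivity q Xi Finv Om brt2 brt_lt brt0 brt1 ThE qt0 T0 La0 a_lip c.
Let bdiff c t := diffusivity_bounded q Xi Finv Om T am0 a_bd c t.

Lemma grad_form_energy c : grad_form c c = oe_int (fun t => diffusivity c t * grad_energy c t).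
Proof.
rewrite /grad_form -(oe_int_bilin (X := fun t j j' => diffusivity c t * (bt j t * bt j' t)) stiffc c c); last first.
  move=> j j'; under eq_fun do rewrite mulrCA.
  exact: (bounded_mul_integrable (mdiff c) (bdiff c) (bb_int j j')).
apply: eq_Rintegral => t _; congr (_ * _); rewrite grad_energyE mulr_sumr; apply: eq_bigr => p _.
rewrite mulrCA; congr (_ * _); rewrite mulr_sumr; apply: eq_bigr => p' _.
by ring.
Qed.

(** The quadratic form used as [Q] in [galerkin_coercive]: the diffusivity is replaced by its lower
    bound [am]. *)
Definition energy c :=
  am * \sum_p cf c p * \sum_p' cf c p' * (stiffc p.1 p'.1 * oe_int (fun t => bt p.2 t * bt p'.2 t)).

Lemma energyE c : energy c = am * oe_int (grad_energy c).
Proof.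
rewrite /energy -(oe_int_bilin (X := fun t j j' => bt j t * bt j' t) stiffc c c bb_int); congr (_ * _).
by apply: eq_Rintegral => t _; rewrite grad_energyE.
Qed.

Lemma energy_le_grad_form c : energy c <= grad_form c c.
Proof.
rewrite energyE grad_form_energy -RintegralZl //; apply: le_Rintegral => //.
- exact: integrableZlR.
- under eq_fun do rewrite mulrCA.
  exact: (bounded_mul_integrable (mdiff c) (bdiff c) (grad_energy_int c)).
move=> t _; rewrite mulrCA ler_wpM2l ?indicE ?ler0n // ler_wpM2r ?grad_energy_ge0 //.
by have /andP[] := a_bd (mean_at q Xi Finv Om T (qt := qt) (Th := Th) c t).
Qed.

Let massE (f g : MI -> R) := mass_sum br2 br_lt br0 br1 XiE q0 Xi_m FS FOm FinvK Om_open Om_bd f g.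

(** Adding the form to its transpose turns the time integrals into boundary values by the product
    rule; the spline vanishes at time 0, and at time [T] the mass form is the integral of a
    square. *)
Lemma time_form_ge0 c : S c -> 0 <= time_form c c.
Proof.
move=> [_ c0].
pose D j j' := oe_int (fun t => derive1 (bt j) t * bt j' t).
have Dsym j j' : D j j' + D j' j = bt j T * bt j' T - bt j 0 * bt j' 0.
  have P := pw_deriv_pairM (pw_poly_deriv_pair (@btpw j)) (pw_poly_deriv_pair (@btpw j')).
  have := pw_deriv_pair_FTC brT2' brTl P; rewrite brT_lo // brT_hi // => <-.
  rewrite (oe_intD brT2' brTl); [|exact: open_polyM|exact: open_polyM].
  by congr (_ + _); apply: eq_Rintegral => t _; rewrite [bt j t * _]mulrC.
have W0 x : W (tsl c 0) x = 0.
  have [xO|xO] := pselect (Om x); last exact: wfun_off.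
  have [z zc <-] : (F @` open_cube d) x by rewrite FOm.
  by rewrite wE //; exact: c0.
have sym (I I' : MI) : massc I I' = massc I' I by apply: eq_Rintegral => x _; rewrite mulrC.
have two : time_form c c + time_form c c =
    (\int[mu]_x (W (tsl c 1) x * W (tsl c 1) x)) - \int[mu]_x (W (tsl c 0) x * W (tsl c 0) x).
  rewrite !massE !slice_sum2 -sumrB.
  transitivity (\sum_p cf c p * \sum_p' cf c p' * (massc p.1 p'.1 * (D p.2 p'.2 + D p'.2 p.2))).
    rewrite [X in _ + X](_ : _ = \sum_p cf c p * \sum_p' cf c p' * (massc p.1 p'.1 * D p'.2 p.2)).
      rewrite -big_split /=; apply: eq_bigr => p _; rewrite -mulrDr; congr (_ * _).
      by rewrite -big_split /=; apply: eq_bigr => p' _; rewrite -!mulrDr.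
    rewrite /time_form; under eq_bigr do rewrite mulr_sumr.
    rewrite exchange_big /=; apply: eq_bigr => p _; rewrite mulr_sumr; apply: eq_bigr => p' _.
    by rewrite (sym p'.1) -/(D p'.2 p.2); ring.
  apply: eq_bigr => p _; rewrite -mulrBr; congr (_ * _); rewrite -sumrB; apply: eq_bigr => p' _.
  by rewrite Dsym /bT divff ?gt_eqF // mul0r; ring.
have := two; rewrite [X in _ - X](_ : _ = 0) ?subr0; last first.
  transitivity (\int[mu]_(x in [set: rvec d]) (0 : R)).
    by apply: eq_Rintegral => x _; rewrite W0 mul0r.
  by rewrite Rintegral_cst // mul0r.
move=> E; suff : 0 <= time_form c c + time_form c c by lra.
by rewrite E; apply: Rintegral_ge0 => x _; rewrite -expr2 sqr_ge0.
Qed.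

Lemma energy_le c : S c -> energy c <= time_form c c + grad_form c c.
Proof. by move=> Sc; apply: le_trans (energy_le_grad_form c) _; rewrite lerDr time_form_ge0. Qed.

Lemma energy_scale b c : energy (b *: c) = b ^+ 2 * energy c.
Proof.
rewrite /energy mulrCA; congr (_ * _); rewrite mulr_sumr; apply: eq_bigr => p _.
rewrite mxE expr2 -!mulrA; congr (_ * _); rewrite mulrCA; congr (_ * _); rewrite mulr_sumr.
by apply: eq_bigr => p' _; rewrite mxE -mulrA.
Qed.

Lemma energy_continuous : continuous energy.
Proof.
have cf_continuous (p : MI * 'I_nB) : continuous (fun c : 'rV[R]_K => cf c p).
  by move=> c; exact: coord_continuous.
move=> c; apply: continuousM; first exact: cst_continuous.
apply: continuous_sum_at => p; apply: continuousM; first exact: cf_continuous.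
apply: continuous_sum_at => p'; apply: continuousM; first exact: cf_continuous.
exact: cst_continuous.
Qed.

(** The gradient energy is continuous in time off the breakpoints, so it vanishes at all these times
    and not merely almost everywhere. At each of them the spline vanishes at mesh points and, by
    density, on the cube; closed pieces extend this to the breakpoints in time. The index [l] gives
    a direction in which to reach the boundary. *)
Lemma energy_null (l : 'I_d) c : S c -> energy c <= 0 -> S0 c.
Proof.
move=> [c_bd _]; rewrite energyE pmulr_rle0 // => I0.
have ge0 t : 0 <= \1_oe t * grad_energy c t by rewrite mulr_ge0 ?grad_energy_ge0 // indicE ler0n.
have N := Rintegral_ge0_eq0 (grad_energy_int c) ge0.
have {}N : leb.-negligible [set t | \1_oe t * grad_energy c t <> 0].
  by apply: N; apply/eqP; rewrite eq_le I0 /=; apply: Rintegral_ge0 => t _.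
have en0 t : oe t -> grad_energy c t = 0.
  move=> to; apply/eqP/negP => /negP en.
  have gc : {for t, continuous (grad_energy c)}.
    apply: differentiable_continuous; apply/derivable1_diffP.
    by have [] := pw_poly_is_derive brT2' (@grad_energy_pw c) to.
  have : nbhs t (oe `&` [set t | grad_energy c t != 0]).
    apply: filterI; first by apply: open_nbhs_nbhs; split => //; exact: open_elems_open.
    have : nbhs (grad_energy c t) [set y : R | y != 0].
      by apply: open_nbhs_nbhs; split => //; exact: open_neq.
    exact: gc.
  move=> /nbhs_ballP[r /= r0 rU].
  have : leb.-negligible `]t - r, t + r[%classic.
    apply: (negligibleS _ N) => s; rewrite /= in_itv /= => sr.
    have [so /= /eqP s0] : (oe `&` [set t | grad_energy c t != 0]) s.
      by apply: rU; rewrite /ball /= ltr_distlC.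
    by rewrite indicE mem_set // mul1r.
  move=> [A [mA A0 sub]].
  pose J : set R := `]t - r, t + r[%classic.
  have : (leb J <= leb A)%E.
    by apply: le_measure; rewrite ?inE //; exact: measurable_itv.
  rewrite [X in (_ <= X)%E]A0 /J lebesgue_measure_itv /= lte_fin ifT; last by lra.
  by rewrite -EFinB lee_fin; lra.
have sts0 t : oe t -> forall z, mesh z -> ts (tsl c (t / T)) z = 0.
  move=> to; apply: (tspline_zero br2 br_lt br0 br1 XiE q0 (l := l)).
    move=> z zb; apply: c_bd => //; apply: scaled_time => //; exact: (oeT_itv brt0 brt1).
  move=> z zm; apply: (dtspline_zero br2 br_lt br0 br1 XiE q0 Xi_m FS FOm FinvK Finv_bd Om_open) => // k.
  have gi := pgradM_integrable br2 br_lt br0 br1 XiE q0 Xi_m FS FOm FinvK Finv_bd Om_open Om_bd (tsl c (t / T)) (tsl c (t / T)).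
  have sq_ge0 x : 0 <= \sum_k0 G (tsl c (t / T)) k0 x * G (tsl c (t / T)) k0 x.
    by apply: sumr_ge0 => k0 _; exact: mulr_ge0_sqr.
  have := Rintegral_ge0_eq0 gi sq_ge0 (en0 t to).
  apply: negligibleS => x /= Gx h; apply: Gx; apply/eqP; rewrite -sqrf_eq0 expr2.
  by have /(_ k isT) -> := psumr_eq0P (fun k0 _ => mulr_ge0_sqr (G (tsl c (t / T)) k0 x)) h.
move=> z tau zc tr.
have pw : pw_poly (brT brt T) (fun t => sts c z (t / T)).
  rewrite (_ : (fun t => _) = fun t => \sum_p ((cf c p * bspline_space Xi q (fun k => (p.1 : MI) k) z)%:P).[t] * bt p.2 t).
    by apply: pw_poly_sum => p; apply: pw_polyM; first exact: pw_poly_horner.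
  by apply/funext => t; rewrite stsplineE; apply: eq_bigr => p _; rewrite hornerC mulrA.
have pw0 : pw_poly (brT brt T) (fun=> 0 : R).
  by rewrite (_ : (fun=> 0) = fun t : R => (0 : {poly R}).[t]); [exact: pw_poly_horner | apply/funext => t; rewrite horner0].
have := pw_poly_eq brT2' brTl pw pw0 _ (x := tau * T).
rewrite mulfK ?gt_eqF //; apply.
  by move=> t to; apply: tspline_zero_dense zc => y ym; exact: sts0.
rewrite brT_lo // brT_hi //; case/andP: tr => h1 h2.
apply/andP; split; first by apply: mulr_ge0; exact: ltW.
by rewrite ger_pMl // ltW.
Qed.

End Energy.

(** * The right-hand side *)

Section SpaceTimeData.
Context (R : realType) (d : nat) (Om : set 'rV[R]_d) (T : R) (f : 'rV[R]_d -> R -> R).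
Hypothesis hf : in_Z Om T f.
Notation rvec n := (g_sigma_algebraType (@open 'rV[R]_n)).
Notation leb := (@lebesgue_measure R).
Notation fhat := (spacetime_fun Om T f).

Let split_row (v : 'rV[R]_d.+1) : 'rV[R]_d * R := (rsubmx (v : 'rV[R]_(1 + d)), v 0 0).

Let split_row_continuous : continuous split_row.
Proof.
have c1 : continuous (fun v : 'rV[R]_d.+1 => v 0 0) by exact: coord_continuous.
suff c2 : continuous (fun v : 'rV[R]_d.+1 => rsubmx (v : 'rV[R]_(1 + d))).
  by move=> v; exact: (cvg_pair (c2 v) (c1 v)).
apply: rowv_continuous => i; rewrite (_ : (fun x => _) = fun v : 'rV[R]_d.+1 => v 0 (rshift 1 i)).
  exact: coord_continuous.
by apply/funext => w; rewrite mxE.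
Qed.

Let measurable_split_row :
  measurable_fun setT (split_row : rvec d.+1 -> g_sigma_algebraType (@open ('rV[R]_d * R)%type)).
Proof.
apply: (@measurability _ _ _ (g_sigma_algebraType (@open ('rV[R]_d * R)%type)) _ _ (@open ('rV[R]_d * R)%type)) => //.
move=> _ [A oA <-]; rewrite setTI; apply: rvec_open.
by apply: open_comp => // v _; exact: split_row_continuous.
Qed.

Lemma measurable_spacetime_fun : measurable_fun setT fhat.
Proof.
apply: (measurability _ (RGenOInfty.measurableE R)).
move=> _ [_ [c ->] <-]; rewrite setTI.
have oc : open (`]c, +oo[%classic : set R) by rewrite set_itvE; exact: open_gt.
have := measurable_split_row measurableT (hf.1 _ oc); rewrite setTI.
suff -> : fhat = (fun p : 'rV[R]_d * R => \1_(Om `*` `]0, T[) p * f p.1 p.2) \o split_row by [].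
apply/funext => v; rewrite /= /spacetime_fun /= !indicE in_setX /=.
by case: (_ \in Om); case: (_ \in _); rewrite /= ?mul1r ?mul0r ?mulr0.
Qed.

Lemma spacetime_fun_rcons t (y : rvec d) :
  fhat (rcons_row (t, y)) = \1_(`]0, T[) t * (\1_Om (y : 'rV[R]_d) * f y t).
Proof. by rewrite /spacetime_fun rcons_rowK. Qed.

Lemma spacetime_sqr_integrable : (row_measure R d.+1).-integrable setT (EFin \o (fun v => fhat v ^+ 2)).
Proof.
have msq : measurable_fun setT (fun v => fhat v ^+ 2) by apply: measurable_funX; exact: measurable_spacetime_fun.
have mE : measurable_fun setT (EFin \o (fun v => fhat v ^+ 2)) by exact/measurable_EFinP.
apply/integrableP; split => //.
rewrite (eq_integral (EFin \o (fun v => fhat v ^+ 2))) => [|v _]; last by rewrite gee0_abs // lee_fin sqr_ge0.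
rewrite ge0_row_integralS //; last by move=> v; rewrite lee_fin sqr_ge0.
apply: le_lt_trans hf.2; rewrite [X in (_ <= X)%E]integral_mkcond; rewrite le_eqVlt; apply/orP; left; apply/eqP.
apply: eq_integral => t _; rewrite patchE; case: ifPn => tT.
  rewrite ieintE.
  - apply: eq_integral => y _; rewrite /= spacetime_fun_rcons indicE tT mul1r exprMn; congr (_ * _)%:E.
    by rewrite indicE; case: (_ \in _); rewrite ?expr1n ?expr0n.
  - have := measurable_rcons_slice t mE; apply: eq_measurable_fun => y _.
    rewrite /= spacetime_fun_rcons indicE tT mul1r exprMn; congr (_ * _)%:E.
    by rewrite indicE; case: (_ \in _); rewrite ?expr1n ?expr0n.
  - by move=> y; rewrite lee_fin mulr_ge0 ?sqr_ge0 // indicE ler0n.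
rewrite integral0_eq // => y _; rewrite /= spacetime_fun_rcons indicE (negbTE tT) mul0r expr0n.
by [].
Qed.

End SpaceTimeData.

Section Load.
Context (R : realType) (d m q : nat) (Xi br : 'I_d -> seq R).
Hypotheses (br2 : forall k, (2 <= size (br k))%N)
  (br_lt : forall k, sorted (fun a b : R => a < b) (br k))
  (br0 : forall k, head 0 (br k) = 0) (br1 : forall k, last 0 (br k) = 1)
  (XiE : forall k, Xi k = nseq q 0 ++ br k ++ nseq q 1) (q0 : (0 < q)%N)
  (Xi_m : forall k, (size (Xi k) <= m)%N).
Context (F Finv : 'rV[R]_d -> 'rV[R]_d) (Om : set 'rV[R]_d).
Hypotheses (FS : forall k, spline_space Xi q (fun z => F z 0 k))
  (FOm : F @` open_cube d = Om) (FinvK : forall z, open_cube d z -> Finv (F z) = z)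
  (Finv_bd : forall J, bounded_derivatives_on Finv (F @` mesh_elem Xi J)) (Om_open : open Om).
Notation rvec n := (g_sigma_algebraType (@open 'rV[R]_n)).
Notation MI := {ffun 'I_d -> 'I_m}.
Hypothesis Om_bd : exists C, forall x, Om x -> `|x| <= C.
Context (qt : nat) (Th brt : seq R).
Hypotheses (brt2 : (2 <= size brt)%N) (brt_lt : sorted (fun a b : R => a < b) brt)
  (brt0 : head 0 brt = 0) (brt1 : last 0 brt = 1)
  (ThE : Th = nseq qt 0 ++ brt ++ nseq qt 1) (qt0 : (0 < qt)%N).
Context (T : R) (T0 : 0 < T).
Notation mu := (row_measure R d).
Notation leb := (@lebesgue_measure R).
Notation ts := (tspline q Xi).
Notation W := (wfun q Xi Finv Om).
Notation dlt I := (fun J : MI => (J == I)%:R : R).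
Notation nB := (size Th - qt.+1)%N.
Notation K := #|{: MI * 'I_nB}|.
Notation cf c p := ((c : 'rV[R]_K) 0 (enum_rank p)).
Notation bt := (bT qt Th T).
Implicit Types (c e : 'rV[R]_K) (z : 'rV[R]_d).
Notation reps := (reps q Xi F T (qt := qt) (Th := Th)).
Notation S0 := (null_coefs (m := m) (qt := qt) (Th := Th) q Xi).
Let wE (f : MI -> R) z : open_cube d z -> W f (F z) = ts f z.
Proof. exact: wfunE. Qed.

Context (f : 'rV[R]_d -> R -> R) (hf : in_Z Om T f).
Notation bc := (clamped_basis qt Th T).
Notation fhat := (spacetime_fun Om T f).

Let gam (j : nat) (t : R) : R := \1_(`]0, T[) t * bc j t.

Let mgam j : measurable_fun setT (gam j : measurableTypeR R -> R).
Proof.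
apply: measurable_funM; first exact: measurable_indic.
suff : continuous (bc j) by exact: continuous_measurable_fun.
have [L L0 HL] := clamped_basis_lip brt2 brt_lt brt0 brt1 ThE qt0 T0 j.
exact: (lipschitz_continuous L0 HL).
Qed.

Let gam_int j : leb.-integrable setT (EFin \o gam j) /\ leb.-integrable setT (EFin \o (fun t => gam j t ^+ 2)).
Proof.
have [C HC] := clamped_basis_bounded brt2 brt_lt brt0 brt1 ThE qt0 T j.
have i1 : leb.-integrable setT (EFin \o (fun t => \1_(`]0, T[) t : R)).
  exact: (integrable_indic_itv 0 T false true).
have mb : measurable_fun setT (bc j : measurableTypeR R -> R).
  suff : continuous (bc j) by exact: continuous_measurable_fun.
  have [L L0 HL] := clamped_basis_lip brt2 brt_lt brt0 brt1 ThE qt0 T0 j.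
  exact: (lipschitz_continuous L0 HL).
have gi : leb.-integrable setT (EFin \o gam j).
  have := bounded_mul_integrable mb HC i1.
  by under eq_fun do rewrite mulrC.
split=> //.
have gC t : `|gam j t| <= C.
  rewrite /gam normrM -[C]mul1r ler_pM // indicE; case: (_ \in _); rewrite ?normr1 ?normr0 //.
exact: (bounded_mul_integrable (@mgam j) gC gi).
Qed.

Let wint (g : MI -> R) := wfun_integrable br2 br_lt br0 br1 XiE q0 Xi_m FS FOm FinvK Om_open Om_bd g.
Let wint2 (g : MI -> R) := wfunM_integrable br2 br_lt br0 br1 XiE q0 Xi_m FS FOm FinvK Om_open Om_bd g g.

Let load_int (p : MI * 'I_nB) :
  (row_measure R d.+1).-integrable setT (EFin \o (fun v => fhat v * tensor (W (dlt p.1)) (gam p.2) v)).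
Proof.
have t1 := tensor_integrable (wint (dlt p.1)) (gam_int p.2).1.
have t2 := tensor_integrable (wint2 (dlt p.1)) (gam_int p.2).2.
have s2 := spacetime_sqr_integrable hf.
have mt : measurable_fun setT (tensor (W (dlt p.1)) (gam p.2)).
  by apply/measurable_EFinP; exact: (measurable_int _ t1).
(* The product is bounded by the sum of the squares, and both the data and the basis function are
   square integrable. *)
apply: (le_integrable measurableT _ _ (integrableD measurableT s2 t2)).
  by apply/measurable_EFinP; apply: measurable_funM => //; exact: (measurable_spacetime_fun hf).
move=> v _ /=; rewrite lee_fin /tensor.
set x := fhat v; set y := gam _ _ ; set w := W _ _.
rewrite [X in _ <= X]ger0_norm; last by rewrite addr_ge0 ?sqr_ge0 // mulr_ge0 ?sqr_ge0 // -expr2 sqr_ge0.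
rewrite ler_norml; have := sqr_ge0 (x + y * w); have := sqr_ge0 (x - y * w).
have -> : y ^+ 2 * (w * w) = (y * w) ^+ 2 by ring.
set u := y * w => h1 h2; have h3 := sqr_ge0 x; have h4 := sqr_ge0 u.
by apply/andP; split; nra.
Qed.

Definition load (e : 'rV[R]_K) : R := \sum_p cf e p *
  \int[row_measure R d.+1]_v (fhat v * tensor (W (dlt p.1)) (fun t => \1_(`]0, T[) t * bc p.2 t) v).

Lemma int_Q_load v e : reps v e -> int_Q Om T (fun x t => f x t * v x t) = load e.
Proof.
move=> ve; rewrite /load -Rintegral_lincomb; last by move=> p; exact: load_int.
apply: int_QE; first by apply: integrable_sumR => p; exact/integrableZlR/load_int.
rewrite (_ : [set _ | _] = set0); first exact: negligible_set0.
apply/seteqP; split=> // y /=; apply; rewrite /spacetime_fun /tensor.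
set p := runcons_row y; case: p => t x /=.
have [tT|tT] := boolP (t \in (`]0, T[%classic : set R)); last first.
  rewrite indicE (negbTE tT) !mul0r big1 // => p _.
  by rewrite !mul0r mulr0.
have [xO|xO] := boolP (x \in (Om : set (rvec d))); last first.
  rewrite [\1_Om x]indicE (negbTE xO) !mul0r mulr0 big1 // => p _.
  by rewrite mul0r mulr0.
rewrite !indicE tT xO !mul1r.
have tT' : 0 < t < T by move: tT; rewrite inE /= in_itv.
have vE : v x t = \sum_p cf e p * (bt p.2 t * W (dlt p.1) x).
  rewrite -(slice_sum (fun j : 'I_nB => bt j t) e (fun I => W (dlt I) x)) -wfun_sum.
  have [z zc <-] : (F @` open_cube d) x by rewrite FOm; rewrite inE in xO.
  by rewrite (reps_slice T0 ve) // wE.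
rewrite vE mulr_sumr; apply: eq_bigr => p _; rewrite mulrCA; congr (_ * (_ * _)).
by rewrite mul1r clamped_basis_id.
Qed.

Lemma load_lin b e e' : load (b *: e + e') = b * load e + load e'.
Proof.
rewrite /load mulr_sumr -big_split /=; apply: eq_bigr => p _.
by rewrite !mxE mulrDl mulrA.
Qed.

Lemma load_null e : S0 e -> load e = 0.
Proof.
have rz e' : S0 e' -> reps (fun _ _ => 0) e' by move=> H z tau zc tr; rewrite H.
move=> e0; rewrite -(int_Q_load (rz _ e0)) (int_Q_load (rz 0 _)); last exact: (lin_subset_null m q Xi qt Th).1.
by have := load_lin 1 0 0; rewrite scaler0 addr0 mul1r => /eqP; rewrite -subr_eq0 opprD addNKr oppr_eq0 => /eqP.
Qed.

End Load.

Lemma iint_dim0 (R : realType) (d : nat) (g : 'rV[R]_d -> R) : d = 0%N -> iint g = g 0.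
Proof. by move=> d0; move: g; rewrite d0. Qed.

(** * Trial functions and the case of dimension 0 *)

Section Assembly.
Context (R : realType) (d m q : nat) (Xi br : 'I_d -> seq R).
Hypotheses (br2 : forall k, (2 <= size (br k))%N)
  (br_lt : forall k, sorted (fun a b : R => a < b) (br k))
  (br0 : forall k, head 0 (br k) = 0) (br1 : forall k, last 0 (br k) = 1)
  (XiE : forall k, Xi k = nseq q 0 ++ br k ++ nseq q 1) (q0 : (0 < q)%N)
  (Xi_m : forall k, (size (Xi k) <= m)%N).
Context (F Finv : 'rV[R]_d -> 'rV[R]_d) (Om : set 'rV[R]_d).
Hypotheses (FS : forall k, spline_space Xi q (fun z => F z 0 k))
  (FOm : F @` open_cube d = Om) (FinvK : forall z, open_cube d z -> Finv (F z) = z)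
  (Finv_bd : forall J, bounded_derivatives_on Finv (F @` mesh_elem Xi J)) (Om_open : open Om).
Notation rvec n := (g_sigma_algebraType (@open 'rV[R]_n)).
Notation MI := {ffun 'I_d -> 'I_m}.
Hypothesis Om_bd : exists C, forall x, Om x -> `|x| <= C.
Context (qt : nat) (Th brt : seq R).
Hypotheses (brt2 : (2 <= size brt)%N) (brt_lt : sorted (fun a b : R => a < b) brt)
  (brt0 : head 0 brt = 0) (brt1 : last 0 brt = 1)
  (ThE : Th = nseq qt 0 ++ brt ++ nseq qt 1) (qt0 : (0 < qt)%N).
Context (T : R) (T0 : 0 < T).
Notation mu := (row_measure R d).
Notation leb := (@lebesgue_measure R).
Notation nB := (size Th - qt.+1)%N.
Notation K := #|{: MI * 'I_nB}|.
Notation cf c p := ((c : 'rV[R]_K) 0 (enum_rank p)).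
Notation bt := (bT qt Th T).
Notation oe := (open_elems (brT brt T)).
Notation oe_int f := (\int[leb]_x (\1_oe x * f x)).
Notation sts := (stspline q Xi (qt := qt) (Th := Th)).
Implicit Types (c e : 'rV[R]_K) (z : 'rV[R]_d).
Notation stiffc := (stiffc q Xi br F Finv Om).
Notation time_form := (time_form q Xi Finv Om brt T (qt := qt) (Th := Th)).
Notation reps := (reps q Xi F T (qt := qt) (Th := Th)).
Notation S := (trial_coefs (m := m) (qt := qt) (Th := Th) q Xi).
Notation S0 := (null_coefs (m := m) (qt := qt) (Th := Th) q Xi).
Let brTl : forall i j, (i < j)%N -> (j < size (brT brt T))%N -> (brT brt T)`_i < (brT brt T)`_j.
Proof. exact: brT_lt. Qed.
Let brT2' : (2 <= size (brT brt T))%N. Proof. exact: brT2. Qed.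
Let btpw j : pw_poly (brT brt T) (bt j).
Proof. exact: (bT_pw_poly brt2 brt_lt brt0 brt1 ThE qt0 T0). Qed.

Notation trial_fun := (trial_fun q Xi Finv T (qt := qt) (Th := Th)).

Lemma Vh_reps u : Vh Xi q Th qt F T u -> exists2 e, S e & reps u e.
Proof.
move=> [uh [uh_sp uh_bd uh_0 uE]].
have [e eE] := spline_spacetime_coef q0 Xi_m uh_sp.
exists e; first by split=> *; rewrite -eE; [exact: uh_bd | exact: uh_0].
by move=> z tau zc tr; rewrite uE // eE.
Qed.

Let rt c : reps (trial_fun c) c.
Proof. exact: reps_trial. Qed.

Lemma trial_fun_Vh c : S c -> Vh Xi q Th qt F T (trial_fun c).
Proof.
move=> [c_bd c_0]; exists (sts c); split => //; first exact: stspline_space.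
exact: rt.
Qed.

Let dt_E := int_Q_dt br2 br_lt br0 br1 XiE q0 Xi_m FS FOm FinvK Om_open Om_bd brt2 brt_lt brt0 brt1 ThE qt0 T0.

(** In dimension 0 the cube is a point with empty boundary and there is a single spatial index, so
    the trial functions are exactly the time splines that vanish at 0. *)
Lemma time_form_dim0_null e : d = 0%N -> S e -> (forall c, S c -> time_form c e = 0) -> S0 e.
Proof.
move=> d0 [_ e0] H.
have no (k : 'I_d) : False by case: k => i; rewrite d0.
have all_cube (z : 'rV[R]_d) : open_cube d z by move=> k; case: (no k).
have row0 (z : 'rV[R]_d) : z = 0 by apply/rowP => k; case: (no k).
pose I0 : MI := [ffun k => False_rect _ (no k)].
have Iu (I : MI) : I = I0 by apply/ffunP => k; case: (no k).
have stsE c z t : sts c z (t / T) = \sum_j cf c (I0, j) * bt j t.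
  rewrite /stspline /tspline (big_pred1 I0) => [|I]; last by rewrite /= (Iu I) eqxx.
  by rewrite /bspline_space big1 ?mulr1 // => k; case: (no k).
pose y (j : 'I_nB) := cf e (I0, j).
have main := @spline_deriv_orthogonal _ _ _ brT2' brTl (brT_lo brt0 T) qt0 nB _ (fun j : 'I_nB => bt j)
  (fun j => btpw j) (fun i => bT_tfam_span brt2 brt_lt brt0 brt1 ThE T0 (ltn_ord i)) y.
have nE : nB = (qt + (size (brT brt T)).-1)%N.
  by rewrite (size_knots ThE) size_brT; lia.
have y0 : \sum_j y j * bt j 0 = 0 by rewrite -(stsE e 0) mul0r e0.
have orth (w : 'I_nB -> R) : \sum_j w j * bt j 0 = 0 ->
    oe_int (fun x => derive1 (fun x => \sum_j w j * bt j x) x * (\sum_j y j * bt j x)) = 0.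
  move=> w0; pose c : 'rV[R]_K := \row_i w (enum_val i).2.
  have stsc z t : sts c z (t / T) = \sum_j w j * bt j t.
    by rewrite stsE; apply: eq_bigr => j _; rewrite mxE enum_rankK.
  have Sc : S c.
    split=> [z tau [_ nb] _|z _]; first by case: nb; exact: all_cube.
    by have := stsc z 0; rewrite mul0r => ->.
  rewrite -[RHS](H c Sc) -(dt_E (rt c) (rt e)).
  apply/esym/(int_Q_open_elems brt0 brt1) => t to; rewrite /int_Omega iint_dim0 // indicE mem_set ?mul1r.
    congr (_ * _); last by rewrite /trial_fun stsE.
    rewrite /dt; congr (derive1 _ t); apply/funext => s; exact: stsc.
  by rewrite -FOm; exists 0 => //; exact: row0.
move=> z tau _ tr; have -> : tau = (tau * T) / T by rewrite mulfK // gt_eqF.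
rewrite stsE; apply: (main nE y0 orth); rewrite brT_hi //.
case/andP: tr => h1 h2; apply/andP; split; first by apply: mulr_ge0; exact: ltW.
by rewrite ger_pMl // ltW.
Qed.

Lemma grad_form_dim0 a c e : d = 0%N -> grad_form q Xi br F Finv Om brt T a (qt := qt) (Th := Th) c e = 0.
Proof.
move=> d0; rewrite /grad_form big1 // => p _; rewrite big1 ?mulr0 // => p' _.
rewrite (_ : stiffc _ _ = 0) ?mul0r ?mulr0 //.
transitivity (\int[mu]_(x in [set: rvec d]) (0 : R)); last by rewrite Rintegral_cst // mul0r.
have no (k : 'I_d) : False by case: k => i; rewrite d0.
by apply: eq_Rintegral => x _; rewrite big1 // => k; case: (no k).
Qed.

End Assembly.

Unset Implicit Arguments. Set Strict Implicit. Set Printing Implicit Defensive.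

Theorem theorem4p2 (R : realType) (d : nat)
  (* spatial knot vectors (degree qs) and time knot vector (degree qt) *)
  (qs qt : nat) (Xi : 'I_d -> seq R) (Th : seq R)
  (hqs : (1 <= qs)%N) (hqt : (1 <= qt)%N)
  (hXi : forall k, open_knots qs (Xi k)) (hTh : open_knots qt Th)
  (* quasi-uniformity *)
  (alpha hs ht : R) (halpha : 0 < alpha < 1)
  (hXiq : forall k, quasi_uniform alpha hs (Xi k))
  (hThq : quasi_uniform alpha ht Th)
  (* geometry map and domain *)
  (F : 'rV[R]_d -> 'rV[R]_d) (Om : set 'rV[R]_d)
  (hF : forall k : 'I_d, spline_space Xi qs (fun z => F z 0 k))
  (hFinj : {in open_cube d &, injective F})
  (hFOm : F @` open_cube d = Om)
  (hFinv : exists Finv : 'rV[R]_d -> 'rV[R]_d,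
      (forall z, open_cube d z -> Finv (F z) = z) /\
      forall J : 'I_d -> nat,
        bounded_derivatives_on Finv (F @` mesh_elem Xi J))
  (hOm : lipschitz_domain Om)
  (T : R) (hT : 0 < T)
  (* diffusion coefficient *)
  (a : R -> R) (m M : R) (hm : 0 < m) (hmM : m <= M)
  (ha_lip : exists L : R, forall s s', `|a s - a s'| <= L * `|s - s'|)
  (ha_bd : forall s, m <= a s <= M)
  (* right-hand side *)
  (f : 'rV[R]_d -> R -> R) (hf : in_Z Om T f) :
  exists uh : 'rV[R]_d -> R -> R,
    Vh Xi qs Th qt F T uh /\
    forall vh : 'rV[R]_d -> R -> R, Vh Xi qs Th qt F T vh ->
      int_Q Om T (fun x t => dt uh x t * vh x t)
      + int_Q Om T (fun x t => a (int_Omega Om (fun y => uh y t))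
                               * grad_dot uh vh x t)
      = int_Q Om T (fun x t => f x t * vh x t).
Proof.
have H k := cid (hXi k); pose br k := sval (H k).
have br2 k : (2 <= size (br k))%N by case: (svalP (H k)).
have br_lt k : sorted (fun a b : R => a < b) (br k) by case: (svalP (H k)).
have br0 k : head 0 (br k) = 0 by case: (svalP (H k)).
have br1 k : last 0 (br k) = 1 by case: (svalP (H k)).
have XiE k : Xi k = nseq qs 0 ++ br k ++ nseq qs 1 by case: (svalP (H k)).
have [brt [brt2 brt_lt brt0 brt1 ThE]] := hTh.
have [Finv [FinvK Finv_bd]] := hFinv.
have [Om_open _ Om_bd _] := hOm.
have [La a_lip_ge0 a_lip] : exists2 La : R, 0 <= La & forall s s', `|a s - a s'| <= La * `|s - s'|.
  have [L HL] := ha_lip; exists `|L| => // s s'; apply: le_trans (HL s s') _.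
  by rewrite ler_wpM2r // ler_norm.
pose mm := \max_(k < d) size (Xi k).
have Xi_m k : (size (Xi k) <= mm)%N by exact: leq_bigmax.
have trialS := lin_subset_trial mm qs Xi qt Th.
have nullS := lin_subset_null mm qs Xi qt Th.
have dt_E := int_Q_dt br2 br_lt br0 br1 XiE hqs Xi_m hF hFOm FinvK Om_open Om_bd brt2 brt_lt brt0 brt1 ThE hqt hT.
have grad_E := int_Q_grad br2 br_lt br0 br1 XiE hqs Xi_m hF hFOm FinvK Finv_bd Om_open Om_bd brt2 brt_lt brt0 brt1 ThE hqt hT hm ha_bd a_lip_ge0 a_lip.
have load_E := int_Q_load br2 br_lt br0 br1 XiE hqs Xi_m hF hFOm FinvK Om_open Om_bd brt2 brt_lt brt0 brt1 ThE hqt hT hf.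
have [c Sc Hc] : exists2 c, trial_coefs (m := mm) (qt := qt) (Th := Th) qs Xi c &
    forall e, trial_coefs qs Xi e ->
      time_form qs Xi Finv Om brt T c e + grad_form qs Xi br F Finv Om brt T a c e =
      load qs Xi Finv Om T f e.
  have time0 := time_form_nullr br2 br_lt br0 br1 XiE hqs Xi_m hF hFOm FinvK Om_open Om_bd brt2 brt_lt brt0 brt1 ThE hqt hT.
  have grad0 := grad_form_nullr br2 br_lt br0 br1 XiE hqs Xi_m hF hFOm FinvK Finv_bd Om_open Om_bd brt2 brt_lt brt0 brt1 ThE hqt hT hm ha_bd a_lip_ge0 a_lip.
  have load0 := load_null br2 br_lt br0 br1 XiE hqs Xi_m hF hFOm FinvK Om_open Om_bd brt2 brt_lt brt0 brt1 ThE hqt hT hf.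
  (* In positive dimension [Ordinal dpos] provides the direction that definiteness of the energy
     needs. *)
  have [d0|dpos] := posnP d.
    have [c Sc Hc] := galerkin_linear trialS nullS
      (time_form_linr qs Xi Finv Om brt T) (load_lin qs Xi Finv Om T f) time0 load0
      (time_form_linl qs Xi Finv Om brt T)
      (fun c e => time_form_nulll br2 br_lt br0 br1 XiE hqs Xi_m hF hFOm FinvK Om_open Om_bd brt2 brt_lt brt0 brt1 ThE hqt hT e)
      (fun e => time_form_dim0_null br2 br_lt br0 br1 XiE hqs Xi_m hF hFOm FinvK Om_open Om_bd brt2 brt_lt brt0 brt1 ThE hqt hT d0).
    by exists c => // e Se; rewrite grad_form_dim0 // addr0 Hc.
  apply: (galerkin_coercive trialS nullS _ (load_lin qs Xi Finv Om T f) _ load0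
    (Q := energy qs Xi br F Finv Om brt T m)).
  - by move=> c b e e'; rewrite time_form_linr grad_form_linr mulrDr addrACA.
  - by move=> c e e0; rewrite time0 // grad0 // addr0.
  - move=> e; exact: (forms_continuous brt2 brt_lt brt0 brt1 ThE hqt hT hm ha_bd a_lip_ge0 a_lip).
  - exact: energy_continuous.
  - by move=> b c; exact: energy_scale.
  - move=> c; exact: (energy_le br2 br_lt br0 br1 XiE hqs Xi_m hF hFOm FinvK Finv_bd Om_open Om_bd brt2 brt_lt brt0 brt1 ThE hqt hT hm ha_bd a_lip_ge0 a_lip).
  - move=> c; exact: (energy_null br2 br_lt br0 br1 XiE hqs Xi_m hF hFOm FinvK Finv_bd Om_open Om_bd brt2 brt_lt brt0 brt1 ThE hqt hT hm (Ordinal dpos)).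
exists (trial_fun qs Xi Finv T c); split; first exact: (trial_fun_Vh FinvK hT Sc).
move=> vh /(Vh_reps hqs Xi_m)[e Se ve].
have uc := reps_trial qs Xi FinvK hT c.
by rewrite (dt_E _ _ _ _ uc ve) (grad_E _ _ _ _ uc ve) (load_E _ _ ve) Hc.
Qed.
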